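(* Let $\mathfrak X_0$ be an integral normal scheme which is flat of finite type over $\mathrm{Spec}\,\mathbb Z$ and let $\mathcal E$ be an admissible class of characters (with values in $\mathbb C^\times$) with $\mathcal E\supset\mathcal E_f$. Then the vector spaces $H^0_{\mathcal F}(X_\eta)$, $H^0_{\mathcal F}(X)$, $H^0_{\mathcal F}(X_{0\eta_0})$ and $H^0_{\mathcal F}(X_0)$ consist of constant functions only. Thus they are canonically isomorphic to $\mathbb R$ with trivial action of $G\times\mathbb R^{>0}$ (for $X_\eta$ and $X$), resp. of $\mathbb R^{>0}$ (for $X_{0\eta_0}$ and $X_0$).
   Context: Let $K_0$ be the function field of $\mathfrak X_0$, $K$ an algebraic closure, $\pi:\mathfrak X\to\mathfrak X_0$ the normalization of $\mathfrak X_0$ in $K$, $\eta=\mathrm{Spec}\,K$ and $\eta_0=\mathrm{Spec}\,K_0$ the generic points, $G=\mathrm{Aut}_{K_0}(K)$, acting on $\mathfrak X$ from the right over $\mathfrak X_0$ (with induced isomorphisms $\sigma:\kappa(x^\sigma)\to\kappa(x)$). $\mathcal N_0$ is the submonoid of the multiplicative monoid of positive integers generated by a set $\mathrm{char}\,\mathcal N_0$ of primes containing the set of positive residue characteristics of $\mathfrak X_0$; $\mathbb Q_0^{>0}\subset\mathbb Q^{>0}$ is the subgroup generated by $\mathcal N_0$. $\dot{\mathfrak X}(\mathbb C)$ is the set of pairs $(x,\bar P^\times)$, $x\in\mathfrak X$, $\bar P^\times:\kappa(x)^\times\to\mathbb C^\times$ a group homomorphism, with $(x,\bar P^\times)^\sigma=(x^\sigma,\bar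 P^\times\circ\sigma)$ for $\sigma\in G$ and injective maps $F_\nu(x,\bar P^\times)=(x,\bar P^\times\circ(\ )^\nu)$. A class $\mathcal E$ of characters $\chi:\kappa^\times\to\mathbb C^\times$ on algebraically closed fields $\kappa$ is admissible if it is invariant under isomorphisms $\tau:\kappa'\to\kappa$ of fields ($\chi\in\mathcal E\Leftrightarrow\chi\circ\tau\in\mathcal E$), if $\chi\in\mathcal E\Leftrightarrow\chi^\nu\in\mathcal E$ for all $\nu\in\mathcal N_0$, and if for every $\chi\in\mathcal E$ the group $\ker(\chi)_{\mathrm{tors}}$ is finite of order in $\mathcal N_0$. $\mathcal E_f$ is the class of characters $\chi$ with $\ker\chi$ finite and $|\ker\chi|\in\mathcal N_0$. $\dot{\mathfrak X}(\mathbb C)_{\mathcal E}=\{(x,\bar P^\times)\in\dot{\mathfrak X}(\mathbb C)\mid\bar P^\times\in\mathcal E\}$; $\check{\mathfrak X}(\mathbb C)=\mathrm{colim}_{\mathcal N_0}\dot{\mathfrak X}(\mathbb C)$ and $\check{\mathfrak X}(\mathbb C)_{\mathcal E}=\mathrm{colim}_{\mathcal N_0}\dot{\mathfrak X}(\mathbb C)_{\mathcal E}$ (over $\mathcal N_0$ ordered by divisibility, transition map from index $\nu$ to $\nu\mu$ being $F_\mu$), with the $\mathbb Q_0^{>0}$-action by the now bijective $F_\nu$; $\check{\mathfrak X}_0(\mathbb C)_{\mathcal E}=\check{\mathfrak X}(\mathbb C)_{\mathcal E}/G$. The projections $\mathrm{pr}_{\mathfrak X}:\check{\mathfrak X}(\mathbb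 C)_{\mathcal E}\to\mathfrak X$, $F_\nu^{-1}(x,\bar P^\times)\mapsto x$, and the induced $\mathrm{pr}_{\mathfrak X_0}:\check{\mathfrak X}_0(\mathbb C)_{\mathcal E}\to\mathfrak X_0$ are $\mathbb Q_0^{>0}$-invariant. Topologies: if $\mathfrak X_0=\mathrm{Spec}\,R_0$ is affine, $\mathfrak X=\mathrm{Spec}\,R$, identify $(x,\bar P^\times)$, $x$ corresponding to the prime $\mathfrak p$, with the multiplicative map $P:R\to\mathbb C$, $P(r)=\bar P^\times(r\bmod\mathfrak p)$ for $r\notin\mathfrak p$ and $P(r)=0$ for $r\in\mathfrak p$, and give $\dot{\mathfrak X}(\mathbb C)$ the topology of pointwise convergence. In general $O\subset\dot{\mathfrak X}(\mathbb C)$ is open iff its intersection with $\{(x,\bar P^\times)\mid x\in\pi^{-1}(\mathfrak X_0')\}$ is open there for every affine open $\mathfrak X_0'\subset\mathfrak X_0$. $\check{\mathfrak X}(\mathbb C)$ has the inductive limit topology ($Z$ is open iff $F_\nu(Z)\cap\dot{\mathfrak X}(\mathbb C)$ is open in $\dot{\mathfrak X}(\mathbb C)$ for all $\nu\in\mathcal N_0$), subsets the subspace topology, and quotients by $G$ the quotient topology. For a topological space $M$ with an action of $\mathbb Q_0^{>0}$ ($q\mapsto F_q$) let $\tilde X_M=M\times\mathbb R^{>0}$ with action $(m,u)q=(F_q(m),q^{-1}u)$ and $X_M=M\times_{\mathbb Q_0^{>0}}\mathbb R^{>0}$ its quotient, $p:\tilde X_M\to X_M$. $\mathcal R_{\tilde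 X_M}$ is the sheaf of continuous real valued functions $\tilde f$ on open sets $\tilde U\subset\tilde X_M$ such that for every $(m,u)\in\tilde U$ there is a neighborhood $V$ of $m$ in $M$ with $V\times\{u\}\subset\tilde U$ and $\tilde f(\cdot,u)$ constant on $V$; $\mathcal R_{X_M}=(p_*\mathcal R_{\tilde X_M})^{\mathbb Q_0^{>0}}$, a subsheaf of the sheaf of continuous real functions on $X_M$. The leafwise cohomology is $H^i_{\mathcal F}(X_M)=H^i(X_M,\mathcal R_{X_M})$, with the action of $\mathbb R^{>0}$ induced by $[m,u]v=[m,uv]$ and, for $X_\eta$ and $X$, of $G$. The spaces $X_\eta,X,X_{0\eta_0},X_0$ are $X_M$ for $M=\mathrm{pr}_{\mathfrak X}^{-1}(\eta),\ \check{\mathfrak X}(\mathbb C)_{\mathcal E},\ \mathrm{pr}_{\mathfrak X_0}^{-1}(\eta_0),\ \check{\mathfrak X}_0(\mathbb C)_{\mathcal E}$ respectively. *)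

(* Defs.v *)
From HB Require Import structures.
From mathcomp Require Import all_boot all_order all_algebra.
From mathcomp Require Import all_classical all_reals all_analysis.
From mathcomp Require Import complex.

Set Implicit Arguments.
Unset Strict Implicit.
Unset Printing Implicit Defensive.

Import Order.TTheory GRing.Theory Num.Theory.
Import numFieldNormedType.Exports.

Local Open Scope classical_set_scope.
Local Open Scope ring_scope.
Local Open Scope quotient_scope.
Local Open Scope card_scope.

Definition invertible (A : comPzRingType) (a : A) : Prop := exists b, a * b = 1.

Record localRing := LocalRing {
  local_carrier :> comPzRingType;
  local_nonzero : ~ invertible (0 : local_carrier);
  local_add : forall a b : local_carrier,
    ~ invertible a -> ~ invertible b -> ~ invertible (a + b)
}.

Section ResidueField.
Context (A : localRing).

Let res_rel : rel A := fun a b => `[< ~ invertible (a - b) >].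

Lemma nonunit_mul (a b : A) : ~ invertible a -> ~ invertible (a * b).
Proof. by move=> na [c abc]; apply: na; exists (b * c); rewrite mulrA. Qed.

Let res_refl : reflexive res_rel.
Proof. by move=> a; apply/asboolP; rewrite subrr; apply: local_nonzero. Qed.
Let res_sym : symmetric res_rel.
Proof.
suff H a b : res_rel a b -> res_rel b a by move=> a b; apply/idP/idP; apply: H.
move=> /asboolP nab; apply/asboolP.
by rewrite -opprB -mulN1r mulrC; apply: nonunit_mul.
Qed.
Let res_trans : transitive res_rel.
Proof.
move=> b a c /asboolP nab /asboolP nbc; apply/asboolP.
by rewrite -(subrK b a) -addrA; apply: local_add.
Qed.

Canonical res_equiv := EquivRel res_rel res_refl res_sym res_trans.

Definition residue_field := {eq_quot res_equiv}.
HB.instance Definition _ := Choice.on residue_field.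
HB.instance Definition _ := EqQuotient.on residue_field.

Let pi (a : A) : residue_field := \pi_residue_field a.

Lemma residueP (a b : A) : pi a = pi b <-> ~ invertible (a - b).
Proof.
split=> [/eqmodP/asboolP//|nab]; apply/eqmodP; exact/asboolP.
Qed.

Let resW (P : residue_field -> Prop) : (forall a, P (pi a)) -> forall x, P x.
Proof. by move=> h x; rewrite -[x]reprK. Qed.

Let repr_res (a : A) : ~ invertible (repr (pi a) - a).
Proof. by apply/residueP; rewrite /pi reprK. Qed.

Let add (x y : residue_field) := pi (repr x + repr y).
Let opp (x : residue_field) := pi (- repr x).
Let mul (x y : residue_field) := pi (repr x * repr y).
Let inv (x : residue_field) :=
  if pselect (exists b, repr x * b = 1) is left h then pi (projT1 (cid h)) else pi 0.

Let addE a b : add (pi a) (pi b) = pi (a + b).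
Proof.
apply/residueP; rewrite opprD addrACA; apply: local_add; exact: repr_res.
Qed.
Let oppE a : opp (pi a) = pi (- a).
Proof.
apply/residueP; rewrite -opprD -mulN1r mulrC.
by apply: nonunit_mul; apply: repr_res.
Qed.
Let mulE a b : mul (pi a) (pi b) = pi (a * b).
Proof.
apply/residueP; set a' := repr _; set b' := repr _.
have -> : a' * b' - a * b = (a' - a) * b' + (b' - b) * a.
  by rewrite mulrBl mulrBl (mulrC b' a) (mulrC b a) addrA subrK.
by apply: local_add; apply: nonunit_mul; apply: repr_res.
Qed.

Let addA : associative add.
Proof.
by elim/resW=> a; elim/resW=> b; elim/resW=> c; rewrite !addE addrA.
Qed.
Let addC : commutative add.
Proof. by elim/resW=> a; elim/resW=> b; rewrite !addE addrC. Qed.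
Let add0 : left_id (pi 0) add.
Proof. by elim/resW=> a; rewrite addE add0r. Qed.
Let addN : left_inverse (pi 0) opp add.
Proof. by elim/resW=> a; rewrite oppE addE addNr. Qed.
HB.instance Definition _ :=
  GRing.isZmodule.Build residue_field addA addC add0 addN.

Let mulA : associative mul.
Proof.
by elim/resW=> a; elim/resW=> b; elim/resW=> c; rewrite !mulE mulrA.
Qed.
Let mulC : commutative mul.
Proof. by elim/resW=> a; elim/resW=> b; rewrite !mulE mulrC. Qed.
Let mul1 : left_id (pi 1) mul.
Proof. by elim/resW=> a; rewrite mulE mul1r. Qed.
Let mulDl : left_distributive mul add.
Proof.
by elim/resW=> a; elim/resW=> b; elim/resW=> c; rewrite !(mulE, addE) mulrDl.
Qed.
Let one_neq0 : pi 1 != 0 :> residue_field.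
Proof.
by apply/eqP => /residueP; apply; rewrite subr0; exists 1; rewrite mulr1.
Qed.
HB.instance Definition _ :=
  GRing.Zmodule_isComNzRing.Build residue_field mulA mulC mul1 mulDl one_neq0.

Let mulV (x : residue_field) : x != 0 -> inv x * x = 1.
Proof.
rewrite /inv => x0; case: pselect => [h|nh].
  case: cid => b /= xb; rewrite -[X in _ * X]reprK.
  by rewrite [_ * _]mulE mulrC xb.
by case/eqP: x0; rewrite -[x]reprK; apply/residueP; rewrite subr0.
Qed.
Let inv0 : inv 0 = 0.
Proof.
rewrite /inv; case: pselect => // h; exfalso.
by apply: (@repr_res 0); rewrite subr0.
Qed.
HB.instance Definition _ := GRing.ComNzRing_isField.Build residue_field mulV inv0.

Definition residue (a : A) : residue_field := \pi_residue_field a.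
Let residueB : {morph residue : a b / a - b}.
Proof. by move=> a b; rewrite -[RHS]/(add (pi a) (opp (pi b))) oppE addE. Qed.
Let residueM : monoid_morphism residue.
Proof. by split=> // a b; rewrite -[RHS]/(mul (pi a) (pi b)) mulE. Qed.
HB.instance Definition _ := GRing.isZmodMorphism.Build A residue_field residue residueB.
HB.instance Definition _ := GRing.isMonoidMorphism.Build A residue_field residue residueM.

Lemma residue_eq0 (a : A) : residue a = 0 <-> ~ invertible a.
Proof. by rewrite -[X in invertible X]subr0 -residueP. Qed.

Lemma residue_surj (x : residue_field) : exists a, residue a = x.
Proof. by exists (repr x); apply: reprK. Qed.

End ResidueField.

Record opens (X : topologicalType) := Opens {
  oset :> set X;
  oset_open : open oset
}.

Definition opensI (X : topologicalType) (U V : opens X) : opens X :=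
  Opens (openI (oset_open U) (oset_open V)).

Record ringedSpace := RingedSpace {
  rs_space :> topologicalType;
  sec : opens rs_space -> comPzRingType;
  res : forall U V : opens rs_space, V `<=` U -> {rmorphism sec U -> sec V};
  res_id : forall (U : opens rs_space) (h : U `<=` U) (s : sec U), res h s = s;
  res_res : forall (U V W : opens rs_space) (hVU : V `<=` U) (hWV : W `<=` V)
    (hWU : W `<=` U) (s : sec U), res hWV (res hVU s) = res hWU s;
  sheaf_separated : forall (U : opens rs_space) (I : Type)
    (V : I -> opens rs_space) (h : forall i, V i `<=` U),
    U `<=` \bigcup_i V i ->
    forall s t : sec U, (forall i, res (h i) s = res (h i) t) -> s = t;
  sheaf_glue : forall (U : opens rs_space) (I : Type)
    (V : I -> opens rs_space) (h : forall i, V i `<=` U),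
    U `<=` \bigcup_i V i ->
    forall s : forall i, sec (V i),
    (forall i j (W : opens rs_space) (hi : W `<=` V i) (hj : W `<=` V j),
       res hi (s i) = res hj (s j)) ->
    exists t : sec U, forall i, res (h i) t = s i
}.
Arguments sec : clear implicits.
Arguments sec {X} U : rename.

Section Stalk.
Context (X : ringedSpace) (x : X).

Record pregerm := PreGerm {
  germ_dom : opens X;
  germ_in : oset germ_dom x;
  germ_sec : sec germ_dom
}.
HB.instance Definition _ := gen_eqMixin pregerm.
HB.instance Definition _ := gen_choiceMixin pregerm.

Let germ_rel : rel pregerm := fun a b =>
  `[< exists (W : opens X) (_ : oset W x)
        (ha : W `<=` germ_dom a) (hb : W `<=` germ_dom b),
      res ha (germ_sec a) = res hb (germ_sec b) >].

Let germ_refl : reflexive germ_rel.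
Proof.
by move=> a; apply/asboolP; exists (germ_dom a), (germ_in a), (fun=> id), (fun=> id).
Qed.
Let germ_sym : symmetric germ_rel.
Proof.
by move=> a b; apply/idP/idP => /asboolP[W [Wx [ha [hb e]]]]; apply/asboolP;
  exists W, Wx, hb, ha.
Qed.
Let germ_trans : transitive germ_rel.
Proof.
move=> b a c /asboolP[U [Ux [hUa [hUb eU]]]] /asboolP[V [Vx [hVb [hVc eV]]]].
apply/asboolP; pose W := opensI U V.
have hU : W `<=` U by move=> y [].
have hV : W `<=` V by move=> y [].
exists W, (conj Ux Vx), (subset_trans hU hUa), (subset_trans hV hVc).
rewrite -(res_res hUa hU) eU (res_res hUb hU (subset_trans hU hUb)).
by rewrite -(res_res hVc hV) -eV (res_res hVb hV (subset_trans hU hUb)).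
Qed.

Canonical germ_equiv := EquivRel germ_rel germ_refl germ_sym germ_trans.

Definition stalk := {eq_quot germ_equiv}.
HB.instance Definition _ := Choice.on stalk.
HB.instance Definition _ := EqQuotient.on stalk.

Definition germ (U : opens X) (hx : oset U x) (s : sec U) : stalk :=
  \pi_stalk (PreGerm hx s).

Lemma germP (U V : opens X) (hU : oset U x) (hV : oset V x)
    (s : sec U) (t : sec V) :
  germ hU s = germ hV t <->
  exists (W : opens X) (_ : oset W x) (hWU : W `<=` U) (hWV : W `<=` V),
    res hWU s = res hWV t.
Proof.
by split=> [/eqmodP/asboolP//|h]; apply/eqmodP; apply/asboolP.
Qed.

Lemma germ_res (U V : opens X) (hU : oset U x) (hV : oset V x)
    (h : V `<=` U) (s : sec U) : germ hV (res h s) = germ hU s.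
Proof. by apply/germP; exists V, hV, (fun=> id), h; rewrite res_id. Qed.

Lemma germ_surj (a : stalk) :
  exists (U : opens X) (hU : oset U x) (s : sec U), germ hU s = a.
Proof.
by exists _, (germ_in (repr a)), (germ_sec (repr a)); case: (repr a) (reprK a).
Qed.

Let germ_surj2 (a b : stalk) : exists (U : opens X) (hU : oset U x)
  (s t : sec U), germ hU s = a /\ germ hU t = b.
Proof.
have [U [hU [s <-]]] := germ_surj a; have [V [hV [t <-]]] := germ_surj b.
have h1 : opensI U V `<=` U by move=> y [].
have h2 : opensI U V `<=` V by move=> y [].
by exists (opensI U V), (conj hU hV), (res h1 s), (res h2 t); rewrite !germ_res.
Qed.

Let germ_surj3 (a b c : stalk) : exists (U : opens X) (hU : oset U x)
  (s t r : sec U), [/\ germ hU s = a, germ hU t = b & germ hU r = c].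
Proof.
have [U [hU [s [t [<- <-]]]]] := germ_surj2 a b.
have [V [hV [r <-]]] := germ_surj c.
have h1 : opensI U V `<=` U by move=> y [].
have h2 : opensI U V `<=` V by move=> y [].
exists (opensI U V), (conj hU hV), (res h1 s), (res h1 t), (res h2 r).
by rewrite !germ_res.
Qed.

Let subIl (U V : opens X) : opensI U V `<=` U. Proof. by move=> y []. Qed.
Let subIr (U V : opens X) : opensI U V `<=` V. Proof. by move=> y []. Qed.

Let lift2 (op : forall U : opens X, sec U -> sec U -> sec U) (a b : stalk) :=
  germ (conj (germ_in (repr a)) (germ_in (repr b)) :
          oset (opensI (germ_dom (repr a)) (germ_dom (repr b))) x)
    (op _ (res (@subIl _ _) (germ_sec (repr a)))
          (res (@subIr _ _) (germ_sec (repr b)))).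

Let lift2E (op : forall U : opens X, sec U -> sec U -> sec U) :
  (forall (U V : opens X) (h : V `<=` U) (s t : sec U),
     res h (op U s t) = op V (res h s) (res h t)) ->
  forall (U : opens X) (hU : oset U x) (s t : sec U),
    lift2 op (germ hU s) (germ hU t) = germ hU (op U s t).
Proof.
move=> opres U hU s t; rewrite /lift2.
case ea: (repr (germ hU s)) => [A hA s'].
case eb: (repr (germ hU t)) => [B hB t'] /=.
have /germP[V [Vx [hVA [hVU e1]]]] : germ hA s' = germ hU s.
  by rewrite /germ -ea reprK.
have /germP[W [Wx [hWB [hWU e2]]]] : germ hB t' = germ hU t.
  by rewrite /germ -eb reprK.
apply/germP; pose Z := opensI V W.
have hZV : Z `<=` V by move=> y [].
have hZW : Z `<=` W by move=> y [].
have hZ : Z `<=` opensI A B by move=> y [/hVA ? /hWB ?].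
exists Z, (conj Vx Wx), hZ, (subset_trans hZV hVU).
rewrite !opres !(res_res _ _ (subset_trans hZV hVA))
  !(res_res _ _ (subset_trans hZW hWB)).
rewrite -(res_res hVA hZV) e1 -(res_res hWB hZW) e2.
by rewrite !(res_res _ _ (subset_trans hZV hVU)).
Qed.

Let add := lift2 (fun U => +%R).
Let mul := lift2 (fun U => *%R).
Let opp := lift2 (fun U _ t => - t) (germ (I : oset (Opens openT) x) 0).

Let addE (U : opens X) (hU : oset U x) (s t : sec U) :
  add (germ hU s) (germ hU t) = germ hU (s + t).
Proof. by apply: lift2E => *; rewrite rmorphD. Qed.
Let mulE (U : opens X) (hU : oset U x) (s t : sec U) :
  mul (germ hU s) (germ hU t) = germ hU (s * t).
Proof. by apply: lift2E => *; rewrite rmorphM. Qed.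
Let oppE (U : opens X) (hU : oset U x) (s : sec U) :
  opp (germ hU s) = germ hU (- s).
Proof.
have hT : U `<=` Opens openT by [].
rewrite /opp -(germ_res (I : oset (Opens openT) x) hU hT) lift2E //.
by move=> *; rewrite rmorphN.
Qed.

Let zero : stalk := germ (I : oset (Opens openT) x) 0.
Let one : stalk := germ (I : oset (Opens openT) x) 1.
Let zeroE (U : opens X) (hU : oset U x) : zero = germ hU 0.
Proof.
have hT : U `<=` Opens openT by [].
by rewrite /zero -(germ_res _ hU hT) rmorph0.
Qed.
Let oneE (U : opens X) (hU : oset U x) : one = germ hU 1.
Proof.
have hT : U `<=` Opens openT by [].
by rewrite /one -(germ_res _ hU hT) rmorph1.
Qed.

Let addA : associative add.
Proof.
move=> a b c; have [U [hU [s [t [r [<- <- <-]]]]]] := germ_surj3 a b c.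
by rewrite !addE addrA.
Qed.
Let addC : commutative add.
Proof.
move=> a b; have [U [hU [s [t [<- <-]]]]] := germ_surj2 a b.
by rewrite !addE addrC.
Qed.
Let add0 : left_id zero add.
Proof.
move=> a; have [U [hU [s <-]]] := germ_surj a.
by rewrite (zeroE hU) addE add0r.
Qed.
Let addN : left_inverse zero opp add.
Proof.
move=> a; have [U [hU [s <-]]] := germ_surj a.
by rewrite oppE addE addNr -zeroE.
Qed.
HB.instance Definition _ := GRing.isZmodule.Build stalk addA addC add0 addN.

Let mulA : associative mul.
Proof.
move=> a b c; have [U [hU [s [t [r [<- <- <-]]]]]] := germ_surj3 a b c.
by rewrite !mulE mulrA.
Qed.
Let mulC : commutative mul.
Proof.
move=> a b; have [U [hU [s [t [<- <-]]]]] := germ_surj2 a b.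
by rewrite !mulE mulrC.
Qed.
Let mul1 : left_id one mul.
Proof.
move=> a; have [U [hU [s <-]]] := germ_surj a.
by rewrite (oneE hU) mulE mul1r.
Qed.
Let mulDl : left_distributive mul add.
Proof.
move=> a b c; have [U [hU [s [t [r [<- <- <-]]]]]] := germ_surj3 a b c.
by rewrite !(mulE, addE) mulrDl.
Qed.
HB.instance Definition _ :=
  GRing.Zmodule_isComPzRing.Build stalk mulA mulC mul1 mulDl.

Section GermMorphism.
Context (U : opens X) (hU : oset U x).
Let germB : {morph germ hU : s t / s - t}.
Proof. by move=> s t; rewrite -[RHS]/(add _ (opp _)) oppE addE. Qed.
Let germM : monoid_morphism (germ hU).
Proof. by split=> [|s t]; [rewrite -oneE|rewrite -[RHS]/(mul _ _) mulE]. Qed.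
HB.instance Definition _ := GRing.isZmodMorphism.Build (sec U) stalk (germ hU) germB.
HB.instance Definition _ := GRing.isMonoidMorphism.Build (sec U) stalk (germ hU) germM.
End GermMorphism.

End Stalk.

Record locallyRingedSpace := LocallyRingedSpace {
  lrs_space :> ringedSpace;
  stalk_add : forall (x : lrs_space) (a b : stalk x),
    ~ invertible a -> ~ invertible b -> ~ invertible (a + b);
  stalk_nonzero : forall x : lrs_space, ~ invertible (0 : stalk x)
}.

Section Residue.
Context (X : locallyRingedSpace) (x : X).

Definition local_stalk : localRing :=
  LocalRing (@stalk_nonzero X x) (@stalk_add X x).

(* The residue field; at the generic point of an integral scheme, whose local
   ring is a field, it is the function field. *)
Definition kappa : fieldType := residue_field local_stalk.

Definition eval (U : opens X) (hx : oset U x) : sec U -> kappa :=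
  @residue local_stalk \o germ hx.
HB.instance Definition _ (U : opens X) (hx : oset U x) :=
  GRing.RMorphism.on (eval hx).

Lemma eval_surj (a : kappa) :
  exists (U : opens X) (hx : oset U x) (s : sec U), eval hx s = a.
Proof.
have [b <-] := residue_surj a; have [U [hx [s <-]]] := germ_surj b.
by exists U, hx, s.
Qed.

Lemma eval_res (U V : opens X) (hU : oset U x) (hV : oset V x)
    (h : V `<=` U) (s : sec U) : eval hV (res h s) = eval hU s.
Proof. by rewrite /eval /= (germ_res hU). Qed.

Lemma eval_surj2 (a b : kappa) : exists (U : opens X) (hU : oset U x)
  (s t : sec U), eval hU s = a /\ eval hU t = b.
Proof.
have [U [hU [s <-]]] := eval_surj a; have [V [hV [t <-]]] := eval_surj b.
have h1 : opensI U V `<=` U by move=> y [].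
have h2 : opensI U V `<=` V by move=> y [].
by exists (opensI U V), (conj hU hV), (res h1 s), (res h2 t); rewrite !eval_res.
Qed.

End Residue.

Definition preim (X Y : topologicalType) (f : X -> Y) (cf : continuous f)
    (V : opens Y) : opens X :=
  Opens (open_comp (fun x _ => cf x) (oset_open V)).

Record morphism (X Y : locallyRingedSpace) := Morphism {
  mor_fun :> X -> Y;
  mor_cont : continuous mor_fun;
  mor_sec : forall V : opens Y, {rmorphism sec V -> sec (preim mor_cont V)};
  mor_res : forall (V W : opens Y) (h : W `<=` V)
    (h' : preim mor_cont W `<=` preim mor_cont V) (s : sec V),
    mor_sec W (res h s) = res h' (mor_sec V s);
  mor_local : forall (x : X) (V : opens Y) (hx : oset V (mor_fun x))
    (hx' : oset (preim mor_cont V) x) (s : sec V),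
    eval hx s = 0 -> eval hx' (mor_sec V s) = 0
}.

Notation mpreim f V := (preim (@mor_cont _ _ f) V).
Arguments mor_sec {X Y} f {V} : rename.

Section KappaMap.
Context (X Y : locallyRingedSpace) (f : morphism X Y) (x : X).

Let kappa_repr (a : kappa (f x)) :
  exists p : pregerm (f x), eval (germ_in p) (germ_sec p) = a.
Proof.
by have [U [hx [s <-]]] := eval_surj a; exists (PreGerm hx s).
Qed.

Definition kappa_map (a : kappa (f x)) : kappa x :=
  let p := projT1 (cid (kappa_repr a)) in
  eval (germ_in p : oset (mpreim f (germ_dom p)) x) (mor_sec f (germ_sec p)).

Lemma kappa_mapE (V : opens Y) (hx : oset V (f x))
    (hx' : oset (mpreim f V) x) (s : sec V) :
  kappa_map (eval hx s) = eval hx' (mor_sec f s).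
Proof.
rewrite /kappa_map; case: cid => -[U hU t] /= e.
pose W := opensI U V.
have hWU : W `<=` U by move=> y [].
have hWV : W `<=` V by move=> y [].
have hWU' : mpreim f W `<=` mpreim f U by move=> y [].
have hWV' : mpreim f W `<=` mpreim f V by move=> y [].
have hW : oset W (f x) by [].
have hW' : oset (mpreim f W) x by [].
rewrite -[LHS](eval_res (hU : oset (mpreim f U) x) hW' hWU') -(eval_res hx' hW' hWV').
rewrite -(mor_res hWV hWV') -(mor_res hWU hWU').
apply/eqP; rewrite -subr_eq0 -!rmorphB; apply/eqP.
apply: (@mor_local _ _ f x W hW hW').
by rewrite rmorphB /= (eval_res hU) (eval_res hx) e subrr.
Qed.

Let kappa_mapB : {morph kappa_map : a b / a - b}.
Proof.
move=> a b; have [U [hx [s [t [<- <-]]]]] := eval_surj2 a b.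
have hx' : oset (mpreim f U) x by [].
by rewrite -rmorphB !(kappa_mapE hx hx') !rmorphB.
Qed.
Let kappa_mapM : monoid_morphism kappa_map.
Proof.
split=> [|a b].
  have hT : oset (Opens openT) (f x) by [].
  have hT' : oset (mpreim f (Opens openT)) x by [].
  by rewrite -(rmorph1 (eval hT)) (kappa_mapE hT hT') !rmorph1.
have [U [hx [s [t [<- <-]]]]] := eval_surj2 a b.
have hx' : oset (mpreim f U) x by [].
by rewrite -rmorphM !(kappa_mapE hx hx') !rmorphM.
Qed.
HB.instance Definition _ :=
  GRing.isZmodMorphism.Build (kappa (f x)) (kappa x) kappa_map kappa_mapB.
HB.instance Definition _ :=
  GRing.isMonoidMorphism.Build (kappa (f x)) (kappa x) kappa_map kappa_mapM.

End KappaMap.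
Arguments kappa_map {X Y} f x a.

(* equality of morphisms, avoiding transport along the equality of the
   underlying maps *)
Definition mor_eq (X Y : locallyRingedSpace) (f g : morphism X Y) : Prop :=
  f =1 g /\
  forall (V : opens Y) (s : sec V) (W : opens X)
    (hf : W `<=` mpreim f V) (hg : W `<=` mpreim g V),
    res hf (mor_sec f s) = res hg (mor_sec g s).

Section Composition.
Context (X Y Z : locallyRingedSpace).

Let id_cont : continuous (@id X). Proof. by move=> x. Qed.
Let id_sub (V : opens X) : preim id_cont V `<=` V. Proof. by []. Qed.
Let id_res (V W : opens X) (h : W `<=` V)
    (h' : preim id_cont W `<=` preim id_cont V) (s : sec V) :
  res (id_sub (V := W)) (res h s) = res h' (res (id_sub (V := V)) s).
Proof. by rewrite !(res_res _ _ (h' : preim id_cont W `<=` V)). Qed.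
Let id_local (x : X) (V : opens X) (hx : oset V (id x))
    (hx' : oset (preim id_cont V) x) (s : sec V) :
  eval hx s = 0 -> eval hx' (res (id_sub (V := V)) s) = 0.
Proof. by rewrite (eval_res hx). Qed.

Definition mor_id : morphism X X :=
  @Morphism X X id id_cont (fun V => res (id_sub (V := V))) id_res id_local.

Context (g : morphism Y Z) (f : morphism X Y).

Let comp_cont : continuous (g \o f).
Proof. by move=> x; apply: continuous_comp; apply: mor_cont. Qed.
Let comp_sub (V : opens Z) : preim comp_cont V `<=` mpreim f (mpreim g V).
Proof. by []. Qed.
Let comp_sec (V : opens Z) : {rmorphism sec V -> sec (preim comp_cont V)} :=
  res (comp_sub (V := V)) \o (@mor_sec _ _ f (mpreim g V) \o @mor_sec _ _ g V).
Let comp_res (V W : opens Z) (h : W `<=` V)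
    (h' : preim comp_cont W `<=` preim comp_cont V) (s : sec V) :
  comp_sec W (res h s) = res h' (comp_sec V s).
Proof.
have h1 : mpreim g W `<=` mpreim g V by move=> y /h.
have h2 : mpreim f (mpreim g W) `<=` mpreim f (mpreim g V) by move=> y /h1.
rewrite /comp_sec /= (mor_res _ h1) (mor_res _ h2).
by rewrite !(res_res _ _ (h' : preim comp_cont W `<=` mpreim f (mpreim g V))).
Qed.
Let comp_local (x : X) (V : opens Z) (hx : oset V (g (f x)))
    (hx' : oset (preim comp_cont V) x) (s : sec V) :
  eval hx s = 0 -> eval hx' (comp_sec V s) = 0.
Proof.
have hx1 : oset (mpreim f (mpreim g V)) x by [].
have hx2 : oset (mpreim g V) (f x) by [].
move=> e; rewrite /comp_sec /= (eval_res hx1).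
apply: (@mor_local _ _ f x _ hx2); exact: (@mor_local _ _ g (f x) V hx).
Qed.

Definition mor_comp : morphism X Z :=
  @Morphism X Z (g \o f) comp_cont comp_sec comp_res comp_local.

End Composition.

Record primeIdeal (A : comPzRingType) := PrimeIdeal {
  prime_set :> set A;
  prime0 : prime_set 0;
  primeD : forall a b, prime_set a -> prime_set b -> prime_set (a + b);
  primeMl : forall a b, prime_set b -> prime_set (a * b);
  prime1 : ~ prime_set 1;
  primeM : forall a b, prime_set (a * b) -> prime_set a \/ prime_set b
}.

Section Spec.
Context (A : comPzRingType).

Definition spec := primeIdeal A.
HB.instance Definition _ := gen_eqMixin spec.
HB.instance Definition _ := gen_choiceMixin spec.

Definition basic_open (f : A) : set spec := [set p : spec | ~ prime_set p f].

Definition spec_open (U : set spec) : Prop :=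
  exists S : set A, U = \bigcup_(f in S) basic_open f.

Let spec_openT : spec_open setT.
Proof.
exists [set 1]; apply/seteqP; split=> // p _; exists 1 => //; exact: prime1.
Qed.
Let spec_openI : setI_closed spec_open.
Proof.
move=> _ _ [S ->] [T ->].
exists [set h | exists2 f, S f & exists2 g, T g & h = f * g].
apply/seteqP; split=> p.
  move=> [[f Sf pf] [g Tg pg]]; exists (f * g); first by exists f => //; exists g.
  by move=> /primeM[].
move=> [_ [f Sf [g Tg ->]] pfg]; split.
  by exists f => // pf; apply: pfg; rewrite mulrC; apply: primeMl.
by exists g => // pg; apply: pfg; apply: primeMl.
Qed.
Let spec_open_bigU (I : Type) (F : I -> set spec) :
  (forall i, spec_open (F i)) -> spec_open (\bigcup_i F i).
Proof.
move=> oF; exists [set f | exists i, basic_open f `<=` F i].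
apply/seteqP; split=> p; last by move=> [f [i hf] pf]; exists i => //; apply: hf.
move=> [i _]; have [S e] := oF i; rewrite e => -[f Sf pf].
by exists f => //; exists i; rewrite e => q qf; exists f.
Qed.
HB.instance Definition _ :=
  isOpenTopological.Build spec spec_openT spec_openI spec_open_bigU.

End Spec.

Definition is_localization (A B : comPzRingType) (f : A) (g : {rmorphism A -> B}) : Prop :=
  [/\ invertible (g f),
      forall b, exists (n : nat) (a : A), g f ^+ n * b = g a &
      forall a, g a = 0 -> exists n : nat, f ^+ n * a = 0].

(* [(U, O_X|U)] is isomorphic to [Spec (O_X U)] with its structure sheaf: the
   latter is the sheaf whose sections over [D(f)] are [(O_X U)_f], so that an
   isomorphism is a homeomorphism [phi] onto [U] such that restriction from [U]
   to the image of [D(f)] is a localization at [f]. *)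
Definition affine (X : ringedSpace) (U : opens X) : Prop :=
  exists phi : spec (sec U) -> X,
    [/\ injective phi, range phi = U,
        forall V : set X, V `<=` U -> (open V <-> open (phi @^-1` V)) &
        forall (f : sec U) (V : opens X) (h : V `<=` U),
          phi @^-1` V = basic_open f -> is_localization f (res h)].

Record scheme := Scheme {
  scheme_space :> locallyRingedSpace;
  scheme_affine : forall x : scheme_space,
    exists2 U : opens scheme_space, affine U & oset U x
}.

Definition domain (A : comPzRingType) : Prop :=
  (1 : A) <> 0 /\ forall a b : A, a * b = 0 -> a = 0 \/ b = 0.

(* [A] is a domain and contains every element [a / b] of its fraction field
   which is integral over [A] *)
Definition normal_domain (A : comPzRingType) : Prop :=
  domain A /\
  forall a b : A, b <> 0 ->
    (exists (n : nat) (c : nat -> A),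
       a ^+ n.+1 + \sum_(i < n.+1) c i * a ^+ i * b ^+ (n.+1 - i) = 0) ->
    exists c, a = c * b.

Definition integral_scheme (X : scheme) : Prop :=
  [set: X] !=set0 /\ forall U : opens X, U !=set0 -> domain (sec U).

Definition normal_scheme (X : scheme) : Prop :=
  forall x : X, normal_domain (stalk x).

(* [\sum n_i \otimes m_i = 0] in [N \otimes_Z M], by the universal property of
   the tensor product *)
Definition biadditive (N M P : zmodType) (b : N -> M -> P) : Prop :=
  (forall m, {morph b^~ m : x y / x + y}) /\ (forall n, {morph b n : x y / x + y}).

Definition tensor_eq0 (N M : zmodType) (t : seq (N * M)) : Prop :=
  forall (P : zmodType) (b : N -> M -> P), biadditive b ->
    \sum_(p <- t) b p.1 p.2 = 0.

Definition flat_Zmodule (M : zmodType) : Prop :=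
  forall (N N' : zmodType) (j : {additive N -> N'}), injective j ->
  forall t : seq (N * M),
    tensor_eq0 [seq (j p.1, p.2) | p <- t] -> tensor_eq0 t.

(* Flatness over [Spec Z]; a module over a localization of [Z] is flat over it
   if and only if it is flat over [Z]. *)
Definition flat_over_Z (X : scheme) : Prop := forall x : X, flat_Zmodule (stalk x).

Definition finitely_generated_ring (A : comPzRingType) : Prop :=
  exists s : seq A, forall S : {pred A},
    GRing.subring_closed S -> {subset s <= S} -> forall a, a \in S.

Definition finite_type_over_Z (X : scheme) : Prop :=
  compact [set: X] /\
  forall x : X, exists U : opens X,
    [/\ affine U, oset U x & finitely_generated_ring (sec U)].

Definition generic_point (X : scheme) (eta : X) : Prop := closure [set eta] = setT.

Definition integral_over_image (A : comPzRingType) (K : fieldType) (f : A -> K)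
    (z : K) : Prop :=
  exists p : {poly K}, [/\ p \is monic, forall i, range f p`_i & root p z].

Record galois (F K : fieldType) (iota : {rmorphism F -> K}) := Galois {
  galois_fun :> K -> K;
  galoisB : {morph galois_fun : x y / x - y};
  galoisM : monoid_morphism galois_fun;
  galois_bij : bijective galois_fun;
  galois_fix : forall a, galois_fun (iota a) = iota a
}.

Section GaloisGroup.
Context (F K : fieldType) (iota : {rmorphism F -> K}).
Local Notation G := (galois iota).

Lemma galois_eq (s t : G) : s =1 t -> s = t.
Proof.
case: s t => [s sB sM sb sf] [t tB tM tb tf] /= /funext e; subst t.
by congr Galois; apply: Prop_irrelevance.
Qed.

Definition galois_one : G :=
  @Galois F K iota id (fun _ _ => erefl) (erefl, fun _ _ => erefl)
    (Bijective (fun _ => erefl) (fun _ => erefl)) (fun _ => erefl).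

Let mulB (s t : G) : {morph s \o t : x y / x - y}.
Proof. by move=> x y /=; rewrite galoisB galoisB. Qed.
Let mulM (s t : G) : monoid_morphism (s \o t).
Proof.
split=> [|x y] /=; first by rewrite (galoisM t).1 (galoisM s).1.
by rewrite (galoisM t).2 (galoisM s).2.
Qed.
Let mul_fix (s t : G) (a : F) : s (t (iota a)) = iota a.
Proof. by rewrite !galois_fix. Qed.

Definition galois_mul (s t : G) : G :=
  Galois (mulB s t) (mulM s t) (bij_comp (galois_bij s) (galois_bij t)) (mul_fix s t).

Lemma galois_inv_ex (s : G) : exists t : G, galois_mul t s = galois_one /\ galois_mul s t = galois_one.
Proof.
have [t st ts] := galois_bij s.
have tB : {morph t : x y / x - y}.
  by move=> x y; apply: (can_inj st); rewrite galoisB !ts.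
have tM : monoid_morphism t.
  split=> [|x y]; apply: (can_inj st); first by rewrite ts (galoisM s).1.
  by rewrite (galoisM s).2 !ts.
have tf a : t (iota a) = iota a by rewrite -[in LHS](galois_fix s) st.
by exists (Galois tB tM (Bijective ts st) tf); split; apply: galois_eq.
Qed.

Definition galois_inv (s : G) : G := projT1 (cid (galois_inv_ex s)).

HB.instance Definition _ := gen_eqMixin G.
HB.instance Definition _ := gen_choiceMixin G.

Let galois_mulA : associative galois_mul.
Proof. by move=> s t u; apply: galois_eq. Qed.
Let galois_mul1g : left_id galois_one galois_mul.
Proof. by move=> s; apply: galois_eq. Qed.
Let galois_mulg1 : right_id galois_one galois_mul.
Proof. by move=> s; apply: galois_eq. Qed.
Let galois_mulVg : left_inverse galois_one galois_inv galois_mul.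
Proof. by move=> s; rewrite /galois_inv; case: cid => t []. Qed.
Let galois_mulgV : right_inverse galois_one galois_inv galois_mul.
Proof. by move=> s; rewrite /galois_inv; case: cid => t []. Qed.
HB.instance Definition _ :=
  isGroup.Build G galois_mulA galois_mul1g galois_mulg1 galois_mulVg galois_mulgV.

End GaloisGroup.

(* [X -> X0] together with [Spec K -> X] over [X0], that is, a point [eta] over
   [eta0] and an embedding of its residue field, such that over every affine
   open [U] of [X0] the scheme [X] is the spectrum of the integral closure of
   [O_X0(U)] in [K]. *)
Record normalization (X0 : scheme) (eta0 : X0) (K : fieldType)
    (iota : {rmorphism kappa eta0 -> K}) := Normalization {
  nz_scheme :> scheme;
  nz_proj : morphism nz_scheme X0;
  nz_eta : nz_scheme;
  nz_emb : {rmorphism kappa nz_eta -> K};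
  nz_proj_eta : nz_proj nz_eta = eta0;
  nz_embE : forall (U : opens X0) (h0 : oset U eta0)
    (h : oset (mpreim nz_proj U) nz_eta) (s : sec U),
    nz_emb (eval h (mor_sec nz_proj s)) = iota (eval h0 s);
  nz_affine : forall U : opens X0, affine U -> affine (mpreim nz_proj U);
  nz_inj : forall (U : opens X0) (h : oset (mpreim nz_proj U) nz_eta),
    affine U -> injective (nz_emb \o eval h);
  nz_range : forall (U : opens X0) (h0 : oset U eta0)
    (h : oset (mpreim nz_proj U) nz_eta), affine U ->
    range (nz_emb \o eval h) = integral_over_image (iota \o eval h0)
}.
Arguments nz_proj {X0 eta0 K iota} n.
Arguments nz_eta {X0 eta0 K iota} n.
Arguments nz_emb {X0 eta0 K iota} n.

(* The right action of the Galois group on [X] over [X0]: [act s] is the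
   automorphism given on affine pieces by [s : R -> R], that is, inducing [s] on
   the residue field [K] of the generic point. *)
Record galoisAction (X0 : scheme) (eta0 : X0) (K : fieldType)
    (iota : {rmorphism kappa eta0 -> K}) (X : normalization iota) := GaloisAction {
  act : galois iota -> morphism X X;
  act1 : mor_eq (act 1%g) (mor_id X);
  actM : forall s t, mor_eq (act (s * t)%g) (mor_comp (act t) (act s));
  act_proj : forall s, mor_eq (mor_comp (nz_proj X) (act s)) (nz_proj X);
  act_eta : forall s, act s (nz_eta X) = nz_eta X;
  act_emb : forall s (U : opens X) (h : oset U (nz_eta X))
    (h' : oset (mpreim (act s) U) (nz_eta X)) (r : sec U),
    nz_emb X (eval h' (mor_sec (act s) r)) = s (nz_emb X (eval h r))
}.

Definition Cplx (R : realType) : numClosedFieldType := R[i].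

(* a group homomorphism [k^* -> C^*], extended by [0] to [k] *)
Record character (R : realType) (k : fieldType) := Character {
  char_fun :> k -> Cplx R;
  char0 : char_fun 0 = 0;
  char1 : char_fun 1 = 1;
  charM : {morph char_fun : x y / x * y}
}.

Definition N0 (P : nat_pred) : Type := {n : nat | P.-nat n}.
HB.instance Definition _ (P : nat_pred) := Choice.copy (N0 P) {n : nat | P.-nat n}.

Definition Q0 (P : nat_pred) : set rat :=
  [set q | exists a b : N0 P, q = (val a)%:R / (val b)%:R].

Section N0.
Context (P : nat_pred).

Lemma N0_gt0 (n : N0 P) : (0 < val n)%N.
Proof. by case: n => n /= /andP[]. Qed.

Lemma N0_neq0 (n : N0 P) : (val n)%:R != 0 :> rat.
Proof. by rewrite pnatr_eq0 -lt0n N0_gt0. Qed.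

Let mulP (m n : N0 P) : P.-nat (val m * val n)%N.
Proof. by rewrite pnatM (valP m) (valP n). Qed.
Let oneP : P.-nat 1%N. Proof. by []. Qed.

Definition N0_one : N0 P := exist (fun n : nat => P.-nat n) 1%N oneP.
Definition N0_mul (m n : N0 P) : N0 P :=
  exist (fun n : nat => P.-nat n) _ (mulP m n).

Lemma N0_mulC : commutative N0_mul.
Proof. by move=> m n; apply: val_inj; rewrite /= mulnC. Qed.
Lemma N0_mulA : associative N0_mul.
Proof. by move=> m n k; apply: val_inj; rewrite /= mulnA. Qed.
Lemma N0_mul1 : left_id N0_one N0_mul.
Proof. by move=> m; apply: val_inj; rewrite /= mul1n. Qed.

Lemma Q0_mul (q r : rat) : Q0 P q -> Q0 P r -> Q0 P (q * r).
Proof.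
move=> [a [b ->]] [c [d ->]]; exists (N0_mul a c), (N0_mul b d).
by rewrite /= !natrM mulf_div.
Qed.
Lemma Q0_inv (q : rat) : Q0 P q -> Q0 P q^-1.
Proof. by move=> [a [b ->]]; exists b, a; rewrite invf_div. Qed.
Lemma Q0_1 : Q0 P 1.
Proof. by exists N0_one, N0_one; rewrite divff. Qed.
Lemma Q0_neq0 (q : rat) : Q0 P q -> q != 0.
Proof. by move=> [a [b ->]]; rewrite mulf_neq0 ?invr_eq0 ?N0_neq0. Qed.

End N0.

Section Characters.
Context (R : realType).

Lemma character_eq (k : fieldType) (c d : character R k) : c =1 d -> c = d.
Proof.
case: c d => [c c0 c1 cM] [d d0 d1 dM] /= /funext e; subst d.
by congr Character; apply: Prop_irrelevance.
Qed.

Section Comp.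
Context (k k' : fieldType) (t : {rmorphism k' -> k}) (c : character R k).
Let comp0 : (c \o t) 0 = 0. Proof. by rewrite /= rmorph0 char0. Qed.
Let comp1 : (c \o t) 1 = 1. Proof. by rewrite /= rmorph1 char1. Qed.
Let compM : {morph c \o t : x y / x * y}.
Proof. by move=> x y /=; rewrite rmorphM charM. Qed.
Definition char_comp : character R k' := Character comp0 comp1 compM.
End Comp.

Section Exp.
Context (k : fieldType) (P : nat_pred) (n : N0 P) (c : character R k).
Let exp0 : c (0 ^+ val n) = 0.
Proof. by rewrite expr0n gtn_eqF ?N0_gt0 // char0. Qed.
Let exp1 : c (1 ^+ val n) = 1. Proof. by rewrite expr1n char1. Qed.
Let expM : {morph (fun x => c (x ^+ val n)) : x y / x * y}.
Proof. by move=> x y; rewrite exprMn charM. Qed.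
Definition char_exp : character R k := Character exp0 exp1 expM.
End Exp.

Definition char_ker (k : fieldType) (c : character R k) : set k := [set x | c x = 1].

Definition torsion_part (k : fieldType) (A : set k) : set k :=
  [set x | A x /\ exists n : nat, (0 < n)%N /\ x ^+ n = 1].

Definition finite_order_in (T : Type) (P : nat_pred) (A : set T) : Prop :=
  exists n : N0 P, A #= `I_(val n).

(* [adm_closed]: the members of the class live on algebraically closed fields *)
Record admissibleClass (P : nat_pred) := AdmissibleClass {
  adm_class :> forall k : fieldType, set (character R k);
  adm_closed : forall (k : fieldType) (c : character R k),
    adm_class c -> GRing.closed_field_axiom k;
  adm_iso : forall (k k' : fieldType) (t : {rmorphism k' -> k})
    (c : character R k), bijective t ->
    adm_class c <-> adm_class (char_comp t c);
  adm_exp : forall (k : fieldType) (c : character R k) (n : N0 P),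
    adm_class c <-> adm_class (char_exp n c);
  adm_tors : forall (k : fieldType) (c : character R k),
    adm_class c -> finite_order_in P (torsion_part (char_ker c))
}.

Definition class_Ef (P : nat_pred) (k : fieldType) : set (character R k) :=
  [set c | GRing.closed_field_axiom k /\ finite_order_in P (char_ker c)].

End Characters.

Section DotSpace.
Context (R : realType) (X0 : scheme) (eta0 : X0) (K : fieldType)
  (iota : {rmorphism kappa eta0 -> K}) (X : normalization iota).

Record dotX := DotX {
  dot_pt : X;
  dot_char : character R (kappa dot_pt)
}.
HB.instance Definition _ := gen_eqMixin dotX.
HB.instance Definition _ := gen_choiceMixin dotX.

Lemma dotX_eq (y z : dotX) : dot_pt y = dot_pt z ->
  (forall (U : opens X) (hy : oset U (dot_pt y)) (hz : oset U (dot_pt z)) (s : sec U),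
    dot_char y (eval hy s) = dot_char z (eval hz s)) -> y = z.
Proof.
case: y z => [x c] [x' d] /= e; subst x' => h; congr DotX.
by apply: character_eq => a; have [U [hx [s <-]]] := eval_surj a.
Qed.

Definition dot_over (U : opens X0) : set dotX :=
  [set y | oset (mpreim (nz_proj X) U) (dot_pt y)].

(* the multiplicative map [R -> C] attached to a point over [U] *)
Definition dot_eval (U : opens X0) (y : dot_over U) :
    {ptws sec (mpreim (nz_proj X) U) -> Cplx R} :=
  fun r => dot_char (val y) (eval (set_mem (valP y)) r).

(* [O] is open if over every affine open subset of [X0] it is open for the
   topology of pointwise convergence of the maps [dot_eval] *)
Definition dot_open (O : set dotX) : Prop :=
  forall U : opens X0, affine U ->
    open ((fun y : dot_over U => O (val y)) : set (initial_topology (@dot_eval U))).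

Let dot_openT : dot_open setT.
Proof. by move=> U _; apply: openT. Qed.
Let dot_openI : setI_closed dot_open.
Proof. by move=> A B oA oB U aU; apply: openI; [apply: oA|apply: oB]. Qed.
Let dot_open_bigU (I : Type) (F : I -> set dotX) :
  (forall i, dot_open (F i)) -> dot_open (\bigcup_i F i).
Proof.
by move=> oF U aU; apply: bigcup_open => i _; apply: oF.
Qed.
HB.instance Definition _ :=
  isOpenTopological.Build dotX dot_openT dot_openI dot_open_bigU.

Definition dot_F (P : nat_pred) (n : N0 P) (y : dotX) : dotX :=
  DotX (char_exp n (dot_char y)).

Lemma dot_F_mul (P : nat_pred) (m n : N0 P) (y : dotX) :
  dot_F (N0_mul m n) y = dot_F m (dot_F n y).
Proof.
by apply: dotX_eq => //= U hy hz s; rewrite (Prop_irrelevance hz hy) exprM.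
Qed.

Lemma dot_F1 (P : nat_pred) (y : dotX) : dot_F (N0_one P) y = y.
Proof. by apply: dotX_eq => //= U hy hz s; rewrite (Prop_irrelevance hz hy). Qed.

Definition dot_map (f : morphism X X) (y : dotX) : dotX :=
  DotX (char_comp (kappa_map f (dot_pt y)) (dot_char y)).

Lemma dot_map_F (f : morphism X X) (P : nat_pred) (n : N0 P) (y : dotX) :
  dot_map f (dot_F n y) = dot_F n (dot_map f y).
Proof.
apply: dotX_eq => //= U hy hz s; rewrite (Prop_irrelevance hz hy).
by rewrite -rmorphXn.
Qed.

Lemma dot_map_eq (f g : morphism X X) (y : dotX) :
  mor_eq f g -> dot_map f y = dot_map g y.
Proof.
move=> [e es]; apply: dotX_eq => //= U hy hz s.
have hf : oset (mpreim f U) (dot_pt y) by [].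
have hg : oset (mpreim g U) (dot_pt y) by [].
rewrite (kappa_mapE hy hf) (kappa_mapE hz hg).
have h1 : opensI (mpreim f U) (mpreim g U) `<=` mpreim f U by move=> x [].
have h2 : opensI (mpreim f U) (mpreim g U) `<=` mpreim g U by move=> x [].
have h : oset (opensI (mpreim f U) (mpreim g U)) (dot_pt y) by [].
by rewrite -(eval_res hf h h1) -(eval_res hg h h2) (es _ _ _ h1 h2).
Qed.

Lemma dot_map_id (y : dotX) : dot_map (mor_id X) y = y.
Proof.
apply: dotX_eq => //= U hy hz s.
have hf : oset (mpreim (mor_id X) U) (dot_pt y) by [].
by rewrite (@kappa_mapE _ _ (mor_id X) _ U hy hf) /= (eval_res hz).
Qed.

Lemma dot_map_comp (g f : morphism X X) (y : dotX) :
  dot_map (mor_comp g f) y = dot_map g (dot_map f y).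
Proof.
apply: dotX_eq => //= U hy hz s.
have h1 : oset (mpreim g U) (f (dot_pt y)) by [].
have h2 : oset (mpreim f (mpreim g U)) (dot_pt y) by [].
have h3 : oset (mpreim (mor_comp g f) U) (dot_pt y) by [].
rewrite (@kappa_mapE _ _ (mor_comp g f) _ U hy h3).
rewrite (@kappa_mapE _ _ g _ U hz h1) (@kappa_mapE _ _ f _ (mpreim g U) h1 h2) /=.
by rewrite (eval_res h2).
Qed.

End DotSpace.
Arguments dotX R {X0 eta0 K iota} X.

(* Only the maps [q0_act q] for [q] in [Q0 P] are meaningful. *)
Record Q0space (P : nat_pred) := MkQ0space {
  q0_space :> topologicalType;
  q0_act : rat -> q0_space -> q0_space;
  q0_act1 : q0_act 1 =1 id;
  q0_actM : forall q r, Q0 P q -> Q0 P r ->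
    forall m, q0_act (q * r) m = q0_act q (q0_act r m)
}.

Section Subspace.
Context (P : nat_pred) (M : Q0space P) (A : set M).
Context (hA : forall q, Q0 P q -> forall m, A m -> A (q0_act q m)).

Definition sub_act (q : rat) (m : A) : A :=
  if pselect (Q0 P q) is left h
  then exist _ (q0_act q (val m)) (mem_set (hA h (set_mem (valP m)))) else m.

Lemma val_sub_act (q : rat) (m : A) :
  Q0 P q -> val (sub_act q m) = q0_act q (val m).
Proof. by rewrite /sub_act; case: pselect. Qed.

Let sub_act1 : sub_act 1 =1 id.
Proof.
by move=> m; apply: val_inj; rewrite val_sub_act ?q0_act1 //; apply: Q0_1.
Qed.
Let sub_actM (q r : rat) : Q0 P q -> Q0 P r ->
  forall m, sub_act (q * r) m = sub_act q (sub_act r m).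
Proof.
move=> hq hr m; apply: val_inj.
by rewrite !val_sub_act ?q0_actM //; apply: Q0_mul.
Qed.

Definition sub_Q0space : Q0space P := MkQ0space sub_act1 sub_actM.
End Subspace.

Section QuotientSpace.
Context (P : nat_pred) (M : Q0space P) (e : equiv_rel M).
Context (he : forall q, Q0 P q ->
  forall m m', e m m' -> e (q0_act q m) (q0_act q m')).

Let Q := quotient_topology {eq_quot e}.

Definition quo_act (q : rat) (c : Q) : Q :=
  if pselect (Q0 P q) is left _ then \pi_Q (q0_act q (repr c)) else c.

Let piP (m m' : M) : e m m' -> \pi_Q m = \pi_Q m'.
Proof. by move=> h; apply/eqmodP. Qed.

Lemma quo_actE (q : rat) (m : M) :
  Q0 P q -> quo_act q (\pi_Q m) = \pi_Q (q0_act q m).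
Proof.
rewrite /quo_act; case: pselect => // hq _; apply/piP/he => //.
by apply/eqmodP; rewrite reprK.
Qed.

Let quo_act1 : quo_act 1 =1 id.
Proof.
by move=> c; rewrite -[c]reprK quo_actE ?q0_act1 //; apply: Q0_1.
Qed.
Let quo_actM (q r : rat) : Q0 P q -> Q0 P r ->
  forall c, quo_act (q * r) c = quo_act q (quo_act r c).
Proof.
move=> hq hr c; rewrite -[c]reprK.
by rewrite !quo_actE ?q0_actM //; apply: Q0_mul.
Qed.

Definition quo_Q0space : Q0space P := MkQ0space quo_act1 quo_actM.
End QuotientSpace.

Section Suspension.
Context (R : realType) (P : nat_pred) (M : Q0space P).

Definition Rpos : Type := initial_topology (fun u : {posnum R} => u%:num : R).
HB.instance Definition _ := Topological.on Rpos.

Definition Xtilde : Type := (M * Rpos)%type.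
HB.instance Definition _ := Topological.on Xtilde.

Let rpos (u : Rpos) : R := (u : {posnum R})%:num.

(* the orbits of [(m, u) q = (F_q m, q^-1 u)] *)
Let orbit_rel : rel Xtilde := fun z w =>
  `[< exists2 q : rat, Q0 P q &
        w.1 = q0_act q z.1 /\ rpos w.2 = ratr q^-1 * rpos z.2 >].

Let orbit_refl : reflexive orbit_rel.
Proof.
move=> z; apply/asboolP; exists 1; first exact: Q0_1.
by rewrite q0_act1 invr1 rmorph1 mul1r.
Qed.
Let orbit_sym : symmetric orbit_rel.
Proof.
suff H z w : orbit_rel z w -> orbit_rel w z.
  by move=> z w; apply/idP/idP; apply: H.
move=> /asboolP[q hq [e1 e2]]; apply/asboolP; exists q^-1; first exact: Q0_inv.
have q0 := Q0_neq0 hq; have hV := Q0_inv hq.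
rewrite e1 e2 -q0_actM // mulVf // q0_act1 invrK mulrA -rmorphM mulfV //.
by rewrite rmorph1 mul1r.
Qed.
Let orbit_trans : transitive orbit_rel.
Proof.
move=> w z v /asboolP[q hq [e1 e2]] /asboolP[r hr [f1 f2]].
apply/asboolP; exists (r * q); first exact: Q0_mul.
by rewrite f1 f2 e1 e2 q0_actM // invfM rmorphM mulrA.
Qed.
Canonical orbit_equiv := EquivRel orbit_rel orbit_refl orbit_sym orbit_trans.

Definition XM : Type := quotient_topology {eq_quot orbit_equiv}.
HB.instance Definition _ := Topological.on XM.

Definition pr_XM (z : Xtilde) : XM := \pi_(quotient_topology {eq_quot orbit_equiv}) z.

Definition lift_XM (c : XM) : Xtilde := repr (c : quotient_topology {eq_quot orbit_equiv}).

Lemma lift_XMK (c : XM) : pr_XM (lift_XM c) = c.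
Proof. exact: reprK. Qed.

Lemma pr_XMP (z w : Xtilde) : pr_XM z = pr_XM w <->
  exists2 q : rat, Q0 P q &
    w.1 = q0_act q z.1 /\ rpos w.2 = ratr q^-1 * rpos z.2.
Proof.
split=> [/eqmodP/asboolP //|h]; apply/eqmodP; exact/asboolP.
Qed.

Definition flow (v : {posnum R}) (c : XM) : XM :=
  pr_XM ((lift_XM c).1, (((lift_XM c).2 : {posnum R})%:num * v%:num)%:pos).

Lemma flowE (v u : {posnum R}) (m : M) :
  flow v (pr_XM (m, u)) = pr_XM (m, (u%:num * v%:num)%:pos).
Proof.
apply/pr_XMP => /=; have /pr_XMP[q hq [e1 e2]] := lift_XMK (pr_XM (m, u)).
exists q => //; split; first exact: e1.
by move: e2; rewrite /rpos /= => ->; rewrite mulrA.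
Qed.

(* Sections over the open set [U] are represented by functions on the whole
   space; only their values on [U] are constrained. *)
Definition leaf_sheaf (U : set Xtilde) (f : Xtilde -> R) : Prop :=
  (forall z, U z -> {for z, continuous f}) /\
  forall m u, U (m, u) -> exists V : set M,
    [/\ nbhs m V, forall m', V m' -> U (m', u) &
        forall m', V m' -> f (m', u) = f (m, u)].

(* A section of the invariants of the direct image, that is, an invariant
   section over the preimage of [U], is the pullback of a function on [U]. *)
Definition leaf_sheaf_XM (U : set XM) (f : XM -> R) : Prop :=
  leaf_sheaf (pr_XM @^-1` U) (f \o pr_XM).

Definition H0_pred : {pred XM -> R} := fun f => `[< leaf_sheaf_XM setT f >].

Let H0_submod : submod_closed H0_pred.
Proof.
split=> [|a f g /asboolP[cf lf] /asboolP[cg lg]]; apply/asboolP.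
  split=> [z _|m u _]; first exact: cst_continuous.
  by exists setT; split=> //; apply: filterT.
split=> [z _|m u _].
  have := continuousD (continuousM (@cst_continuous _ _ a z) (cf z I)) (cg z I).
  exact.
have [V [nV _ fV]] := lf m u I; have [W [nW _ gW]] := lg m u I.
exists (V `&` W); split=> //; first exact: filterI.
move=> m' [Vm' Wm'] /=.
by congr (a * _ + _); [apply: fV|apply: gW].
Qed.
HB.instance Definition _ := GRing.isSubmodClosed.Build R (XM -> R) H0_pred H0_submod.

(* [H^0], the real vector space of global sections *)
Record leaf_H0 := LeafH0 { h0_fun :> XM -> R; _ : h0_fun \in H0_pred }.
HB.instance Definition _ := [isSub for h0_fun].
HB.instance Definition _ := [Choice of leaf_H0 by <:].
HB.instance Definition _ := [SubChoice_isSubLmodule of leaf_H0 by <:].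

End Suspension.

Section CheckSpace.
Context (R : realType) (X0 : scheme) (eta0 : X0) (K : fieldType)
  (iota : {rmorphism kappa eta0 -> K}) (X : normalization iota) (P : nat_pred).

Local Notation pre := (N0 P * dotX R X)%type.

(* the pair [(n, y)], i.e. [y] at the index [n] of the directed system, stands
   for [F_n^-1 y] *)
Let colim_rel : rel pre := fun a b =>
  `[< exists m n : N0 P,
        N0_mul m a.1 = N0_mul n b.1 /\ dot_F m a.2 = dot_F n b.2 >].

Let colim_refl : reflexive colim_rel.
Proof. by move=> a; apply/asboolP; exists (N0_one P), (N0_one P). Qed.
Let colim_sym : symmetric colim_rel.
Proof.
by move=> a b; apply/idP/idP => /asboolP[m [n [e f]]]; apply/asboolP; exists n, m.
Qed.
Let colim_trans : transitive colim_rel.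
Proof.
move=> b a c /asboolP[m [n [e f]]] /asboolP[k [l [e' f']]]; apply/asboolP.
exists (N0_mul k m), (N0_mul n l); split.
  by rewrite -!N0_mulA e -e' N0_mulA (N0_mulC k) -N0_mulA.
by rewrite !dot_F_mul f -f' -!dot_F_mul N0_mulC.
Qed.
Canonical colim_equiv := EquivRel colim_rel colim_refl colim_sym colim_trans.

Definition checkX : Type := {eq_quot colim_equiv}.
HB.instance Definition _ := Choice.on checkX.

Definition check_mk (n : N0 P) (y : dotX R X) : checkX :=
  \pi_{eq_quot colim_equiv} (n, y).
Definition check_repr (z : checkX) : pre := repr (z : {eq_quot colim_equiv}).

Lemma check_reprK (z : checkX) : check_mk (check_repr z).1 (check_repr z).2 = z.
Proof. by rewrite /check_mk -surjective_pairing; apply: reprK. Qed.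

Lemma check_mkP (n n' : N0 P) (y y' : dotX R X) :
  check_mk n y = check_mk n' y' <->
  exists k l : N0 P, N0_mul k n = N0_mul l n' /\ dot_F k y = dot_F l y'.
Proof. by split=> [/eqmodP/asboolP //|h]; apply/eqmodP; exact/asboolP. Qed.

Definition check_open (Z : set checkX) : Prop :=
  forall n : N0 P, open [set y : dotX R X | Z (check_mk n y)].

Let check_openT : check_open setT. Proof. by move=> n; apply: openT. Qed.
Let check_openI : setI_closed check_open.
Proof. by move=> A B oA oB n; apply: openI; [apply: oA|apply: oB]. Qed.
Let check_open_bigU (I : Type) (F : I -> set checkX) :
  (forall i, check_open (F i)) -> check_open (\bigcup_i F i).
Proof. by move=> oF n; apply: bigcup_open => i _; apply: oF. Qed.
HB.instance Definition _ :=
  isOpenTopological.Build checkX check_openT check_openI check_open_bigU.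

(* [F_(a/b)], which maps [F_n^-1 y] to [F_(b n)^-1 (F_a y)] *)
Definition check_frac (a b : N0 P) (z : checkX) : checkX :=
  check_mk (N0_mul b (check_repr z).1) (dot_F a (check_repr z).2).

Lemma check_fracE (a b a' b' n : N0 P) (y : dotX R X) :
  (val a)%:R / (val b)%:R = (val a')%:R / (val b')%:R :> rat ->
  check_frac a b (check_mk n y) = check_mk (N0_mul b' n) (dot_F a' y).
Proof.
move=> /eqP; rewrite eqr_div ?N0_neq0 // -!natrM eqr_nat => /eqP e.
have {}e : N0_mul a b' = N0_mul a' b by apply: val_inj.
rewrite /check_frac; have := check_reprK (check_mk n y).
case: (check_repr _) => [n1 y1] /= /check_mkP[k [l [ek ef]]].
apply/check_mkP; exists (N0_mul b' k), (N0_mul b l); split.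
  apply: val_inj; move: (congr1 val ek) => /= ek'.
  by rewrite mulnACA ek' [in RHS]mulnACA (mulnC (val b)).
rewrite -!dot_F_mul.
have -> : N0_mul (N0_mul b' k) a = N0_mul (N0_mul a b') k.
  by apply: val_inj; rewrite /= mulnC mulnA.
have -> : N0_mul (N0_mul b l) a' = N0_mul (N0_mul a' b) l.
  by apply: val_inj; rewrite /= mulnC mulnA.
by rewrite e dot_F_mul ef -dot_F_mul.
Qed.

Definition check_F (q : rat) (z : checkX) : checkX :=
  if pselect (exists a b : N0 P, q = (val a)%:R / (val b)%:R) is left h
  then let a := projT1 (cid h) in let b := projT1 (cid (projT2 (cid h))) in
       check_frac a b z
  else z.

Lemma check_FE (a b n : N0 P) (y : dotX R X) :
  check_F ((val a)%:R / (val b)%:R) (check_mk n y) =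
  check_mk (N0_mul b n) (dot_F a y).
Proof.
rewrite /check_F; case: pselect => [h|[]]; last by exists a, b.
by apply: check_fracE; rewrite -(projT2 (cid (projT2 (cid h)))).
Qed.

Let check_F1 : check_F 1 =1 id.
Proof.
move=> z; rewrite -[z]check_reprK.
have {1}-> : 1 = (val (N0_one P))%:R / (val (N0_one P))%:R :> rat.
  by rewrite divff.
by rewrite check_FE N0_mul1 dot_F1.
Qed.
Let check_FM (q r : rat) : Q0 P q -> Q0 P r ->
  forall z, check_F (q * r) z = check_F q (check_F r z).
Proof.
move=> [a [b ->]] [c [d ->]] z; rewrite -[z]check_reprK.
rewrite !check_FE mulf_div -!natrM.
rewrite -[(val a * val c)%N]/(val (N0_mul a c)) -[(val b * val d)%N]/(val (N0_mul b d)).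
by rewrite check_FE dot_F_mul N0_mulA.
Qed.
Definition check_Q0space : Q0space P := MkQ0space check_F1 check_FM.

Definition check_pr (z : checkX) : X := dot_pt (check_repr z).2.

Lemma check_prE (n : N0 P) (y : dotX R X) : check_pr (check_mk n y) = dot_pt y.
Proof.
rewrite /check_pr; have := check_reprK (check_mk n y).
case: (check_repr _) => [n1 y1] /= /check_mkP[k [l [_ e]]].
by move: (congr1 (@dot_pt _ _ _ _ _ _) e).
Qed.

Definition check_map (f : morphism X X) (z : checkX) : checkX :=
  check_mk (check_repr z).1 (dot_map f (check_repr z).2).

Lemma check_mapE (f : morphism X X) (n : N0 P) (y : dotX R X) :
  check_map f (check_mk n y) = check_mk n (dot_map f y).
Proof.
rewrite /check_map; have := check_reprK (check_mk n y).
case: (check_repr _) => [n1 y1] /= /check_mkP[k [l [en ey]]].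
by apply/check_mkP; exists k, l; rewrite -!dot_map_F ey.
Qed.

Lemma check_map_F (f : morphism X X) (q : rat) (z : checkX) :
  Q0 P q -> check_map f (check_F q z) = check_F q (check_map f z).
Proof.
move=> [a [b ->]]; rewrite -[z]check_reprK.
by rewrite !(check_FE, check_mapE) dot_map_F.
Qed.

Lemma check_pr_F (q : rat) (z : checkX) : Q0 P q -> check_pr (check_F q z) = check_pr z.
Proof.
by move=> [a [b ->]]; rewrite -[z]check_reprK check_FE !check_prE.
Qed.

Lemma check_pr_map (f : morphism X X) (z : checkX) :
  check_pr (check_map f z) = f (check_pr z).
Proof. by rewrite -[z]check_reprK check_mapE !check_prE. Qed.

Context (E : admissibleClass R P).

(* the colimit of the subsets [{(x, chi) | chi \in E}] *)
Definition checkE_set : set check_Q0space :=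
  [set z | exists (n : N0 P) (y : dotX R X),
     E (kappa (dot_pt y)) (dot_char y) /\ z = check_mk n y].

Let checkE_F (q : rat) : Q0 P q ->
  forall z, checkE_set z -> checkE_set (q0_act q z).
Proof.
move=> [a [b ->]] z [n [y [Ey ->]]]; exists (N0_mul b n), (dot_F a y).
split; last exact: check_FE.
exact: (adm_exp E (dot_char y) a).1.
Qed.

Definition checkE : Q0space P := sub_Q0space checkE_F.

Definition checkE_pr (z : checkE) : X := check_pr (val z).

Let checkE_pr_F (x : X) (q : rat) : Q0 P q ->
  forall z : checkE, checkE_pr z = x -> checkE_pr (q0_act q z) = x.
Proof.
by move=> hq z <-; rewrite /checkE_pr val_sub_act // check_pr_F.
Qed.

Definition check_eta : Q0space P := sub_Q0space (@checkE_pr_F (nz_eta X)).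

Context (A : galoisAction X).
Local Notation G := (galois iota).

Lemma dot_mapM (s t : G) (y : dotX R X) :
  dot_map (act A (s * t)%g) y = dot_map (act A t) (dot_map (act A s) y).
Proof. by rewrite -dot_map_comp; apply: dot_map_eq; apply: actM. Qed.

Lemma dot_map1 (y : dotX R X) : dot_map (act A 1%g) y = y.
Proof. by rewrite -[RHS]dot_map_id; apply: dot_map_eq; apply: act1. Qed.

Lemma kappa_map_bij (s : G) (x : X) : bijective (kappa_map (act A s) x).
Proof.
pose f := act A s; pose g := act A s^-1%g.
have surj a : exists b, kappa_map f x b = a.
  have [U [hx [r <-]]] := eval_surj a.
  have e : mor_eq (mor_comp g f) (mor_id X).
    have := actM A s s^-1%g; rewrite mulgV => -[e1 e2].
    have [d1 d2] := act1 A; split=> [y|V t W hf hg]; first by rewrite -e1 d1.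
    have h : W `<=` mpreim (act A 1%g) V by move=> y /hg; rewrite /= d1.
    by rewrite -(d2 _ _ _ h hg) (e2 _ _ _ h hf).
  have hgx : g (f x) = x by apply: e.1.
  have h1 : oset (mpreim g U) (f x) by rewrite /= hgx.
  have h2 : oset (mpreim f (mpreim g U)) x by [].
  exists (eval h1 (mor_sec g r)).
  rewrite (@kappa_mapE _ _ f x _ h1 h2).
  have i1 : opensI (mpreim (mor_comp g f) U) (mpreim (mor_id X) U)
      `<=` mpreim (mor_comp g f) U by move=> y [].
  have i2 : opensI (mpreim (mor_comp g f) U) (mpreim (mor_id X) U)
      `<=` mpreim (mor_id X) U by move=> y [].
  have h3 : oset (mpreim (mor_comp g f) U) x by [].
  have h4 : oset (mpreim (mor_id X) U) x by [].
  have h5 : oset (opensI (mpreim (mor_comp g f) U) (mpreim (mor_id X) U)) x by [].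
  have := congr1 (eval h5) (e.2 _ r _ i1 i2).
  by rewrite (eval_res h3) (eval_res h4) /= (eval_res h2) (eval_res hx).
exists (fun a => projT1 (cid (surj a))) => a; last by case: cid.
by case: cid => b /= /(fmorph_inj (kappa_map f x)).
Qed.

Let checkE_map (s : G) (z : check_Q0space) :
  checkE_set z -> checkE_set (check_map (act A s) z).
Proof.
move=> [n [y [Ey ->]]]; exists n, (dot_map (act A s) y).
split; last exact: check_mapE.
exact: (adm_iso E (dot_char y) (kappa_map_bij s (dot_pt y))).1.
Qed.

Definition checkE_act (s : G) (z : checkE) : checkE :=
  exist _ (check_map (act A s) (val z)) (mem_set (checkE_map s (set_mem (valP z)))).

Let check_eta_map (s : G) (z : checkE) :
  checkE_pr z = nz_eta X -> checkE_pr (checkE_act s z) = nz_eta X.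
Proof. by rewrite /checkE_pr /= check_pr_map => ->; apply: act_eta. Qed.

Definition check_eta_act (s : G) (z : check_eta) : check_eta :=
  exist _ (checkE_act s (val z)) (mem_set (check_eta_map s (set_mem (valP z)))).

Lemma checkE_act1 (z : checkE) : checkE_act 1%g z = z.
Proof.
by apply: val_inj; rewrite /= -[val z]check_reprK check_mapE dot_map1.
Qed.
Lemma checkE_actM (s t : G) (z : checkE) :
  checkE_act (s * t)%g z = checkE_act t (checkE_act s z).
Proof.
by apply: val_inj; rewrite /= -[val z]check_reprK !check_mapE dot_mapM.
Qed.
Lemma checkE_act_F (s : G) (q : rat) (z : checkE) :
  Q0 P q -> checkE_act s (q0_act q z) = q0_act q (checkE_act s z).
Proof.
move=> hq; apply: val_inj.
rewrite [RHS]val_sub_act // -[RHS]/(check_F q (check_map (act A s) (val z))).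
rewrite -check_map_F //.
by rewrite -[LHS]/(check_map (act A s) (val (sub_act checkE_F q z))) val_sub_act.
Qed.

Let galois_rel : rel checkE := fun z w => `[< exists s : G, checkE_act s z = w >].

Let galois_refl : reflexive galois_rel.
Proof. by move=> z; apply/asboolP; exists 1%g; apply: checkE_act1. Qed.
Let galois_sym : symmetric galois_rel.
Proof.
suff H z w : galois_rel z w -> galois_rel w z.
  by move=> z w; apply/idP/idP; apply: H.
move=> /asboolP[s <-]; apply/asboolP; exists s^-1%g.
by rewrite -checkE_actM mulgV checkE_act1.
Qed.
Let galois_trans : transitive galois_rel.
Proof.
move=> w z v /asboolP[s <-] /asboolP[t <-]; apply/asboolP.
by exists (s * t)%g; rewrite checkE_actM.
Qed.
Canonical galois_equiv := EquivRel galois_rel galois_refl galois_sym galois_trans.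

Let galois_F (q : rat) : Q0 P q -> forall z w : checkE,
  galois_equiv z w -> galois_equiv (q0_act q z) (q0_act q w).
Proof.
move=> hq z w /asboolP[s <-]; apply/asboolP; exists s.
exact: checkE_act_F.
Qed.

Definition check0 : Q0space P := quo_Q0space galois_F.

Definition check0_pr (c : check0) : X0 :=
  nz_proj X (checkE_pr (repr (c : quotient_topology {eq_quot galois_equiv}))).

Lemma check0_prE (z : checkE) :
  check0_pr (\pi_(quotient_topology {eq_quot galois_equiv}) z) =
  nz_proj X (checkE_pr z).
Proof.
rewrite /check0_pr.
have /eqmodP/asboolP[s <-] :
    z = repr (\pi_(quotient_topology {eq_quot galois_equiv}) z) %[mod {eq_quot galois_equiv}].
  by rewrite reprK.
rewrite /checkE_pr /= check_pr_map.
exact: (act_proj A s).1 (check_pr (val z)).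
Qed.

Let check0_pr_F (x : X0) (q : rat) : Q0 P q ->
  forall c : check0, check0_pr c = x -> check0_pr (q0_act q c) = x.
Proof.
move=> hq c <-; rewrite -[c in LHS](@reprK _ (quotient_topology {eq_quot galois_equiv})).
by rewrite [q0_act _ _]quo_actE // check0_prE /checkE_pr val_sub_act // check_pr_F.
Qed.

Definition check0_eta : Q0space P := sub_Q0space (@check0_pr_F eta0).

End CheckSpace.

Section SuspensionMap.
Context (R : realType) (P : nat_pred) (M : Q0space P) (f : M -> M).

(* [[m, u] |-> [f m, u]] *)
Definition XM_map (c : XM R M) : XM R M :=
  pr_XM (f (lift_XM c).1, (lift_XM c).2).

Lemma XM_mapE (m : M) (u : Rpos R) :
  (forall q, Q0 P q -> forall m, f (q0_act q m) = q0_act q (f m)) ->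
  XM_map (pr_XM (m, u)) = pr_XM (f m, u).
Proof.
move=> hf; have /pr_XMP[q hq [e1 e2]] := lift_XMK (pr_XM (m, u)).
by apply/pr_XMP; exists q => //; split=> //=; rewrite -hf // -e1.
Qed.
End SuspensionMap.

Section Constants.
Context (R : realType) (P : nat_pred) (M : Q0space P).

Definition H0_constants_only : Prop :=
  forall f : leaf_H0 R M, exists c : R, forall z, f z = c.

Definition H0_canonically_R : Prop :=
  exists phi : {linear R^o -> leaf_H0 R M},
    bijective phi /\ forall (c : R) z, phi c z = c.

(* [T] acts trivially on [H^0] by pullback along the maps [a t] *)
Definition H0_trivial_action (T : Type) (a : T -> XM R M -> XM R M) : Prop :=
  forall (t : T) (f : leaf_H0 R M) z, f (a t z) = f z.

End Constants.

(* Main.v *)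
From HB Require Import structures.
Require Import Defs.
From mathcomp Require Import all_boot all_order all_algebra.
From mathcomp Require Import all_classical all_reals all_analysis.
From mathcomp Require Import complex cyclic separable cyclotomic ring lra zify.

Set Implicit Arguments.
Unset Strict Implicit.
Unset Printing Implicit Defensive.

Import Order.TTheory GRing.Theory Num.Theory.
Import numFieldNormedType.Exports.
Local Open Scope classical_set_scope.
Local Open Scope ring_scope.

(* Fix one injective character [th : K^* -> S^1]. It lies in [E], together with
   every character [exp(rho) th^a exp(i beta)] whose kernel is exactly the group
   of [a]-th roots of unity, [a] in [N0], [rho] and [beta] being homomorphisms
   [K^* -> R]. Moving first [rho] and then [beta] gives continuous paths in [E],
   along which a section is constant for fixed [u].

   Given any point [m] of the space and any neighbourhood of it, prescribed by
   finitely many functions, such a path leads from [F_(a/n) th] into the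
   neighbourhood, for all [a] in some arithmetic progression contained in [N0]:
   [a] is determined modulo some integer by the torsion of the finitely generated
   group in question, and the remaining freedom is used to approximate the
   argument and the absolute value. A zero of the function attached to [m] is
   approximated by letting [rho] tend to [-oo], in a direction provided by
   Gordan's theorem. The progression exists in [N0] because almost all primes
   are residue characteristics of [X0].

   By the invariance under [F_a], a section [f] satisfies
   [f(th, (a/n) u') = f(F_(a/n) th, u')], which is close to [f(m, u)] for all [u']
   close to [u] and all [a] in the progression. The numbers [(a/n) u'] cover a
   neighbourhood of [+oo], so [f(th, w)] tends to [f(m, u)] as [w] tends to
   [+oo], for every [(m, u)]. Hence [f] is constant. *)

(** * Extending homomorphisms by Zorn's lemma *)

(** Torsion is the obstacle. [rho] and [beta] vanish on roots of unity, so there a character of the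
    path is just a power of [th]. By injectivity of [th] the target agrees on the n-th roots of
    unity with some [th ^+ a0]; hence a = a0 modulo n is forced, and a prime l dividing both n and
    a0 divides every such a. This l has to lie in N0: the target is trivial on l-th roots of unity,
    so either these reduce to 1 and l is a residue characteristic, or they survive in the torsion of
    the kernel, whose order lies in N0 by admissibility of [E].

    A section is locally constant only within the space, so a path must never leave [E]: the kernel
    is controlled for every value of the parameter. This is why [rho] is kept injective modulo
    torsion while [beta] moves. Such choices are made by letting a real parameter avoid a countable
    set, [K] being countable.

    All paths stay over the generic point. The four spaces enter only through equivariant continuous
    maps from the generic fibre, with dense image. *)

Section ExtendHom.
Context (K F : fieldType).
Implicit Types (G : set (K * F)) (u v : K * F).

Definition subgrp G := [/\ G (1, 1),
  forall u v, G u -> G v -> G (u.1 * v.1, u.2 * v.2) &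
  forall u, G u -> G (u.1^-1, u.2^-1)].

Definition adjoin G (x : K) (y : F) : set (K * F) :=
  [set u | exists v (i : int), G v /\ u = (v.1 * x ^ i, v.2 * y ^ i)].

Lemma subgrp_expz G x y (i : int) : subgrp G -> G (x, y) -> G (x ^ i, y ^ i).
Proof.
move=> [G1 GM GV] Gxy.
have h (n : nat) : G (x ^+ n, y ^+ n).
  by elim: n => [|n IH]; [rewrite !expr0|rewrite !exprS; exact: (GM _ _ Gxy IH)].
by case: i => n; [exact: h|exact: (GV _ (h n.+1))].
Qed.

Lemma subgrp_adjoin G x y : x != 0 -> y != 0 -> subgrp G -> subgrp (adjoin G x y).
Proof.
move=> x0 y0 [G1 GM GV]; split.
- by exists (1, 1), 0; rewrite !expr0z !mulr1.
- move=> _ _ [u [i [Gu ->]]] [v [j [Gv ->]]]; exists (u.1 * v.1, u.2 * v.2), (i + j).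
  by split; [exact: GM|rewrite !expfzDr //= mulrACA [u.2 * _ * _]mulrACA].
- move=> _ [u [i [Gu ->]]]; exists (u.1^-1, u.2^-1), (- i).
  by split; [exact: GV|rewrite /= !invfM !invr_expz].
Qed.

Lemma sub_adjoin G x y : G `<=` adjoin G x y.
Proof. by move=> u Gu; exists u, 0; rewrite !expr0z !mulr1 -surjective_pairing. Qed.

Lemma adjoin_gen G x y : subgrp G -> adjoin G x y (x, y).
Proof. by move=> [G1 _ _]; exists (1, 1), 1; rewrite !expr1z !mul1r. Qed.

(* It suffices to adjoin an element [x] of prime or of infinite order modulo the
   current domain. *)
Lemma extend_hom (q G0 : set (K * F)) :
  subgrp G0 -> G0 `<=` q ->
  (forall u, q u -> u.1 != 0 /\ u.2 != 0) -> (forall y, q (1, y) -> y = 1) ->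
  (forall G (x : K), subgrp G -> G `<=` q -> x != 0 -> (forall y, ~ G (x, y)) ->
     (exists p z, prime p /\ G (x ^+ p, z)) \/
     (forall n y, (0 < n)%N -> ~ G (x ^+ n, y)) ->
     exists y : F, y != 0 /\ adjoin G x y `<=` q) ->
  exists f : K -> F, [/\ forall x, x != 0 -> q (x, f x), f 0 = 0, f 1 = 1,
    {morph f : x y / x * y} & forall u, G0 u -> f u.1 = u.2].
Proof.
move=> sG0 G0q q0 q1 step.
pose good G := [/\ subgrp G, G0 `<=` G & G `<=` q].
pose P G := G = set0 \/ good G.
have [C CP totC|A [PA maxA]] := @Zorn_bigcup _ P.
  have [[X CX X0]|noX] := pselect (exists2 X, C X & X !=set0); last first.
    left; apply/seteqP; split=> // u [X CX Xu]; apply: noX.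
    by exists X => //; exists u.
  have goodX Y : C Y -> Y !=set0 -> good Y.
    by move=> CY [u Yu]; case: (CP _ CY) => // Y0; rewrite Y0 in Yu.
  have gX := goodX _ CX X0.
  right; split.
  - split.
    + by exists X => //; have [[X1 _ _] _ _] := gX.
    + move=> u v [Y CY Yu] [Z CZ Zv].
      have [YZ|ZY] := totC _ _ CY CZ.
        exists Z => //; have [[_ ZM _] _ _] := goodX _ CZ (ex_intro _ v Zv).
        by apply: ZM => //; apply: YZ.
      exists Y => //; have [[_ YM _] _ _] := goodX _ CY (ex_intro _ u Yu).
      by apply: YM => //; apply: ZY.
    + move=> u [Y CY Yu]; exists Y => //.
      by have [[_ _ YV] _ _] := goodX _ CY (ex_intro _ u Yu); apply: YV.
  - by move=> u G0u; have [_ GX _] := gX; exists X; [exact: CX|apply: GX].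
  - by move=> u [Y CY Yu]; have [_ _ Yq] := goodX _ CY (ex_intro _ u Yu); apply: Yq.
have gA : good A.
  case: PA => // A0; exfalso; apply: (maxA G0); last by right; split.
  rewrite A0; split; first by [].
  by move=> h; have [G01 _ _] := sG0; have := h _ G01.
have [[A1 AM AV] GA Aq] := gA.
have Afun x y z : A (x, y) -> A (x, z) -> y = z.
  move=> Axy Axz; have := AM _ _ Axy (AV _ Axz); rewrite /=.
  have [/= x0 y0] := q0 _ (Aq _ Axy); have [/= _ z0] := q0 _ (Aq _ Axz).
  rewrite divff // => /Aq/q1 e; rewrite -[y](mulfVK z0) e mul1r //.
have step' x : x != 0 -> (forall y, ~ A (x, y)) ->
    (exists p z, prime p /\ A (x ^+ p, z)) \/
     (forall n y, (0 < n)%N -> ~ A (x ^+ n, y)) -> False.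
  move=> x0 nA h; have [y [y0 adj]] := step A x (And3 A1 AM AV) Aq x0 nA h.
  apply: (maxA (adjoin A x y)).
    split; first exact: sub_adjoin.
    by move=> /(_ _ (adjoin_gen _ _ (And3 A1 AM AV))); apply: nA.
  right; split=> //.
    by apply: subgrp_adjoin.
  by move=> u /GA; apply: sub_adjoin.
have tot x : x != 0 -> exists y, A (x, y).
  move=> x0; apply: contrapT => nA.
  have nA' y : ~ A (x, y) by move=> Ay; apply: nA; exists y.
  have [[n0 [n00 An0]]|no] := pselect (exists n, (0 < n)%N /\ exists z, A (x ^+ n, z)); last first.
    apply: (step' x x0 nA'); right=> n y n0 An; apply: no; exists n; split=> //.
    by exists y.
  have exn : exists n, (0 < n)%N && `[< exists z, A (x ^+ n, z) >].
    by exists n0; rewrite n00; apply/asboolP.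
  case: (ex_minnP exn) => n /andP[npos /asboolP[z Az]] minn.
  have n1 : (1 < n)%N.
    by case: n npos Az {minn} => [|[|n]] // _; rewrite expr1 => /nA'.
  (* By minimality of [n], the element [x ^+ (n %/ p)] is outside the domain while its [p]-th power
     is inside: it has order exactly [p] modulo the domain. *)
  pose p := pdiv n; have pp : prime p := pdiv_prime n1.
  have pn : (p %| n)%N := pdiv_dvd n.
  have np0 : (0 < n %/ p)%N by rewrite divn_gt0 ?prime_gt0 // dvdn_leq.
  apply: (step' (x ^+ (n %/ p))); first exact: expf_neq0.
    move=> y Ay; have : (n <= n %/ p)%N.
      by apply: minn; rewrite np0; apply/asboolP; exists y.
    by rewrite leqNgt ltn_Pdiv ?prime_gt1.
  by left; exists p, z; rewrite -exprM divnK.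
pose f x := if x == 0 then 0 else xget 0 [set y | A (x, y)].
have fA x : x != 0 -> A (x, f x).
  move=> x0; rewrite /f (negbTE x0); case: xgetP => //= h.
  by have [y Ay] := tot x x0; case: (h y).
exists f; split.
- by move=> x x0; apply: Aq; apply: fA.
- by rewrite /f eqxx.
- by apply: (Afun 1); rewrite ?fA ?oner_eq0 //; apply: fA; apply: oner_neq0.
- move=> x y; have [->|x0] := eqVneq x 0; first by rewrite mul0r /f eqxx mul0r.
  have [->|y0] := eqVneq y 0; first by rewrite mulr0 /f eqxx mulr0.
  apply: (Afun (x * y)); first by apply: fA; rewrite mulf_neq0.
  exact: (AM _ _ (fA _ x0) (fA _ y0)).
- move=> [x y] Gu /=; have [/= x0 _] := q0 _ (G0q _ Gu).
  by apply: (Afun x); [exact: fA|exact: GA].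
Qed.
End ExtendHom.

(** * Real and complex numbers *)

Section RealComplex.
Context (R : realType).
Local Notation C := (Cplx R).

(** An interval has positive Lebesgue measure, a countable set has measure zero. Generic real
    parameters are chosen by this lemma. *)
Lemma avoid_countable (A : set R) (a b : R) :
  countable A -> a < b -> exists t, a < t < b /\ ~ A t.
Proof.
move=> cA ab; apply: contrapT => no.
have sub : `]a, b[%classic `<=` A.
  by move=> t /=; rewrite in_itv /= => tab; apply: contrapT => nA; apply: no; exists t.
have : countable `]a, b[%classic by apply: sub_countable cA; apply: subset_card_le.
move=> /(@countable_lebesgue_measure0 R); rewrite lebesgue_measure_itv /= lte_fin ab.
by rewrite -EFinB => -[] /eqP; rewrite subr_eq0 gt_eqF.
Qed.

Lemma closed_prim_root (F : closedFieldType) (n : nat) :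
  (n%:R : F) != 0 -> exists z : F, n.-primitive_root z.
Proof.
move=> n0; have n_gt0 : (0 < n)%N by case: n n0 => //; rewrite eqxx.
pose p : {poly F} := 'X^n - 1; have [r Dp] := closed_field_poly_normal p.
rewrite (monicP _) ?monicXnsubC // scale1r in Dp.
have rn1: all n.-unity_root r by apply/allP=> z; rewrite -root_prod_XsubC -Dp.
have sz_r: (n < (size r).+1)%N.
  by rewrite -(size_prod_XsubC r id) -Dp size_XnsubC.
have [|z] := hasP (has_prim_root n_gt0 rn1 _ sz_r); last by exists z.
by rewrite -separable_prod_XsubC -Dp separable_Xn_sub_1.
Qed.

Lemma closed_root (F : closedFieldType) (n : nat) (z : F) :
  (0 < n)%N -> exists y : F, y ^+ n = z.
Proof.
move=> n0; have [y e] := @solve_monicpoly F n (fun i => if i == 0%N then z else 0) n0.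
exists y; rewrite e; case: n n0 e => // n _ _.
by rewrite big_ord_recl /= expr0 mulr1 big1 ?addr0 // => i _; rewrite mul0r.
Qed.

Definition expi (t : R) : C := (cos t +i* sin t)%C.

Lemma expi0 : expi 0 = 1.
Proof. by rewrite /expi cos0 sin0. Qed.

Lemma expiD s t : expi (s + t) = expi s * expi t.
Proof.
apply/eqP; rewrite eq_complex /= sinD cosD.
by rewrite eqxx addrC eqxx.
Qed.

Lemma expiN s : expi (- s) = (expi s)^-1.
Proof.
have e : expi s * expi (- s) = 1 by rewrite -expiD subrr expi0.
have s0 : expi s != 0 by apply: contra_eq_neq e => ->; rewrite mul0r eq_sym oner_neq0.
by apply: (mulfI s0); rewrite e divff.
Qed.

Lemma norm_expi t : `|expi t| = 1.
Proof. by rewrite normc_def /= cos2Dsin2 sqrtr1. Qed.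

Lemma expi_surj (z : C) : `|z| = 1 -> exists t, expi t = z.
Proof.
case: z => a b; rewrite normc_def /= => /(congr1 (@complex.Re _)) /= e.
have {}e : a ^+ 2 + b ^+ 2 = 1.
  by rewrite -[LHS]sqr_sqrtr ?addr_ge0 ?sqr_ge0 // e expr1n.
have a1 : -1 <= a <= 1.
  rewrite -ler_norml -(@ler_pXn2r _ 2%N) ?nnegrE // expr1n real_normK ?num_real //.
  by rewrite -e lerDl sqr_ge0.
have sa : sin (acos a) = `|b|.
  by rewrite sin_acos // -e addrC addKr sqrtr_sqr.
have ca : cos (acos a) = a by rewrite acosK // in_itv.
have [b0|b0] := leP 0 b.
  by exists (acos a); rewrite /expi ca sa ger0_norm.
by exists (- acos a); rewrite /expi cosN sinN ca sa ltr0_norm // opprK.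
Qed.

Lemma cos_eq1_small t : 0 <= t < pi *+ 2 -> cos t = 1 :> R -> t = 0.
Proof.
move=> /andP[t0 t2] ct.
have inj x : 0 <= x <= pi -> cos x = 1 :> R -> x = 0.
  move=> hx cx; apply: cos_inj; rewrite ?in_itv /= ?hx ?lexx ?pi_ge0 // cos0 //.
have [tp|tp] := leP t pi; first by apply: inj; rewrite ?t0.
have := inj (pi *+ 2 - t); rewrite subr_ge0 ltW // lerBlDr mulr2n lerD2l ltW //.
have -> : cos (pi + pi - t) = 1.
  by rewrite -cosN opprB -mulr2n -ct -[in RHS](subrK (pi *+ 2) t) cosD2pi.
by move=> /(_ isT erefl)/eqP; rewrite subr_eq0 => /eqP e; move: t2; rewrite mulr2n e ltxx.
Qed.

Lemma expi_eq1 t : expi t = 1 -> exists k : int, t = (pi *+ 2) * k%:~R.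
Proof.
move=> /(congr1 (@complex.Re _)) /= ct.
have p0 : 0 < pi *+ 2 :> R by rewrite pmulrn_lgt0 // pi_gt0.
pose k := Num.floor (t / (pi *+ 2)).
exists k; apply/eqP; rewrite -subr_eq0; apply/eqP; apply: cos_eq1_small.
  have /andP[h1 h2] := floor_itv (t / (pi *+ 2)).
  rewrite subr_ge0 ltrBlDr -ler_pdivlMl // mulrC h1 /=.
  by rewrite -[X in _ < X + _]mulr1 -mulrDr -ltr_pdivrMl // mulrC addrC -[1]/(1%:~R) -intrD.
have per x (n : nat) : cos (x + (pi *+ 2) *+ n) = cos x :> R.
  by rewrite (periodicn (@cosD2pi R)).
case: k => n.
  by rewrite -(per _ n) mulr_natr subrK.
by rewrite NegzE mulrNz mulrN opprK -pmulrn mulr_natr per.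
Qed.

Lemma countable_expi_scale (c d : R) : d != 0 -> countable [set s | expi (c + s * d) = 1].
Proof.
move=> d0; pose f (k : int) := ((pi *+ 2) * k%:~R - c) / d.
apply: (@sub_countable _ _ _ [set f k | k in setT]).
  apply: subset_card_le => s /= /expi_eq1[k e]; exists k => //.
  by rewrite /f -e addrC addKr mulfK.
by apply: (sub_countable (card_image_le f setT)); apply: countableP.
Qed.

Definition cofR (x : R) : C := (x%:C)%C.
Lemma cofRM : {morph cofR : x y / x * y}. Proof. exact: rmorphM. Qed.

Lemma norm_cofR x : `|cofR x| = cofR `|x|.
Proof. by rewrite normc_def /= expr0n /= addr0 sqrtr_sqr. Qed.

(** The norm of a complex number is itself of complex type; a real value is needed for [ln] and
    [expR]. *)
Definition absC (z : C) : R := complex.Re `|z|.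
Lemma absCE z : `|z| = cofR (absC z).
Proof. by rewrite /absC normc_def. Qed.
Lemma absCM x y : absC (x * y) = absC x * absC y.
Proof. by rewrite {1}/absC normrM !absCE -cofRM. Qed.
Lemma absC1 : absC 1 = 1. Proof. by rewrite /absC normr1. Qed.
Lemma absCX z n : absC (z ^+ n) = absC z ^+ n.
Proof. by elim: n => [|n IH]; rewrite ?expr0 ?absC1 // exprS absCM IH -exprS. Qed.
Lemma absC_gt0 z : z != 0 -> 0 < absC z.
Proof.
move=> z0; have : 0 < `|z| by rewrite normr_gt0.
by rewrite absCE ltcE /= => /andP[].
Qed.
Lemma absC_eq1 z : (`|z| = 1) <-> (absC z = 1).
Proof.
rewrite absCE; split=> [e|->]; last by rewrite /cofR rmorph1.
by have := congr1 (@complex.Re _) e.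
Qed.
Lemma absC_expi t : absC (expi t) = 1. Proof. exact/absC_eq1/norm_expi. Qed.
Lemma absC_cofR x : 0 <= x -> absC (cofR x) = x.
Proof. by move=> x0; rewrite /absC norm_cofR /= ger0_norm. Qed.
End RealComplex.

(** * Homomorphisms into divisible groups and into the real line *)

Section Homs.
Context (K F : fieldType).

(** By Bezout, an exponent prime to [p] would put [x] itself into the domain. So a value [y] at [x]
    has to respect only the single relation [y ^+ p = z]. *)
Lemma dom_prime_dvd (G : set (K * F)) (x : K) (p : nat) (z : F) (i : int) (y : F) :
  subgrp G -> x != 0 -> (forall y, ~ G (x, y)) -> prime p ->
  G (x ^+ p, z) -> G (x ^ i, y) -> (p %| i)%Z.
Proof.
move=> sG x0 nG pp Gz Gy; apply: contrapT => /negP npi.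
have cop : coprime p `|i|%N by rewrite prime_coprime.
have [a [b]] := Bezoutz p i; rewrite /gcdz (eqP cop) => e.
have [_ GM _] := sG.
have := GM _ _ (subgrp_expz a sG Gz) (subgrp_expz b sG Gy).
rewrite /= -[x ^+ p]/(x ^ p%:Z) !exprz_exp -expfzDr //.
by rewrite [p%:Z * a]mulrC [i * b]mulrC e expr1z; apply: nG.
Qed.

Definition mulgrp (T : fieldType) (H : set T) :=
  [/\ H 1, ~ H 0, forall x y, H x -> H y -> H (x * y) & forall x, H x -> H x^-1].

Lemma mulgrp_expz (T : fieldType) (H : set T) x (i : int) : mulgrp H -> H x -> H (x ^ i).
Proof.
move=> [H1 _ HM HV] Hx.
have h (n : nat) : H (x ^+ n).
  by elim: n => [|n IH]; [rewrite expr0|rewrite exprS; exact: HM].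
by case: i => n; [exact: h|exact/HV/h].
Qed.

Definition multhom (f : K -> F) :=
  [/\ f 0 = 0, f 1 = 1 & {morph f : x y / x * y}].

(** Divisible abelian groups are injective. At an element of prime order [p] modulo the domain a
    [p]-th root of the prescribed value is chosen in [D]; at an element of infinite order the value
    is free, and 1 is taken. *)
Lemma extend_hom_divisible (D : set F) (G0 : set (K * F)) :
  mulgrp D -> (forall p z, prime p -> D z -> exists2 y, D y & y ^+ p = z) ->
  subgrp G0 -> (forall u, G0 u -> u.1 != 0 /\ D u.2) ->
  (forall y, G0 (1, y) -> y = 1) ->
  exists f : K -> F, [/\ multhom f, forall x, x != 0 -> D (f x) &
    forall u, G0 u -> f u.1 = u.2].
Proof.
move=> sD divD sG0 G0D G01; have [D1 D0 DM DV] := sD.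
pose q := [set u : K * F | [/\ u.1 != 0, D u.2 & u.1 = 1 -> u.2 = 1]].
have [||||| f [fq f0 f1 fM fG]] := @extend_hom K F q G0.
- by [].
- move=> [x y] Gu; have [x0 Dy] := G0D _ Gu; split=> //= x1.
  by apply: G01; rewrite -x1.
- by move=> u [u0 Du _]; split=> //; apply/eqP => u20; apply: D0; rewrite -u20.
- by move=> y [_ _]; apply.
- move=> G x sG Gq x0 nG h; have [G1 GM GV] := sG.
  have D_expz (y : F) (i : int) : D y -> D (y ^ i) by exact: mulgrp_expz.
  have D_neq0 y : D y -> y != 0 by move=> Dy; apply/eqP => y0; apply: D0; rewrite -y0.
  have inv v i : G v -> v.1 * x ^ i = 1 -> G (x ^ i, v.2^-1).
    move=> Gv e; have [v0 _ _] := Gq _ Gv.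
    have -> : x ^ i = v.1^-1 by apply: (mulfI v0); rewrite e divff.
    exact: GV.
  case: h => [[p [z [pp Gz]]]|no].
    have [_ /= Dz _] := Gq _ Gz; have [y Dy yz] := divD _ _ pp Dz.
    exists y; split; first exact: D_neq0.
    move=> _ [v [i [Gv ->]]]; have [v0 Dv _] := Gq _ Gv; split=> /=.
    + by rewrite mulf_neq0 ?expfz_neq0.
    + by apply: DM => //; apply: D_expz.
    + move=> e; have Gi := inv _ _ Gv e.
      have /dvdzP[j ij] := dom_prime_dvd sG x0 nG pp Gz Gi.
      rewrite ij mulrC [j * _]mulrC -exprz_exp [y ^ p]yz mulrC.
      have := Gq _ (GM _ _ Gv (subgrp_expz j sG Gz)) => -[_ _] /=; apply.
      by rewrite -[x ^+ p]/(x ^ p%:Z) exprz_exp [p%:Z * j]mulrC -ij.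
  exists 1; split; first exact: oner_neq0.
  move=> _ [v [i [Gv ->]]]; have [v0 Dv v1] := Gq _ Gv; rewrite exp1rz mulr1.
  split=> //=; first by rewrite mulf_neq0 ?expfz_neq0.
  move=> e; have Gi := inv _ _ Gv e; case: i e Gi => [[|n]|n] e Gi.
  + by apply: v1; move: e; rewrite expr0z mulr1.
  + by case: (no n.+1 v.2^-1).
  + case: (no n.+1 v.2) => //; have := GV _ Gi.
    by rewrite /= NegzE -invr_expz !invrK.
exists f; split=> // x x0; by have [] := fq x x0.
Qed.
End Homs.

Section AdditiveHoms.
Context (R : realType) (K : fieldType).

Definition addhom (A : K -> R) := forall x y, x != 0 -> y != 0 -> A (x * y) = A x + A y.

Section Theory.
Context (A : K -> R) (hA : addhom A).
Lemma addhom1 : A 1 = 0.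
Proof.
have := hA (oner_neq0 _) (oner_neq0 _); rewrite mul1r => /esym/eqP.
by rewrite addrC -subr_eq0 addrK => /eqP.
Qed.
Lemma addhomV x : x != 0 -> A x^-1 = - A x.
Proof.
move=> x0; apply/eqP; rewrite -subr_eq0 opprK; apply/eqP.
by rewrite -hA ?invr_eq0 // mulVf // addhom1.
Qed.
Lemma addhomX x (n : nat) : x != 0 -> A (x ^+ n) = A x *+ n.
Proof.
move=> x0; elim: n => [|n IH]; first by rewrite expr0 addhom1 mulr0n.
by rewrite exprS hA ?expf_neq0 // IH mulrS.
Qed.
Lemma addhomXz x (i : int) : x != 0 -> A (x ^ i) = A x *~ i.
Proof.
move=> x0; case: i => n; first exact: addhomX.
by rewrite NegzE -invr_expz addhomV ?expfz_neq0 // mulrNz -[x ^ n.+1%:Z]/(x ^+ n.+1) addhomX.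
Qed.
Lemma addhom_torsion x (n : nat) : (0 < n)%N -> x ^+ n = 1 -> A x = 0.
Proof.
move=> n0 xn; have x0 : x != 0.
  by apply: contra_eq_neq xn => ->; rewrite expr0n gtn_eqF // eq_sym oner_neq0.
have := addhomX n x0; rewrite xn addhom1 => /esym/eqP.
by rewrite mulrn_eq0 gtn_eqF // => /eqP.
Qed.
End Theory.

Lemma addhomD A B : addhom A -> addhom B -> addhom (fun x => A x + B x).
Proof. by move=> hA hB x y x0 y0; rewrite hA // hB // addrACA. Qed.
Lemma addhomZ c A : addhom A -> addhom (fun x => c * A x).
Proof. by move=> hA x y x0 y0; rewrite hA // mulrDr. Qed.
Lemma addhom0 : addhom (fun=> 0).
Proof. by move=> x y _ _; rewrite addr0. Qed.

(** No positive power of [r] lies in [H], so the map equal to 1 on [H] and to e at [r] is well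
    defined. It extends to all of [K^*] because the positive reals are divisible, and [A] is the
    logarithm of the extension. *)
Lemma separating_hom (H : set K) (r : K) : mulgrp H -> r != 0 ->
  (forall n : nat, (0 < n)%N -> ~ H (r ^+ n)) ->
  exists A, [/\ addhom A, forall h, H h -> A h = 0 & A r = 1].
Proof.
move=> sH r0 nH; have [H1 H0 HM HV] := sH.
pose H' : set (K * R) := [set u | H u.1 /\ u.2 = 1].
have sH' : subgrp H'.
  split=> //=.
    by move=> u v [? ->] [? ->]; split; rewrite ?mul1r //; apply: HM.
  by move=> u [? ->]; split; rewrite ?invr1 //; apply: HV.
have e0 : expR 1 != 0 :> R by rewrite gt_eqF // expR_gt0.
have H_neq0 h : H h -> h != 0 by move=> Hh; apply/eqP => h0; apply: H0; rewrite -h0.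
have [|||||f [[f0 f1 fM] fpos fG]] :=
    @extend_hom_divisible K R [set x | 0 < x] (adjoin H' r (expR 1)).
- split=> /=; rewrite ?ltr01 ?ltxx //.
    by move=> x y; apply: mulr_gt0.
  by move=> x; rewrite invr_gt0.
- move=> p z pp z0; exists (expR (ln z / p%:R)); first exact: expR_gt0.
  by rewrite -expRM_natl mulrC mulfVK ?lnK // pnatr_eq0 gtn_eqF ?prime_gt0.
- exact: subgrp_adjoin.
- move=> _ [v [i [[Hv v1] ->]]] /=; rewrite v1 mul1r; split.
    by rewrite mulf_neq0 ?expfz_neq0 ?(H_neq0 _ Hv).
  by rewrite exprz_gt0 // expR_gt0.
- move=> y [v [i [[Hv v1] [e ->]]]]; rewrite v1 mul1r.
  have ri : r ^ i = v.1^-1 by apply: (mulfI (H_neq0 _ Hv)); rewrite -e divff ?H_neq0.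
  case: i e ri => [[|n]|n] e ri; first by rewrite expr0z.
    by case: (nH n.+1) => //; rewrite [r ^+ _]ri; apply: HV.
  case: (nH n.+1) => //; have -> : r ^+ n.+1 = v.1 by rewrite -[LHS]invrK -[LHS]/((r ^ Negz n)^-1) ri invrK.
  exact: Hv.
exists (fun x => ln (f x)); split.
- by move=> x y x0 y0 /=; rewrite fM lnM // posrE; apply: fpos.
- move=> h Hh /=.
  by rewrite (fG (h, 1)) ?ln1 //; apply: sub_adjoin.
- rewrite /= (fG (r, expR 1)) ?expRK //; exact: adjoin_gen.
Qed.

End AdditiveHoms.

(** * Characters of the multiplicative group of a field *)

Definition tors (K : fieldType) : set K := [set x | exists n : nat, (0 < n)%N /\ x ^+ n = 1].

Section Torsion.
Context (K : fieldType).

Lemma tors_neq0 (x : K) : tors x -> x != 0.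
Proof.
move=> [n [n0 xn]].
by apply: contra_eq_neq xn => ->; rewrite expr0n gtn_eqF // eq_sym oner_neq0.
Qed.

Lemma mulgrp_tors : mulgrp (@tors K).
Proof.
split.
- by exists 1%N; rewrite expr1.
- by move=> /tors_neq0; rewrite eqxx.
- move=> x y [n [n0 xn]] [m [m0 ym]]; exists (n * m)%N; split; first by rewrite muln_gt0 n0.
  by rewrite exprMn exprM xn expr1n mulnC exprM ym expr1n mul1r.
- by move=> x [n [n0 xn]]; exists n; rewrite exprVn xn invr1.
Qed.

Lemma tors_exp (x : K) (n : nat) : (0 < n)%N -> tors (x ^+ n) -> tors x.
Proof. by move=> n0 [m [m0 e]]; exists (n * m)%N; rewrite muln_gt0 n0 m0 exprM. Qed.

Lemma prime_primitive_root (w : K) (p : nat) :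
  prime p -> w ^+ p = 1 -> w != 1 -> p.-primitive_root w.
Proof.
move=> pp wp w1; have [m prim_m] := prim_order_exists (prime_gt0 pp) wp.
case/primeP: pp => _ /[apply] /orP[/eqP m1|/eqP <- //].
by move: (prim_expr_order prim_m) w1; rewrite m1 expr1 => ->; rewrite eqxx.
Qed.
End Torsion.

Section InjectiveCharacter.
Context (R : realType) (K : fieldType).
Hypothesis K_countable : countable [set: K].
Local Notation C := (Cplx R).

(** Injectivity and the condition on absolute values are built into the constraint [q]. At an
    element of infinite order the new value gets an absolute value multiplicatively independent of
    the earlier ones; at prime order a suitable root must be found among the [p]-th roots of the
    prescribed value. *)
Lemma injective_character : exists f : K -> C,
  [/\ multhom f, forall x, x != 0 -> f x != 0, forall x, f x = 1 -> x = 1 &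
    forall x, x != 0 -> absC (f x) = 1 -> tors x].
Proof.
pose q := [set u : K * C | [/\ [/\ u.1 != 0 & u.2 != 0], u.1 = 1 -> u.2 = 1,
  u.2 = 1 -> u.1 = 1 & absC u.2 = 1 -> tors u.1]].
have s0 : subgrp [set (1 : K, 1 : C)].
  by split=> [//|u v -> ->|u ->] /=; rewrite ?mul1r ?invr1.
have [||||| f [fq f0 f1 fM _]] := @extend_hom K C q [set (1, 1)].
- exact: s0.
- move=> u ->; split=> //=; first by rewrite !oner_neq0.
  by move=> _; have [] := mulgrp_tors K.
- by move=> u [[]].
- by move=> y [_ e _ _]; apply: e.
- move=> G x sG Gq x0 nG h; have [G1 GM GV] := sG.
  have inv v i : G v -> v.1 * x ^ i = 1 -> G (x ^ i, v.2^-1).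
    move=> Gv e; have [[v0 _] _ _ _] := Gq _ Gv.
    have -> : x ^ i = v.1^-1 by apply: (mulfI v0); rewrite e divff.
    exact: GV.
  case: h => [[p [z [pp Gz]]]|no].
    have p0 := prime_gt0 pp.
    have [[/= _ z0] _ _ _] := Gq _ Gz.
    have root_neq0 y : y ^+ p = z -> y != 0.
      by move=> e; apply: contraNneq z0 => y0; rewrite -e y0 expr0n gtn_eqF.
    have mulz v j : G v -> G (v.1 * x ^ (p%:Z * j), v.2 * z ^ j).
      by move=> Gv; rewrite -exprz_exp; exact: (GM _ _ Gv (subgrp_expz j sG Gz)).
    (* a root [y] of [z] works unless it is [g^-1] for some [(h, g)] in [G] such
       that [h x] is a nontrivial [p]-th root of unity *)
    have bad y : y ^+ p = z -> (exists v i, [/\ G v, v.2 * y ^ i = 1 & v.1 * x ^ i <> 1]) ->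
        exists v, [/\ G v, v.2 * y = 1, (v.1 * x) ^+ p = 1 & v.1 * x != 1].
      move=> yz [v [i [Gv ev nv]]]; have y0 := root_neq0 _ yz.
      have npi : ~~ (p %| i)%Z.
        apply/negP => /dvdzP[j ij]; apply: nv.
        have yi : y ^ i = z ^ j by rewrite ij mulrC -exprz_exp -yz.
        have /= [_ _ h _] := Gq _ (mulz v j Gv).
        by rewrite ij [j * _]mulrC; apply: h; rewrite -yi.
      have cop : coprime p `|i|%N by rewrite prime_coprime.
      have [a [b]] := Bezoutz p i; rewrite /gcdz (eqP cop) => e.
      pose w := (v.1 ^ b * x ^ (- (p%:Z * a)), v.2 ^ b * z ^ (- a)).
      have Gw : G w.
        have := mulz (v.1 ^ b, v.2 ^ b) (- a); rewrite mulrN; apply.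
        by apply: subgrp_expz => //; rewrite -surjective_pairing.
      have wy : w.2 * y = 1.
        rewrite /w /=; have -> : v.2 = y ^ (- i).
          by rewrite -invr_expz; apply: (mulIf (expfz_neq0 i y0)); rewrite ev mulVf ?expfz_neq0.
        rewrite -yz -[y ^+ p]/(y ^ p%:Z) !exprz_exp -[X in _ * X]expr1z.
        by rewrite -!expfzDr // -[1]e -[RHS](expr0z y); congr (y ^ _); ring.
      exists w; split=> //.
        have Gp : G ((w.1 * x) ^+ p, 1).
          have : G (w.1 ^+ p * x ^+ p, w.2 ^+ p * z).
            apply: (GM (w.1 ^+ p, w.2 ^+ p) (x ^+ p, z)) => //.
            by apply: (subgrp_expz p sG); rewrite -surjective_pairing.
          by rewrite -yz -!exprMn wy expr1n.
        by have /= [_ _ h _] := Gq _ Gp; apply: h.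
      apply/eqP => wx; apply: (nG y).
      have [[w0 _] _ _ _] := Gq _ Gw.
      have -> : x = w.1^-1 by apply: (mulfI w0); rewrite wx divff.
      have -> : y = w.2^-1.
        have w20 : w.2 != 0 by have [[_ w20] _ _ _] := Gq _ Gw.
        by apply: (mulfI w20); rewrite wy divff.
      exact: GV.
    (* If [y] and [y * om] are both bad, with witnesses [v] and [w], then [w.1 / v.1] is a [p]-th
       root of unity in the domain; it is not 1, since its value is the inverse of [om]. So the
       domain contains all [p]-th roots of unity, among them [v.1 * x], and hence [x]. *)
    have [y [y0 yz good]] : exists y, [/\ y != 0, y ^+ p = z &
        forall v i, G v -> v.2 * y ^ i = 1 -> v.1 * x ^ i = 1].
      apply: contrapT => no.
      have isbad y : y ^+ p = z -> exists v, [/\ G v, v.2 * y = 1, (v.1 * x) ^+ p = 1 & v.1 * x != 1].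
        move=> yz; apply: (bad _ yz); apply: contrapT => nb; apply: no.
        exists y; split=> //; first exact: root_neq0.
        by move=> v i Gv ev; apply: contrapT => nv; apply: nb; exists v, i.
      have [y yz] := @closed_root C p z p0.
      have [om prim_om] : exists om : C, p.-primitive_root om.
        by apply: closed_prim_root; rewrite pnatr_eq0 gtn_eqF.
      have [v [Gv vy vp v1]] := isbad _ yz.
      have [|w [Gw wy wp w1]] := isbad (y * om).
        by rewrite exprMn (prim_expr_order prim_om) mulr1.
      have [[v0 v20] _ _ _] := Gq _ Gv; have [[w0 w20] _ _ _] := Gq _ Gw.
      have Gr := GM _ _ Gw (GV _ Gv).
      have r1 : w.1 * v.1^-1 != 1.
        apply/eqP => r1; have /= [_ h _ _] := Gq _ Gr.
        have := h r1 => /(congr1 (fun t => t * v.2 * y * om)).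
        rewrite mul1r vy mul1r mulfVK // -mulrA wy => om1.
        have := eq_prim_root_expr prim_om 1 0; rewrite -om1 !expr1n eqxx => /esym.
        by rewrite (modn_small (prime_gt1 pp)) mod0n.
      have rp : (w.1 * v.1^-1) ^+ p = 1.
        have -> : w.1 * v.1^-1 = (w.1 * x) / (v.1 * x).
          by rewrite invfM mulrACA divff // mulr1.
        by rewrite expr_div_n wp vp divr1.
      have [j e] := prim_rootP (prime_primitive_root pp rp r1) vp.
      have := GM _ _ (subgrp_expz j sG Gr) (GV _ Gv); rewrite /= -exprnP -e mulrAC divff // mul1r.
      exact: nG.
    exists y; split=> // _ [v [i [Gv ->]]]; have [[v0 v20] v1 _ vt] := Gq _ Gv.
    split=> /=.
    + by rewrite !mulf_neq0 ?expfz_neq0.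
    + move=> e; have Gi := inv _ _ Gv e.
      have /dvdzP[j ij] := dom_prime_dvd sG x0 nG pp Gz Gi.
      have yi : y ^ i = z ^ j by rewrite ij mulrC -exprz_exp -yz.
      have /= [_ h _ _] := Gq _ (mulz v j Gv).
      by rewrite yi; apply: h; rewrite [p%:Z * j]mulrC -ij.
    + exact: good.
    + move=> e; apply: (tors_exp p0).
      have : G (v.1 ^+ p * (x ^+ p) ^ i, v.2 ^+ p * z ^ i).
        apply: (GM (v.1 ^+ p, v.2 ^+ p) ((x ^+ p) ^ i, z ^ i)); last exact: subgrp_expz.
        by apply: (subgrp_expz p sG); rewrite -surjective_pairing.
      have swap (T : fieldType) (a b : T) : a ^+ p * (b ^+ p) ^ i = (a * b ^ i) ^+ p.
        rewrite exprMn -[b ^+ p]/(b ^ p%:Z) -[(b ^ i) ^+ p]/((b ^ i) ^ p%:Z).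
        by rewrite !exprz_exp [p%:Z * i]mulrC.
      rewrite -yz !swap => Gp; have /= [_ _ _] := Gq _ Gp; apply.
      by rewrite /= absCX e expr1n.
  (* [G] is single-valued, so countability of [K] makes countable the set of those [t] for which
     some [v.2 * y ^ i], with [i] nonzero, has absolute value 1. *)
  pose f (h : K) := xget 0 [set g | G (h, g)].
  pose bad := [set - ln (absC (f u.1)) / u.2%:~R | u in [set: K * int]].
  have cbad : countable bad.
    apply: (sub_countable (card_image_le _ _)).
    rewrite -setXTT; apply: countableX => //; exact: countableP.
  have [t [_ nt]] := avoid_countable cbad (@ltr01 R).
  pose y := cofR (expR t).
  have y0 : y != 0 by rewrite /y /cofR fmorph_eq0 gt_eqF ?expR_gt0.
  have no' v i : G v -> absC (v.2 * y ^ i) = 1 -> i = 0.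
    move=> Gv e; have [//|i0] := eqVneq i 0; exfalso; apply: nt; exists (v.1, i) => //=.
    have -> : f v.1 = v.2.
      rewrite /f; case: xgetP => [g _ Gg|h0]; last by case: (h0 v.2); rewrite /= -surjective_pairing.
      have [[_ g0] _ _ _] := Gq _ Gg; have [[v0 v20] _ _ _] := Gq _ Gv.
      have [/= _ h _ _] := Gq _ (GM _ _ Gg (GV _ Gv)).
      by apply: (mulIf (invr_neq0 v20)); rewrite [RHS]divff //; apply: h; rewrite divff.
    have [[_ v20] _ _ _] := Gq _ Gv.
    have yi : absC (y ^ i) = expR (t * i%:~R).
      have yn (n : nat) : absC (y ^+ n) = expR (t * n%:R).
        by rewrite absCX absC_cofR ?expR_ge0 // expRM_natr.
      case: (i) => n; first by rewrite [LHS]yn.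
      have := absCM (y ^ Negz n) (y ^+ n.+1); rewrite yn.
      rewrite [X in absC X](_ : _ = 1) ?absC1; last first.
        by rewrite NegzE -invr_expz mulVf ?expfz_neq0.
      move=> h; apply: (mulIf (lt0r_neq0 (expR_gt0 (t * n.+1%:R)))).
      by rewrite -h -expRD NegzE mulrNz -[_%:~R]/(n.+1%:R) mulrN addNr expR0.
    move: e; rewrite absCM yi => /(congr1 (@ln R)).
    rewrite lnM ?posrE ?expR_gt0 ?absC_gt0 // expRK ln1 => /eqP.
    by rewrite addrC addr_eq0 => /eqP <-; rewrite mulfK // intr_eq0.
  exists y; split=> // _ [v [i [Gv ->]]]; have [[v0 v20] v1 v2 vt] := Gq _ Gv.
  split=> /=.
  + by rewrite !mulf_neq0 ?expfz_neq0.
  + move=> e; have Gi := inv _ _ Gv e; case: i e Gi => [[|n]|n] e Gi.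
    * by move: e; rewrite !expr0z !mulr1.
    * by case: (no n.+1 v.2^-1).
    * case: (no n.+1 v.2) => //; have := GV _ Gi.
      by rewrite /= NegzE -invr_expz !invrK.
  + move=> e; have i0 : i = 0 by apply: (no' v) => //; rewrite e absC1.
    by move: e; rewrite i0 !expr0z !mulr1; exact: v2.
  + move=> e; have i0 : i = 0 by apply: (no' v).
    by move: e; rewrite i0 !expr0z !mulr1; exact: vt.
have fn0 x : x != 0 -> f x != 0 by move=> /fq[[]].
exists f; split=> //.
- move=> x e; have x0 : x != 0.
    by apply: contra_eq_neq e => ->; rewrite f0 eq_sym oner_neq0.
  by have [_ _ h _] := fq _ x0; apply: h.
- by move=> x /fq[_ _ _]; apply.
Qed.

(** Dividing the injective character by its absolute value may destroy injectivity; the factor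
    [expi (s * L x)] restores it. If [L x] is nonzero, only countably many [s] give the value 1 at
    [x]; if [L x = 0], the absolute value was already 1. *)
Lemma unitary_injective_character : exists (th : K -> C) (L : K -> R),
  [/\ multhom th, forall x, x != 0 -> absC (th x) = 1, forall x, th x = 1 -> x = 1,
    addhom L & forall x, x != 0 -> L x = 0 -> tors x].
Proof.
have [f [[f0 f1 fM] fn0 finj ftors]] := injective_character.
pose L x := ln (absC (f x)).
have hL : addhom L.
  by move=> x y x0 y0; rewrite /L fM absCM lnM // posrE absC_gt0 ?fn0.
have Ltors x : x != 0 -> L x = 0 -> tors x.
  move=> x0 /(congr1 (@expR R)); rewrite expR0 lnK ?posrE ?absC_gt0 ?fn0 //; exact: ftors.
pose g x := f x / cofR (absC (f x)).
have nc x : x != 0 -> cofR (absC (f x)) != 0.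
  by move=> x0; rewrite /cofR fmorph_eq0 gt_eqF // absC_gt0 ?fn0.
have absg x : x != 0 -> absC (g x) = 1.
  move=> x0; apply/absC_eq1; rewrite normrM normfV norm_cofR absCE.
  by rewrite ger0_norm ?ltW ?absC_gt0 ?fn0 // divff ?nc.
have gM : {morph g : x y / x * y}.
  by move=> x y; rewrite /g fM absCM cofRM invfM mulrACA.
pose A x := xget 0 [set t | expi t = g x].
have AE x : x != 0 -> expi (A x) = g x.
  move=> /absg/absC_eq1/expi_surj[t e]; rewrite /A; case: xgetP => [? _ //|/(_ t)].
  by case.
have cbad : countable (\bigcup_(x in [set x | x != 0 /\ L x != 0]) [set s | expi (A x + s * L x) = 1]).
  apply: bigcup_countable; first exact: (sub_countable (subset_card_le (@subsetT _ _))).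
  by move=> x [_ L0]; apply: countable_expi_scale.
have [s [_ ns]] := avoid_countable cbad (@ltr01 R).
pose th x := g x * expi (s * L x).
have th0 : th 0 = 0 by rewrite /th /g f0 !mul0r.
exists th, L; split=> //.
- split=> //.
    by rewrite /th /g f1 absC1 /L f1 absC1 ln1 mulr0 expi0 mulr1 mul1r /cofR rmorph1 invr1.
  move=> x y; have [->|x0] := eqVneq x 0; first by rewrite mul0r th0 mul0r.
  have [->|y0] := eqVneq y 0; first by rewrite mulr0 th0 mulr0.
  by rewrite /th gM hL // mulrDr expiD mulrACA.
- by move=> x x0; rewrite absCM absg // absC_expi mulr1.
- move=> x e; have x0 : x != 0.
    by apply: contra_eq_neq e => ->; rewrite th0 eq_sym oner_neq0.
  have L0 : L x = 0.
    apply: contrapT => /eqP L0; apply: ns; exists x => //.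
    by rewrite /= expiD AE.
  apply: finj; have af : absC (f x) = 1.
    by rewrite -[LHS]lnK ?posrE ?absC_gt0 ?fn0 // -/(L x) L0 expR0.
  by move: e; rewrite /th /g af L0 mulr0 expi0 mulr1 /cofR rmorph1 divr1.
Qed.
End InjectiveCharacter.

Lemma multhomXz (K F : fieldType) (f : K -> F) (x : K) (i : int) :
  multhom f -> f (x ^ i) = f x ^ i.
Proof.
move=> [f0 f1 fM].
have fX y (n : nat) : f (y ^+ n) = f y ^+ n.
  by elim: n => [|n IH]; rewrite ?expr0 // exprS fM IH -exprS.
case: i => n; first exact: fX.
have [->|x0] := eqVneq x 0; first by rewrite !exp0rz f0 exp0rz.
have fV y : y != 0 -> f y^-1 = (f y)^-1.
  move=> y0; have e : f y * f y^-1 = 1 by rewrite -fM divff.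
  have fy0 : f y != 0 by apply: contra_eq_neq e => ->; rewrite mul0r eq_sym oner_neq0.
  by apply: (mulfI fy0); rewrite e divff.
by rewrite NegzE -!invr_expz fV ?expfz_neq0 // -[x ^ n.+1%:Z]/(x ^+ n.+1) fX.
Qed.

Lemma expiMz (R : realType) (t : R) (i : int) : expi (t *~ i) = expi t ^ i.
Proof.
have h (n : nat) : expi (t *+ n) = expi t ^+ n.
  by elim: n => [|n IH]; rewrite ?mulr0n ?expi0 // mulrS expiD IH exprS.
by case: i => n; [exact: h|rewrite NegzE mulrNz expiN -invr_expz -pmulrn h].
Qed.

(** * Finitely generated groups, positivity and arithmetic progressions *)

Section Generated.
Context (K : fieldType).

Fixpoint gen (rs : seq K) : set K :=
  if rs is r :: rs' then [set x | exists y (i : int), gen rs' y /\ x = y * r ^ i]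
  else @tors K.

Lemma mulgrp_gen rs : (forall r, r \in rs -> r != 0) -> mulgrp (gen rs).
Proof.
elim: rs => [_|r rs IH h]; first exact: mulgrp_tors.
have [|G1 G0 GM GV] := IH; first by move=> s sr; apply: h; rewrite inE sr orbT.
have r0 : r != 0 by apply: h; rewrite inE eqxx.
split.
- by exists 1, 0; rewrite expr0z mulr1.
- move=> [y [i [Gy /eqP]]]; rewrite eq_sym mulf_eq0 (negbTE (expfz_neq0 i r0)) orbF.
  by move=> /eqP y0; apply: G0; rewrite -y0.
- move=> _ _ [x [i [Gx ->]]] [y [j [Gy ->]]]; exists (x * y), (i + j).
  by split; [exact: GM|rewrite expfzDr // mulrACA].
- move=> _ [x [i [Gx ->]]]; exists x^-1, (- i).
  by split; [exact: GV|rewrite invfM invr_expz].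
Qed.

Lemma tors_gen rs x : tors x -> gen rs x.
Proof. by elim: rs => [//|r rs IH] /IH Gx; exists x, 0; rewrite expr0z mulr1. Qed.

Lemma mem_gen rs r : r \in rs -> gen rs r.
Proof.
elim: rs => // s rs IH; rewrite inE => /orP[/eqP ->|/IH Gr].
  by exists 1, 1; split; [apply: tors_gen; have [] := mulgrp_tors K|rewrite mul1r expr1z].
by exists r, 0; rewrite expr0z mulr1.
Qed.

(** These are the products of nonnegative powers with exponents not all zero, the multiplicative
    form of the nontrivial nonnegative combinations in Gordan's theorem. *)
Fixpoint monomials (rs : seq K) : set K :=
  if rs is r :: rs' then
    [set x | exists n : nat, (0 < n)%N /\ x = r ^+ n \/
                             exists y, monomials rs' y /\ x = y * r ^+ n]
  else set0.

Lemma monomials_sub (S : set K) rs : (forall x y, S x -> S y -> S (x * y)) ->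
  (forall r, r \in rs -> S r) -> monomials rs `<=` S.
Proof.
move=> SM; elim: rs => [_ //|r rs IH] Srs x.
have SX (n : nat) : S (r ^+ n.+1).
  elim: n => [|n IHn]; first by rewrite expr1; apply: Srs; rewrite inE eqxx.
  by rewrite exprS; apply: SM => //; apply: Srs; rewrite inE eqxx.
have Srs' s : s \in rs -> S s by move=> sr; apply: Srs; rewrite inE sr orbT.
move=> [[|n] [[// n0 ->]|[y [my ->]]]].
- by rewrite expr0 mulr1; apply: IH.
- exact: SX.
- by apply: SM; [apply: IH|apply: SX].
Qed.
End Generated.

Section LiftUnitary.
Context (R : realType) (K : closedFieldType).
Local Notation C := (Cplx R).

(** [k] annihilates the torsion factor of [x]. The real-valued [B] vanishes on that factor, so [om]
    has to be trivial there. *)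
Lemma gen_agree (rs : seq K) (x : K) : (forall r, r \in rs -> r != 0) -> gen rs x ->
  exists2 k : nat, (0 < k)%N & forall (om : K -> C) (B : K -> R), multhom om -> addhom B ->
    (forall z, z ^+ k = 1 -> om z = 1) -> (forall r, r \in rs -> expi (B r) = om r) ->
    expi (B x) = om x.
Proof.
elim: rs x => [|r rs IH] x h.
  move=> [k [k0 xk]]; exists k => // om B _ hB om1 _.
  by rewrite (addhom_torsion hB k0 xk) expi0 om1.
have h' s : s \in rs -> s != 0 by move=> sr; apply: h; rewrite inE sr orbT.
have r0 : r != 0 by apply: h; rewrite inE eqxx.
move=> [y [i [Gy ->]]]; have [k k0 H] := IH y h' Gy; exists k => // om B hom hB om1 e.
have y0 : y != 0.
  by apply/eqP => y0; have [_ G0 _ _] := mulgrp_gen h'; apply: G0; rewrite -y0.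
have [_ _ omM] := hom.
rewrite hB ?expfz_neq0 // omM expiD (H om B) //; last first.
  by move=> s sr; apply: e; rewrite inE sr orbT.
by rewrite (addhomXz hB) // expiMz e ?inE ?eqxx // multhomXz.
Qed.

Lemma gen_root (m : nat) (rs ss : seq K) (y : K) : (0 < m)%N ->
  (forall r, r \in rs -> r != 0) -> rs = [seq s ^+ m | s <- ss] ->
  gen rs y -> exists2 x, gen ss x & x ^+ m = y.
Proof.
move=> m0; elim: rs ss y => [|r rs IH] [|s ss] y //= h.
  move=> _ ty; have [x xy] := closed_root y m0; exists x => //=.
  by apply: (tors_exp m0); rewrite xy.
move=> [e1 e2] [z [i [Gz ->]]].
have [|x Gx xz] := IH ss z _ e2 Gz; first by move=> t tr; apply: h; rewrite inE tr orbT.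
exists (x * s ^ i); first by exists x, i.
by rewrite exprMn xz e1 -[(s ^ i) ^+ m]/((s ^ i) ^ m%:Z) -[s ^+ m]/(s ^ m%:Z) !exprz_exp [i * _]mulrC.
Qed.

(* [K^*] is divisible, so that when the last element is dependent on the others
   it can be replaced by roots of the others. *)
Lemma lift_unitary (rs : seq K) : (forall r, r \in rs -> r != 0) ->
  exists2 n : nat, (0 < n)%N & forall om : K -> C, multhom om ->
    (forall x, x != 0 -> absC (om x) = 1) -> (forall z, z ^+ n = 1 -> om z = 1) ->
    exists2 B : K -> R, addhom B & forall r, r \in rs -> expi (B r) = om r.
Proof.
(* The induction is on the length, because the tail may be replaced by a list of roots of the same
   length. *)
elim: {rs}(size rs) {-2}rs (erefl (size rs)) => [|k IH] [|r rs] //=.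
  by move=> _ _; exists 1%N => // om _ _ _; exists (fun=> 0) => //; exact: addhom0.
move=> [sz] h.
have h' s : s \in rs -> s != 0 by move=> sr; apply: h; rewrite inE sr orbT.
have r0 : r != 0 by apply: h; rewrite inE eqxx.
have [[m [m0 Gm]]|no] := pselect (exists m : nat, (0 < m)%N /\ gen rs (r ^+ m)).
  pose root x := xget 0 [set y : K | y ^+ m = x].
  have rootP x : root x ^+ m = x.
    rewrite /root; case: xgetP => // no; have [y yx] := closed_root x m0.
    by case: (no y).
  pose ss := [seq root s | s <- rs].
  have ss0 s : s \in ss -> s != 0.
    move=> /mapP[t /h' t0 ->]; apply: contraNneq t0 => e.
    by rewrite -(rootP t) e expr0n gtn_eqF.
  have ess : rs = [seq s ^+ m | s <- ss].
    by rewrite -map_comp -[LHS]map_id; apply: eq_map => s /=; rewrite rootP.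
  have [x Gx xr] := gen_root m0 h' ess Gm.
  have x0 : x != 0.
    by apply: contraNneq (expf_neq0 m r0) => x0; rewrite -xr x0 expr0n gtn_eqF.
  have Gr : gen ss r.
    have [_ _ GM _] := mulgrp_gen ss0; rewrite -(divfK x0 r); apply: GM => //.
    by apply: tors_gen; exists m; split=> //; rewrite expr_div_n xr divff ?expf_neq0.
  have [j j0 agree] := gen_agree ss0 Gr.
  have [|n n0 H] := IH ss _ ss0; first by rewrite size_map.
  exists (n * j)%N; first by rewrite muln_gt0 n0.
  move=> om hom om1 omn.
  have [|B hB e] := H om hom om1.
    by move=> z zn; apply: omn; rewrite exprM zn expr1n.
  exists B => // s; rewrite inE => /orP[/eqP ->|sr].
    by apply: agree => // z zj; apply: omn; rewrite mulnC exprM zj expr1n.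
  have sin : root s \in ss by apply: map_f.
  rewrite -(rootP s) -[root s ^+ m]/(root s ^ m%:Z) (addhomXz hB) ?ss0 //.
  by rewrite expiMz e // multhomXz.
have [n n0 H] := IH rs sz h'; exists n => // om hom om1 omn.
have [B hB e] := H om hom om1 omn.
(* Here [r] is independent of the tail modulo torsion, so the value at [r] can be corrected by a
   multiple of [A] without disturbing the tail. *)
have [|A [hA A0 A1]] := separating_hom R (mulgrp_gen h') r0.
  by move=> m m0 Gm; apply: no; exists m.
have [t et] : exists t, expi t = om r / expi (B r).
  apply: expi_surj; rewrite normrM normfV norm_expi invr1 mulr1.
  exact/absC_eq1/om1.
exists (fun x => B x + t * A x); first by apply: addhomD => //; apply: addhomZ.
move=> s; rewrite inE => /orP[/eqP ->|sr].
  rewrite A1 mulr1 expiD et mulrC divfK //.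
  by have := norm_expi (B r) => /eqP; apply: contraTneq => ->; rewrite normr0 eq_sym oner_neq0.
by rewrite A0 ?mulr0 ?addr0 ?e //; apply: mem_gen.
Qed.
End LiftUnitary.

Section PositiveHom.
Context (R : realType) (K : fieldType).

Lemma dominating_scale (rs : seq K) (f g : K -> R) : (forall r, r \in rs -> 0 < g r) ->
  exists M, 0 < M /\ forall r, r \in rs -> 0 < M * g r + f r.
Proof.
elim: rs => [_|r rs IH h]; first by exists 1.
have [s sr|M [M0 HM]] := IH; first by apply: h; rewrite inE sr orbT.
have r0 : 0 < g r by apply: h; rewrite inE eqxx.
exists (M + `|f r| / g r); split; first by rewrite ltr_pwDl // divr_ge0 // ltW.
move=> s; rewrite inE => /orP[/eqP ->|sr].
  rewrite mulrDl divfK ?gt_eqF // -addrA ltr_pwDl ?mulr_gt0 //.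
  by rewrite -lerBlDr sub0r -normrN ler_norm.
have s0 : 0 < g s by apply: h; rewrite inE sr orbT.
apply: (lt_le_trans (HM s sr)); rewrite lerD2r ler_pM2r // lerDl divr_ge0 //.
exact: ltW.
Qed.

Lemma monomials_pos (A : K -> R) (rs : seq K) x : addhom A ->
  (forall r, r \in rs -> r != 0) -> (forall r, r \in rs -> 0 < A r) ->
  monomials rs x -> 0 < A x.
Proof.
move=> hA r0 rpos mx.
have [] : [set x | x != 0 /\ 0 < A x] x; last by [].
apply: (monomials_sub _ _ mx); last by move=> r rr; split; [apply: r0|apply: rpos].
by move=> y z [y0 Ay] [z0 Az]; rewrite /= mulf_neq0 // hA // addr_gt0.
Qed.

(* Gordan's theorem of the alternative, written multiplicatively. *)
Lemma positive_hom (H : set K) (rs : seq K) : mulgrp H ->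
  (forall r, r \in rs -> r != 0) -> (forall x, monomials rs x -> ~ H x) ->
  exists A : K -> R, [/\ addhom A, forall h, H h -> A h = 0 & forall r, r \in rs -> 0 < A r].
Proof.
elim: rs H => [|r rs IH] H sH h mH.
  by exists (fun=> 0); split=> //; exact: addhom0.
have h' s : s \in rs -> s != 0 by move=> sr; apply: h; rewrite inE sr orbT.
have r0 : r != 0 by apply: h; rewrite inE eqxx.
have [H1 H0 HM HV] := sH.
have H_neq0 x : H x -> x != 0 by move=> Hx; apply/eqP => x0; apply: H0; rewrite -x0.
pose H' : set K := [set x | exists y (i : int), H y /\ x = y * r ^ i].
have sH' : mulgrp H'.
  split.
  - by exists 1, 0; rewrite expr0z mulr1.
  - move=> [y [i [Hy /eqP]]]; rewrite eq_sym mulf_eq0 (negbTE (expfz_neq0 i r0)) orbF.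
    by rewrite (negbTE (H_neq0 _ Hy)).
  - move=> _ _ [x [i [Hx ->]]] [y [j [Hy ->]]]; exists (x * y), (i + j).
    by split; [exact: HM|rewrite expfzDr // mulrACA].
  - move=> _ [x [i [Hx ->]]]; exists x^-1, (- i).
    by split; [exact: HV|rewrite invfM invr_expz].
(* If a monomial in [rs] equals [r ^ i] modulo [H], then [i] is positive, as otherwise a monomial
   would lie in [H]; positivity on [rs] then implies positivity at [r]. If there is none, the
   induction hypothesis applies to [H'], and a large multiple of the map it gives dominates on [rs]
   a map that is 1 at [r]. *)
have [[x [mx [y [i [Hy xy]]]]]|no] := pselect (exists x, monomials rs x /\ H' x).
  have ipos : 0 < i.
    rewrite ltNge; apply/negP => i0.
    apply: (mH (x * r ^+ `|i|%N)); first by exists `|i|%N; right; exists x.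
    rewrite -[r ^+ _]/(r ^ `|i|%N%:Z) abszE ler0_norm // xy -mulrA -expfzDr // subrr.
    by rewrite expr0z mulr1.
  have [|A [hA AH Apos]] := IH H sH h'.
    move=> z mz; apply: mH; exists 0%N; right; exists z.
    by rewrite expr0 mulr1.
  exists A; split=> // s; rewrite inE => /orP[/eqP ->|]; last exact: Apos.
  have := monomials_pos hA h' Apos mx.
  rewrite xy hA ?expfz_neq0 ?(H_neq0 _ Hy) // AH // add0r (addhomXz hA) //.
  by rewrite pmulrz_lgt0.
have [|A0 [hA0 A0H A0pos]] := IH H' sH' h'.
  by move=> x mx Hx; apply: no; exists x.
have [|A1 [hA1 A1H A1r]] := separating_hom R sH r0.
  by move=> n n0; apply: mH; exists n; left.
have [M [M0 HM']] := dominating_scale A1 A0pos.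
exists (fun x => M * A0 x + A1 x); split.
- by apply: addhomD => //; apply: addhomZ.
- move=> x Hx; rewrite A1H // A0H ?mulr0 ?addr0 //.
  by exists x, 0; rewrite expr0z mulr1.
- move=> s; rewrite inE => /orP[/eqP ->|]; last exact: HM'.
  rewrite A1r A0H ?mulr0 ?add0r //.
  by exists 1, 1; rewrite mul1r expr1z.
Qed.
End PositiveHom.

(** The Chinese remainder theorem gives terms that are [a0] modulo [n] and 1 modulo [c'], the part
    of [c] prime to [n]. A prime dividing a term and [c] cannot divide [c'], so it divides [n], and
    then also [a0]. The summand [n * c'] in the first term keeps it positive. *)
Lemma pnat_progression (P : nat_pred) (a0 n c : nat) : (0 < n)%N -> (0 < c)%N ->
  (forall l, prime l -> ~~ (l %| c)%N -> l \in P) ->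
  (forall l, prime l -> (l %| a0)%N -> (l %| n)%N -> l \in P) ->
  exists a N : nat, [/\ (0 < N)%N, forall k, P.-nat (a + k * N)%N &
    forall k, (a + k * N = a0 %[mod n])%N].
Proof.
move=> n0 c0 Pc Pn; pose c' := (c`_(\pi(n)^'))%N.
have c'0 : (0 < c')%N by rewrite part_gt0.
have cop : coprime n c'.
  by rewrite (@pnat_coprime \pi(n)) ?pnat_pi // part_pnat.
pose a1 := chinese n c' a0 1.
exists (a1 + n * c')%N, (n * c')%N.
have modn k : (a1 + n * c' + k * (n * c') = a0 %[mod n])%N.
  by have -> : (a1 + n * c' + k * (n * c') = k.+1 * c' * n + a1)%N by [lia]; rewrite modnMDl chinese_modl.
split=> [|k|//]; first by rewrite muln_gt0 n0 c'0.
set a := (_ + _)%N; have a_gt0 : (0 < a)%N.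
  by rewrite /a ltn_addr // ltn_addl // muln_gt0 n0 c'0.
apply/pnatP => // l pl la; have [lc|] := boolP (l %| c)%N; last exact: Pc.
have [ln|ln] := boolP (l %| n)%N.
  apply: Pn => //; rewrite /dvdn -(modn_dvdm a0 ln) -(modn k) -/a modn_dvdm //.
have lc' : (l %| c')%N.
  have : (l %| c`_(\pi(n)) * c`_(\pi(n)^'))%N by rewrite partnC.
  rewrite Euclid_dvdM // => /orP[|//] h.
  have := pnatP _ (part_gt0 \pi(n) c) (part_pnat \pi(n) c) l pl h.
  by rewrite mem_primes => /and3P[_ _]; rewrite (negbTE ln).
have e : (a = 1 %[mod c'])%N.
  by have -> : a = (k.+1 * n * c' + a1)%N by [rewrite /a; lia]; rewrite modnMDl chinese_modr.
have := la; rewrite /dvdn -(modn_dvdm a lc') e modn_dvdm // modn_small ?prime_gt1 //.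
Qed.

(** * Approximation of multiplicative maps by characters of the path *)

Section ApproximateCharacter.
Context (R : realType) (K : closedFieldType).
Local Notation C := (Cplx R).

Lemma scale_near0 (T : eqType) (rs : seq T) (w f : T -> R) (e : R) : 0 < e ->
  exists2 d : R, 0 < d & forall s, 0 < s < d -> forall r, r \in rs ->
    `|w r * (expR (s * f r) - 1)| < e.
Proof.
move=> e0; elim: rs => [|r rs [d d0 IH]]; first by exists 1.
have : (fun s : R => w r * (expR (s * f r) - 1)) @ (0 : R) --> w r * (expR (0 * f r) - 1).
  apply: cvgM; first exact: cvg_cst.
  apply: cvgB; last exact: cvg_cst.
  apply: continuous_cvg; first exact: continuous_expR.
  by apply: cvgM; [exact: cvg_id|exact: cvg_cst].
rewrite mul0r expR0 subrr mulr0 => /cvgrPdist_lt/(_ e e0)/nbhs_ballP[d' /= d'0 hd'].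
exists (Num.min d d'); first by rewrite lt_min d0.
move=> s /andP[s0]; rewrite lt_min => /andP[sd sd'] t; rewrite inE => /orP[/eqP ->|tr].
  have := hd' s; rewrite /ball /= sub0r normrN => /(_ _); rewrite sub0r normrN; apply.
  by rewrite ger0_norm // ltW.
by apply: IH => //; rewrite s0.
Qed.

Definition mkchar (th : K -> C) (a : nat) (rho beta : K -> R) (x : K) : C :=
  if x == 0 then 0 else cofR (expR (rho x)) * th x ^+ a * expi (beta x).

Context (P : nat_pred) (th : K -> C) (L : K -> R).
Hypotheses (th_hom : multhom th) (th_abs : forall x, x != 0 -> absC (th x) = 1)
  (th_inj : forall x, th x = 1 -> x = 1) (L_hom : addhom L)
  (L_tors : forall x, x != 0 -> L x = 0 -> tors x)
  (K_countable : countable [set: K]) (K_char : forall n : nat, (0 < n)%N -> n%:R != 0 :> K).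

Lemma th_neq0 x : x != 0 -> th x != 0.
Proof.
move=> /th_abs; apply: contra_eq_neq => ->.
by rewrite /absC normr0 /= eq_sym oner_neq0.
Qed.

(* [S] is the image in [K] of the ring of functions on an affine open set, and
   [t] is the multiplicative map attached to a point of that set. *)
Lemma approximate_character (S : set K) (t : K -> C) (c : nat) :
  (0 < c)%N -> (forall l, prime l -> ~~ (l %| c)%N -> l \in P) ->
  S 1 -> (forall x y, S x -> S y -> S (x * y)) -> @tors K `<=` S ->
  t 0 = 0 -> t 1 = 1 -> (forall x y, S x -> S y -> t (x * y) = t x * t y) ->
  (forall l z, prime l -> l.-primitive_root z -> t z = 1 -> l \in P) ->
  forall (rs : seq K) (e : R), (forall r, r \in rs -> S r) -> 0 < e ->
  exists a N : nat, (0 < N)%N /\ forall k, P.-nat (a + k * N)%N /\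
    exists rho beta : K -> R, [/\ addhom rho, addhom beta,
      forall x, x != 0 -> rho x = 0 -> tors x &
      forall r, r \in rs -> absC (mkchar th (a + k * N) rho beta r - t r) < e].
Proof.
move=> c0 Pc S1 SM Stors t0 t1 tM tP rs e Srs e0.
have St_neq0 x : t x != 0 -> x != 0 by apply: contraNneq => ->; rewrite t0.
(* On quotients of elements where [t] does not vanish, [t] becomes a group homomorphism; by
   divisibility of the target it extends to a character [psi] of all of [K^*]. *)
pose H : set K := [set x | exists a b, [/\ S a, S b, t a != 0, t b != 0 & x = a / b]].
have sH : mulgrp H.
  split.
  - by exists 1, 1; rewrite t1 oner_neq0 divr1.
  - move=> [a [b [_ _ /St_neq0 a0 /St_neq0 b0 /esym/eqP]]].
    by rewrite mulf_eq0 invr_eq0 (negbTE a0) (negbTE b0).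
  - move=> _ _ [a [b [Sa Sb ta tb ->]]] [a' [b' [Sa' Sb' ta' tb' ->]]].
    exists (a * a'), (b * b'); rewrite !tM // !mulf_neq0 // invfM mulrACA.
    by split=> //; apply: SM.
  - by move=> _ [a [b [Sa Sb ta tb ->]]]; exists b, a; rewrite invf_div.
pose G0 : set (K * C) := [set u | exists a b,
  [/\ S a, S b, t a != 0, t b != 0 & u = (a / b, t a / t b)]].
have [|||||psi [psi_hom psi0 psiG]] := @extend_hom_divisible K C [set z | z != 0] G0.
- split=> /=; rewrite ?oner_neq0 ?eqxx //.
    by move=> x y; apply: mulf_neq0.
  by move=> x; rewrite invr_eq0.
- move=> p z pp z0; have [y yz] := @closed_root C p z (prime_gt0 pp).
  exists y => //; apply: contraNneq z0 => y0; rewrite -yz y0 expr0n gtn_eqF //.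
  exact: prime_gt0.
- split=> /=.
  - by exists 1, 1; rewrite t1 oner_neq0 !divr1.
  - move=> _ _ [a [b [Sa Sb ta tb ->]]] [a' [b' [Sa' Sb' ta' tb' ->]]] /=.
    exists (a * a'), (b * b'); rewrite !tM // !mulf_neq0 // !invfM.
    split=> //; try exact: SM.
    by congr pair; rewrite mulrACA.
  - by move=> _ [a [b [Sa Sb ta tb ->]]]; exists b, a; rewrite /= !invf_div.
- move=> _ [a [b [Sa Sb ta tb ->]]] /=; rewrite !mulf_neq0 ?invr_eq0 //.
  + exact: St_neq0.
  + exact: St_neq0.
- move=> y [a [b [Sa Sb ta tb [e1 ->]]]].
  have -> : a = b by rewrite -[a](divfK (St_neq0 _ tb)) -e1 mul1r.
  by rewrite divff.
have psit r : S r -> t r != 0 -> psi r = t r.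
  move=> Sr tr; have := psiG (r, t r); apply; exists r, 1.
  by rewrite t1 oner_neq0 !divr1.
have tors_t z : tors z -> psi z = t z.
  move=> tz; have Sz := Stors _ tz; case: tz => n [n0 zn]; apply: psit => //.
  have tX m : S (z ^+ m) /\ t (z ^+ m) = t z ^+ m.
    elim: m => [|m [IH1 IH2]]; first by rewrite !expr0.
    by rewrite !exprS tM // IH2; split=> //; apply: SM.
  have := (tX n).2; rewrite zn t1 => /esym.
  by apply: contra_eq_neq => ->; rewrite expr0n gtn_eqF // eq_sym oner_neq0.
have psiX x n : psi (x ^+ n) = psi x ^+ n by have := multhomXz x n psi_hom.
have thX x n : th (x ^+ n) = th x ^+ n by have := multhomXz x n th_hom.
have [psi_0 psi_1 psiM] := psi_hom; have [th_0 th_1 thM] := th_hom.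
pose rs0 := [seq r <- rs | t r != 0].
pose rs1 := [seq r <- rs | (t r == 0) && (r != 0)].
have rs0P r : r \in rs0 -> [/\ r != 0, S r & t r != 0].
  by rewrite mem_filter => /andP[tr /Srs Sr]; split=> //; apply: St_neq0.
have [|n n0 lift] := @lift_unitary R K rs0; first by move=> r /rs0P[].
have [z prim_z] := closed_prim_root (K_char n0).
have prim_thz : n.-primitive_root (th z).
  have thzn : th z ^+ n = 1 by rewrite -thX (prim_expr_order prim_z).
  have [m prim_m mn] := prim_order_exists n0 thzn.
  suff -> : n = m by [].
  apply/eqP; rewrite eqn_dvd mn andbT (prim_order_dvd prim_z).
  by apply/eqP/th_inj; rewrite thX (prim_expr_order prim_m).
(* [th z] is still primitive by injectivity of [th], so on the [n]-th roots of unity [psi] is a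
   power of [th]. The integer [n] depends on [rs0] only, so the exponent may be chosen after it. *)
have [|[a0 a0n] psiz] := prim_rootP prim_thz (_ : psi z ^+ n = 1).
  by rewrite -psiX (prim_expr_order prim_z).
rewrite /= in psiz.
have z0 : z != 0 by apply: (@tors_neq0 K); exists n; rewrite (prim_expr_order prim_z).
have [|a [N [N0 PN modN]]] := pnat_progression n0 c0 Pc
    (_ : forall l, prime l -> (l %| a0)%N -> (l %| n)%N -> l \in P).
  move=> l pl la ln; pose w := z ^+ (n %/ l).
  have prim_w : l.-primitive_root w by apply: dvdn_prim_root.
  apply: (tP l w) => //; rewrite -tors_t; last first.
    by exists l; rewrite (prim_expr_order prim_w) prime_gt0.
  rewrite psiX psiz -exprM -(divnK la) -mulnA [(l * _)%N]mulnC divnK // mulnC exprM.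
  by rewrite (prim_expr_order prim_thz) expr1n.
exists a, N; split=> // k; split; first exact: PN.
set ak := (a + k * N)%N.
have psi_gt0 x : x != 0 -> 0 < absC (psi x) by move=> x0; apply: absC_gt0; apply: psi0.
have nc x : x != 0 -> cofR (absC (psi x)) != 0.
  by move=> x0; rewrite /cofR fmorph_eq0 gt_eqF // psi_gt0.
(* This is the phase still missing from [th ^+ ak]. The congruence of [ak] and [a0] makes it trivial
   on [n]-th roots of unity, which is what lifting it to a real [beta] on [rs0] requires. *)
pose om x := psi x / cofR (absC (psi x)) / th x ^+ ak.
have abs_psi x : x != 0 -> absC (psi x / cofR (absC (psi x))) = 1.
  move=> x0; apply/absC_eq1; rewrite normrM normfV norm_cofR absCE.
  by rewrite ger0_norm ?ltW ?psi_gt0 // divff ?nc.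
have om_hom : multhom om.
  split.
  - by rewrite /om psi_0 !mul0r.
  - by rewrite /om psi_1 absC1 /cofR rmorph1 th_1 expr1n !divr1.
  - by move=> x y; rewrite /om psiM thM absCM cofRM exprMn !invfM !mulrA; ring.
have om_abs x : x != 0 -> absC (om x) = 1.
  move=> x0; apply/absC_eq1; rewrite normrM (absC_eq1 _).2 ?abs_psi //.
  by rewrite mul1r normfV normrX (absC_eq1 _).2 ?th_abs // expr1n invr1.
have omn x : x ^+ n = 1 -> om x = 1.
  move=> xn; have [j xj] := prim_rootP prim_z xn; rewrite xj.
  have psizj : psi (z ^+ j) = th (z ^+ j) ^+ ak.
    rewrite psiX psiz thX -!exprM mulnC [RHS]exprM -exprM [RHS]exprM.
    rewrite -!exprM; apply/eqP; rewrite (eq_prim_root_expr prim_thz).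
    by rewrite -[X in _ == X]modnMmr modN modnMmr.
  have zj0 : z ^+ j != 0 by rewrite expf_neq0.
  rewrite /om psizj absCX th_abs // expr1n /cofR rmorph1 divr1 divff //.
  by rewrite expf_neq0 // th_neq0.
have [beta hbeta betaE] := lift om om_hom om_abs omn.
(* A monomial in [rs1] is a zero of [t], so it is not in [H]. Thus [lam] gives a direction in which
   the values on [rs1] shrink while those on [rs0] stay fixed. *)
have [||lam [hlam lamH lam_pos]] := @positive_hom R K H rs1 sH.
- by move=> r; rewrite mem_filter => /andP[/andP[]].
- move=> x mx; have [Sx x0 tx] : [set x | [/\ S x, x != 0 & t x = 0]] x.
    apply: (monomials_sub _ _ mx).
      move=> u v [Su u0 tu] [Sv v0 tv]; split; first exact: SM.
        by rewrite mulf_neq0.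
      by rewrite tM // tu mul0r.
    by move=> r; rewrite mem_filter => /andP[/andP[/eqP tr r0] /Srs Sr]; split.
  move=> [u [v [Su Sv tu tv xuv]]]; case/eqP: tu.
  by rewrite -[u](divfK (St_neq0 _ tv)) -xuv tM // tx mul0r.
(* [T] brings the absolute values on [rs1] below [e], with [|L r|] reserved for the perturbation
   [s * L], where [s < 1]; [d] bounds its effect on [rs0]. A generic [s] makes the kernel of [rho]
   torsion. *)
have [T [T0 HT]] := dominating_scale (fun r => ln e - ln (absC (psi r)) - `|L r|) lam_pos.
have [d d0 Hd] := scale_near0 rs0 (fun r => absC (psi r)) L e0.
pose rho0 x := ln (absC (psi x)) + - T * lam x.
have hrho0 : addhom rho0.
  apply: addhomD; last exact: addhomZ.
  by move=> x y x0 y0; rewrite psiM absCM lnM // posrE psi_gt0.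
pose bad := [set - rho0 x / L x | x in [set: K]].
have cbad : countable bad by apply: (sub_countable (card_image_le _ _)).
have d1 : 0 < Num.min d 1 by rewrite lt_min d0 ltr01.
have [s [/andP[s0]]] := avoid_countable cbad d1.
rewrite lt_min => /andP[sd s1] ns.
exists (fun x => rho0 x + s * L x), beta; split=> //.
- by apply: addhomD => //; apply: addhomZ.
- move=> x x0 e1; apply: L_tors => //; apply/eqP/negPn/negP => L0.
  apply: ns; exists x => //; apply: (mulIf L0); rewrite divfK //.
  by apply/eqP; rewrite eq_sym -addr_eq0 addrC e1.
- move=> r rr; rewrite /mkchar; case: eqVneq => [->|r0].
    by rewrite t0 subrr /absC normr0.
  have [tr|tr] := eqVneq (t r) 0.
    have rr1 : r \in rs1 by rewrite mem_filter tr eqxx r0.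
    rewrite tr subr0 !absCM absC_expi absCX th_abs // expr1n !mulr1 absC_cofR ?expR_ge0 //.
    have := HT r rr1; rewrite -[X in _ -> _ < X]lnK ?posrE // ltr_expR /rho0 => h.
    have : s * L r <= `|L r|.
      rewrite (le_trans (ler_norm _)) // normrM ler_piMl // ger0_norm ?ltW //.
    lra.
  have rr0 : r \in rs0 by rewrite mem_filter tr.
  have [_ Sr _] := rs0P _ rr0.
  have lam0 : lam r = 0 by apply: lamH; exists r, 1; rewrite t1 oner_neq0 divr1.
  rewrite /rho0 lam0 mulr0 addr0 expRD lnK ?posrE ?psi_gt0 // (betaE r rr0) /om psit //.
  set E := expR _; set A := absC (t r).
  have A0 : cofR A != 0 by rewrite /A -psit // nc.
  have -> : cofR (A * E) * th r ^+ ak * (t r / cofR A / th r ^+ ak) - t r = t r * cofR (E - 1).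
    rewrite cofRM /cofR rmorphB rmorph1 -/(cofR A) -/(cofR E); field.
    by rewrite expf_neq0 ?th_neq0.
  have := Hd s; rewrite s0 sd => /(_ isT r rr0); rewrite psit // normrM => h.
  have aC : absC (cofR (E - 1)) = `|E - 1| by rewrite /absC norm_cofR.
  by rewrite absCM aC -[absC (t r)]ger0_norm // ltW // absC_gt0.
Qed.
End ApproximateCharacter.

(** * Rings of finite type over the integers *)

Section SpecializationBound.
Context (L : fieldType).

(** For almost all primes l, l is not a unit in the image of [B] localized at [b]. Localizations are
    there for the induction on generators: an algebraic generator is integral only after a leading
    coefficient has been inverted. *)
Definition almost_no_divisor (B : comNzRingType) (j : {rmorphism B -> L}) : Prop :=
  forall b, j b != 0 -> exists c : nat, (0 < c)%N /\
    forall l, prime l -> ~~ (l %| c)%N -> forall m y, j b ^+ m <> l%:R * j y.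

Hypothesis L_char : forall n : nat, (0 < n)%N -> n%:R != 0 :> L.

Lemma almost_no_divisor_int (j : {rmorphism int -> L}) : almost_no_divisor j.
Proof.
have inj : injective j.
  apply: raddf_inj => n jn; apply/eqP/negPn/negP => n0.
  have : (`|n|%N)%:R != 0 :> L by rewrite L_char // absz_gt0.
  by rewrite -(rmorph_nat j) natz abszEsg rmorphM jn mulr0 eqxx.
move=> b jb; have b0 : b != 0 by apply: contraNneq jb => ->; rewrite rmorph0.
exists `|b|%N; split; first by rewrite absz_gt0.
move=> l pl nlb m y; rewrite -rmorphXn -(rmorph_nat j) -rmorphM => /inj e.
move/negP: nlb; apply; have : (l %| `|b ^+ m|)%N.
  by rewrite e abszM natz absz_nat dvdn_mulr.
by rewrite abszX Euclid_dvdX // => /andP[].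
Qed.

Section Adjoin.
Context (B : comNzRingType) (j : {rmorphism B -> L}) (x : L).
Hypothesis nodiv : almost_no_divisor j.

Let ev : {rmorphism {poly B} -> L} := horner_eval x \o map_poly j.
Let evE q : ev q = (map_poly j q).[x]. Proof. by []. Qed.
Let evC b : ev b%:P = j b. Proof. by rewrite evE map_polyC hornerC. Qed.

(** As [j] need not be injective, the leading coefficient of a lift may be killed by [j]; such top
    terms are removed. *)
Let truncate (q : {poly B}) : map_poly j q != 0 -> exists q',
  [/\ map_poly j q' = map_poly j q, (size q' <= size q)%N & j (lead_coef q') != 0].
Proof.
move=> q0; pose q' := \poly_(i < size (map_poly j q)) q`_i.
have sz : (size q' <= size (map_poly j q))%N by apply: size_poly.
have eq' : map_poly j q' = map_poly j q.
  apply/polyP => i; rewrite !coef_map coef_poly; case: ltnP => // h.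
  by rewrite raddf0 -coef_map nth_default.
have sz2 : size q' = size (map_poly j q).
  apply/eqP; rewrite eqn_leq sz /= -[X in (X <= _)%N]/(size (map_poly j q)) -eq'.
  exact: size_poly.
exists q'; split=> //; first by rewrite (leq_trans sz) // size_poly.
by rewrite lead_coefE sz2 -coef_map eq' -lead_coefE lead_coef_eq0.
Qed.

Let pdiv (d q : {poly B}) : d != 0 -> exists k (h r : {poly B}),
  [/\ q * (lead_coef d ^+ k)%:P = h * d + r & (size r < size d)%N].
Proof.
move=> d0; case: (Pdiv.CommonRing.comm_redivpP q d) => k h r e sz.
by exists k, h, r; split; [apply: e; apply: mulrC|apply: sz].
Qed.

(** Comparing the coefficients in the degree of the [m]-th power reduces the claim to the leading
    coefficient of [b] over [j]. *)
Let transcendental : (forall q, ev q = 0 -> map_poly j q = 0) ->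
  almost_no_divisor ev.
Proof.
move=> inj b evb; have jb0 : map_poly j b != 0.
  by apply: contraNneq evb => e; rewrite evE e horner0.
pose i := (size (map_poly j b)).-1.
have jbi : j b`_i = lead_coef (map_poly j b) by rewrite lead_coefE coef_map.
have [|c [c0 H]] := nodiv (b := b`_i); first by rewrite jbi lead_coef_eq0.
exists c; split=> // l pl lc m y e; apply: (H l pl lc m (y`_((size (map_poly j b ^+ m)).-1))).
have : ev (b ^+ m - l%:R * y) = 0 by rewrite rmorphB rmorphM rmorph_nat rmorphXn e subrr.
move=> /inj; rewrite rmorphB rmorphM /= rmorph_nat rmorphXn /= => /eqP; rewrite subr_eq0 => /eqP e'.
by rewrite jbi -lead_coef_exp lead_coefE e' -polyC_natr coefCM coef_map; congr (_ * j _`_ _).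
Qed.

(** Let [p] be a relation of least degree and [b0] a nonzero constant that is a multiple of [ev b].
    If l divides a power of [ev b], it divides that power of [b0]; pseudo-division by [p] then
    yields a relation of lower degree, which vanishes, and its constant term shows that l divides a
    power of [lead_coef p * b0] in [B], up to [j]. *)
Let algebraic (q : {poly B}) : ev q = 0 -> map_poly j q != 0 -> almost_no_divisor ev.
Proof.
move=> evq q0.
have exn : exists n, `[< exists p : {poly B}, [/\ size p = n, j (lead_coef p) != 0 & ev p = 0] >].
  have [q' [e1 _ lq']] := truncate q0; exists (size q'); apply/asboolP; exists q'.
  by split=> //; rewrite evE e1.
case: (ex_minnP exn) => n /asboolP[p [szp lp evp]] minn.
have minp (r : {poly B}) : (size r < n)%N -> ev r = 0 -> map_poly j r = 0.
  move=> szr evr; apply/eqP/negPn/negP => r0; have [r' [e1 sz lr']] := truncate r0.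
  have : (n <= size r')%N by apply: minn; apply/asboolP; exists r'; rewrite evE e1.
  by rewrite leqNgt (leq_ltn_trans sz).
have p0 : p != 0 by apply: contraNneq lp => ->; rewrite lead_coef0 rmorph0.
have szpj : size (map_poly j p) = n.
  apply/eqP; rewrite eqn_leq -szp size_poly /= leqNgt; apply/negP => h.
  have : (map_poly j p)`_(size p).-1 = 0.
    by rewrite nth_default // -ltnS prednK // size_poly_gt0.
  by rewrite coef_map -lead_coefE => e; rewrite e eqxx in lp.
have n1 : (1 < n)%N.
  rewrite ltnNge; apply/negP => h; have := evp.
  rewrite evE; have /size1_polyC e : (size (map_poly j p) <= 1)%N by rewrite szpj.
  rewrite e hornerC coef_map => jp0; move: lp; rewrite lead_coefE szp.
  have -> : n.-1 = 0%N by case: (n) h => [|[]].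
  by rewrite jp0 eqxx.
move=> b evb.
(* Among the nonzero multiples of [ev b], one with a representative [r] of least degree is taken; it
   turns out to be constant. *)
have [b0 [h [jb0 ebh]]] : exists (b0 : B) (h : {poly B}), j b0 != 0 /\ j b0 = ev b * ev h.
  have exm : exists m, `[< exists r h : {poly B}, [/\ size r = m, (size r < n)%N,
      j (lead_coef r) != 0 & ev r = ev b * ev h] >].
    have [k [g [r [e szr]]]] := pdiv b p0.
    have evr : ev r = ev b * ev (lead_coef p ^+ k)%:P.
      by rewrite -rmorphM e rmorphD rmorphM evp mulr0 add0r.
    have r0 : map_poly j r != 0.
      apply/negP => /eqP r0; have : ev r = 0 by rewrite evE r0 horner0.
      rewrite evr evC rmorphXn => /eqP; rewrite mulf_eq0 (negbTE evb) /=.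
      by rewrite expf_eq0 (negbTE lp) andbF.
    have [r' [e1 sz lr']] := truncate r0; exists (size r'); apply/asboolP.
    exists r', (lead_coef p ^+ k)%:P; split=> //; first by rewrite -szp (leq_ltn_trans sz).
    by rewrite -evr !evE e1.
  case: (ex_minnP exm) => m /asboolP[r [h [szr rn lr evr]]] minm.
  have r0 : r != 0 by apply: contraNneq lr => ->; rewrite lead_coef0 rmorph0.
  have [m1|m1] := leqP m 1.
    have rC : r = (lead_coef r)%:P.
      have := size1_polyC (_ : (size r <= 1)%N); rewrite szr => /(_ m1) e.
      by rewrite {2}e lead_coefC.
    by exists (lead_coef r), h; rewrite -evr [in RHS]rC evC.
  (* The remainder of [p] by [r] is again a multiple of [ev b], so it vanishes under [j] by
     minimality. Then [r] divides [p] up to a constant, and the cofactor [g] is a relation of degree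
     lower than that of [p]. *)
  exfalso; have [k [g [r' [e szr']]]] := pdiv p r0.
  have evr' : ev r' = ev b * ev (- (g * h)).
    rewrite rmorphN rmorphM mulrN mulrCA -evr -rmorphM.
    apply/eqP; rewrite -addr_eq0 addrC -rmorphD -e rmorphM evp mul0r //.
  have r'0 : map_poly j r' = 0.
    apply/eqP/negPn/negP => r'0; have [r'' [e1 sz lr'']] := truncate r'0.
    have : (m <= size r'')%N.
      apply: minm; apply/asboolP; exists r'', (- (g * h)); split=> //.
        by rewrite (leq_ltn_trans sz) // (ltn_trans szr').
      by rewrite -evr' !evE e1.
    by rewrite leqNgt (leq_ltn_trans sz) // -szr.
  have evr0 : ev r != 0.
    apply/negP => /eqP /(minp _ rn) rj0; move: lr; rewrite lead_coefE -coef_map rj0 coef0.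
    by rewrite eqxx.
  have e2 : map_poly j p * (j (lead_coef r) ^+ k)%:P = map_poly j g * map_poly j r.
    have := congr1 (map_poly j) e; rewrite rmorphD !rmorphM /= r'0 addr0 map_polyC /= rmorphXn.
    by [].
  have lrk : j (lead_coef r) ^+ k != 0 by rewrite expf_neq0.
  have pj0 : map_poly j p != 0 by rewrite -size_poly_gt0 szpj ltnW.
  have gj0 : map_poly j g != 0.
    apply: contraNneq (mulf_neq0 pj0 (_ : (j (lead_coef r) ^+ k)%:P != 0)) => [g0|].
      by rewrite e2 g0 mul0r.
    by rewrite polyC_eq0.
  have rj0 : map_poly j r != 0 by apply: contraNneq evr0 => r0'; rewrite evE r0' horner0.
  have szg : (size (map_poly j g) < n)%N.
    have := congr1 (fun q : {poly L} => size q) e2.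
    rewrite mulrC mul_polyC size_scale // szpj size_mul //.
    have : size (map_poly j r) = m.
      apply/eqP; rewrite eqn_leq -szr size_poly /= leqNgt; apply/negP => hh.
      have : (map_poly j r)`_(size r).-1 = 0.
        by rewrite nth_default // -ltnS prednK // size_poly_gt0.
      by rewrite coef_map -lead_coefE => e3; rewrite e3 eqxx in lr.
    move=> -> e5; move: m1; rewrite -ltnS e5; case: (m) => [|[|m2]] // _; by rewrite !addnS /= ltnS leq_addr.
  have [g' [e3 szg' lg']] := truncate gj0.
  have g'j : map_poly j g' = 0.
    apply: minp; last first.
      have := congr1 (fun q : {poly L} => q.[x]) e2; rewrite !hornerM -!evE evp mul0r => /esym/eqP.
      by rewrite mulf_eq0 (negbTE evr0) orbF [ev g']evE e3 -evE => /eqP.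
    have -> : size g' = size (map_poly j g').
      apply/eqP; rewrite eqn_leq size_poly andbT leqNgt; apply/negP => hh.
      have g'0 : g' != 0 by apply: contraNneq lg' => ->; rewrite lead_coef0 rmorph0.
      have : (map_poly j g')`_(size g').-1 = 0.
        by rewrite nth_default // -ltnS prednK // size_poly_gt0.
      by rewrite coef_map -lead_coefE => e4; rewrite e4 eqxx in lg'.
    by rewrite e3.
  by rewrite -e3 g'j eqxx in gj0.
have [|c [c0 H]] := nodiv (b := lead_coef p * b0); first by rewrite rmorphM mulf_neq0.
exists c; split=> // l pl lc m y e.
have [k [g [r [e1 szr]]]] := pdiv (y * h ^+ m) p0.
pose M := (k + m)%N.
have e2 : j (lead_coef p) ^+ k * j b0 ^+ m = l%:R * ev r.
  have -> : ev r = ev (y * h ^+ m) * j (lead_coef p) ^+ k.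
    rewrite -rmorphXn -evC -rmorphM e1 rmorphD rmorphM evp mulr0 add0r //.
  by rewrite ebh exprMn e rmorphM rmorphXn; ring.
have sz : (size ((lead_coef p ^+ k * b0 ^+ m)%:P - l%:R * r)%R < n)%N.
  have s1 := size_polyC_leq1 (lead_coef p ^+ k * b0 ^+ m).
  have s2 : (size (- (l%:R * r))%R < n)%N.
    by rewrite size_polyN -polyC_natr mul_polyC (leq_ltn_trans (size_scale_leq _ _)) // -szp.
  have := size_polyD (lead_coef p ^+ k * b0 ^+ m)%:P (- (l%:R * r)); rewrite leq_max.
  by move=> /orP[] h'; apply: (leq_ltn_trans h') => //; apply: leq_ltn_trans s1 n1.
have e3 := minp _ sz.
have : map_poly j ((lead_coef p ^+ k * b0 ^+ m)%:P - l%:R * r) = 0.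
  by apply: e3; rewrite rmorphB [X in _ - X]rmorphM rmorph_nat evC rmorphM !rmorphXn e2 subrr.
move=> /(congr1 (fun q : {poly L} => q`_0)); rewrite coef_map coef0 coefB coefC eqxx /=.
rewrite -polyC_natr coefCM rmorphB rmorphM !rmorphXn [X in _ - X]rmorphM rmorph_nat => /eqP.
rewrite subr_eq0 => /eqP e4.
apply: (H l pl lc M (r`_0 * (lead_coef p ^+ m * b0 ^+ k))).
rewrite [j (r`_0 * _)]rmorphM mulrA -e4 !rmorphM !rmorphXn /M exprMn !exprD; ring.
Qed.

Lemma almost_no_divisor_adjoin : almost_no_divisor ev.
Proof.
have [inj|] := pselect (forall q, ev q = 0 -> map_poly j q = 0); first exact: transcendental.
move=> /existsNP[q /not_implyP[evq /eqP q0]]; exact: algebraic evq q0.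
Qed.
End Adjoin.

(** [B] is an iterated polynomial ring over [int]. Its countability later yields that of the
    function field. *)
Lemma finitely_generated_cover (s : seq L) :
  exists (B : countComNzRingType) (j : {rmorphism B -> L}),
    almost_no_divisor j /\ forall x, x \in s -> range j x.
Proof.
elim: s => [|x s [B [j [nodiv js]]]].
  exists int, (intr : {rmorphism int -> L}); split=> //; exact: almost_no_divisor_int.
exists {poly B}, (horner_eval x \o map_poly j : {rmorphism {poly B} -> L}); split.
  exact: almost_no_divisor_adjoin.
move=> y; rewrite inE => /orP[/eqP ->|/js[b _ <-]].
  by exists 'X => //=; rewrite map_polyX horner_evalE hornerX.
by exists b%:P => //=; rewrite map_polyC horner_evalE hornerC.
Qed.
End SpecializationBound.

(** * Affine schemes and the generic point *)

Local Notation eval := Defs.eval.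

(** Multiplication by [n] on the integers is injective and sends the tensor of 1 and [x] to that of
    1 and [x *+ n], which is zero. *)
Lemma flat_torsion_free (M : zmodType) (x : M) (n : nat) :
  flat_Zmodule M -> (0 < n)%N -> x *+ n = 0 -> x = 0.
Proof.
move=> flatM n0 xn.
pose mul (z : int) := z *+ n.
have mulB : {morph mul : y z / y - z} by move=> y z; rewrite /mul mulrnBl.
pose mulA : {additive int -> int} :=
  HB.pack mul (GRing.isZmodMorphism.Build _ _ mul mulB).
have inj : injective mulA.
  by move=> y z /= /eqP; rewrite eqr_pMn2r // => /eqP.
have := flatM _ _ mulA inj [:: (1, x)] _ M (fun z y => y *~ z).
rewrite big_seq1 /= mulr1z; apply.
  move=> Q b [bl br]; rewrite big_seq1 /=.
  have b0 z : b z 0 = 0.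
    by apply: (addrI (b z 0)); rewrite -br !addr0.
  have bn z (k : nat) y : b (z *+ k) y = b z (y *+ k).
    elim: k => [|k IH]; last by rewrite !mulrS bl br IH.
    by apply: (addrI (b 0 y)); rewrite !mulr0n -bl b0 !addr0.
  by rewrite /mul bn xn b0.
by split=> z y w; rewrite ?mulrzDl ?mulrzDr.
Qed.

Section Affine.
Context (X : locallyRingedSpace) (U : opens X) (phi : spec (sec U) -> X).
Hypotheses (phi_inj : injective phi) (phi_range : range phi = U)
  (phi_open : forall V : set X, V `<=` U -> (open V <-> open (phi @^-1` V)))
  (phi_loc : forall (f : sec U) (V : opens X) (h : V `<=` U),
     phi @^-1` V = basic_open f -> is_localization f (res h)).

Lemma basic_opens (f : sec U) : exists V : opens X,
  [/\ V `<=` U, phi @^-1` V = basic_open f & oset V = phi @` basic_open f].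
Proof.
have pre : phi @^-1` (phi @` basic_open f) = basic_open f.
  by apply/seteqP; split=> [q [q' fq' /phi_inj <-]|q fq] //; exists q.
have sub : phi @` basic_open f `<=` U.
  by move=> _ [q _ <-]; rewrite -phi_range; exists q.
have op : open (phi @` basic_open f).
  apply/(phi_open sub); rewrite pre.
  by exists [set f]; rewrite bigcup_set1.
by exists (Opens op).
Qed.

Lemma affine_nbhd (p : spec (sec U)) (W : opens X) : oset W (phi p) ->
  exists (g : sec U) (V : opens X) (h : V `<=` U),
    [/\ V `<=` W, ~ prime_set p g, oset V (phi p) & is_localization g (res h)].
Proof.
move=> Wp.
have sub : (W `&` U : set X) `<=` U by move=> y [].
have : open (phi @^-1` (W `&` U)).
  by apply/(phi_open sub)/openI; apply: oset_open.
move=> [S eS].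
have : (phi @^-1` (W `&` U)) p by split=> //; rewrite -phi_range; exists p.
rewrite eS => -[g Sg pg]; have [V [h e eV]] := basic_opens g.
exists g, V, h; split=> //; last exact: phi_loc.
  rewrite eV => _ [q gq <-].
  have : (\bigcup_(f in S) basic_open f) q by exists g.
  by rewrite -eS => -[].
by rewrite eV; exists p.
Qed.

Lemma prime_exp (p : spec (sec U)) (g : sec U) n : prime_set p (g ^+ n) -> prime_set p g.
Proof.
by elim: n => [|n IH]; [rewrite expr0 => /prime1|rewrite exprS => /primeM[|/IH]].
Qed.

(** Outside [p], [f] is invertible on its own basic open set. Conversely, an inverse of the germ
    lives on a basic open set of some [g] outside [p]; clearing denominators makes a power of [g] a
    multiple of [f]. *)
Lemma affine_eval (p : spec (sec U)) (hx : oset U (phi p)) (f : sec U) :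
  eval hx f = 0 <-> prime_set p f.
Proof.
split=> [e|pf].
  apply: contrapT => npf; have [V [h eV eV']] := basic_opens f.
  have [[b fb] _ _] := phi_loc h eV.
  have hV : oset V (phi p) by rewrite eV'; exists p.
  have := congr1 (eval hV) fb; rewrite rmorphM rmorph1 /= (eval_res hx) e mul0r => /eqP.
  by rewrite eq_sym oner_eq0.
apply: contrapT => nz; have : invertible (germ hx f).
  by apply: contrapT => ninv; apply: nz; apply/residue_eq0.
move=> [b]; have [W [hW [t <-]]] := germ_surj b.
have i1 : opensI U W `<=` U by move=> y [].
have i2 : opensI U W `<=` W by move=> y [].
have hUW : oset (opensI U W) (phi p) by split.
rewrite -(germ_res hx hUW i1) -(germ_res hW hUW i2) -rmorphM -(rmorph1 (germ hUW)).
move=> /germP[W' [W'p [j1 [j2 e]]]].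
have [g [V [h [VW pg Vp [_ locs loc0]]]]] := affine_nbhd W'p.
have hVU : V `<=` opensI U W by move=> y /VW/j1.
pose t' := res hVU (res i2 t).
have {}e : res h f * t' = 1.
  rewrite /t' -(res_res i1 hVU) -rmorphM.
  by rewrite -(res_res j1 VW) e (res_res j2 VW hVU) rmorph1.
have [n [a ea]] := locs t'.
have [|m em] := loc0 (f * a - g ^+ n).
  by rewrite rmorphB rmorphM rmorphXn -ea mulrCA e mulr1 subrr.
apply: pg; apply: (@prime_exp p g (m + n)).
rewrite exprD; have -> : g ^+ m * g ^+ n = g ^+ m * a * f.
  by move/eqP: em; rewrite mulrBr subr_eq0 => /eqP <-; rewrite mulrA mulrAC.
exact: primeMl.
Qed.

Lemma affine_fraction (p : spec (sec U)) (hx : oset U (phi p)) (z : kappa (phi p)) :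
  exists u v : sec U, eval hx v != 0 /\ z = eval hx u / eval hx v.
Proof.
have [W [hW [s <-]]] := eval_surj z.
have [g [V [h [VW pg Vp [_ locs _]]]]] := affine_nbhd hW.
have [n [a ea]] := locs (res VW s).
have g0 : eval hx g != 0 by apply/eqP => /affine_eval.
exists a, (g ^+ n); rewrite rmorphXn expf_neq0 //; split=> //.
have := congr1 (eval Vp) ea; rewrite rmorphM rmorphXn /= !(eval_res hx) (eval_res hW) => <-.
by rewrite mulrAC divff ?mul1r // expf_neq0.
Qed.
End Affine.

Section Generic.
Context (X : scheme) (X_int : integral_scheme X) (eta : X) (eta_gen : generic_point eta).

Lemma generic_mem (U : opens X) : U !=set0 -> oset U eta.
Proof.
move=> [y Uy]; have cl : closure [set eta] y by rewrite eta_gen.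
have nU : nbhs y U by apply: open_nbhs_nbhs; split=> //; apply: oset_open.
by have [z [/= -> Uz]] := cl _ nU.
Qed.

(** The basic open set of [f] misses the generic point, so it is empty, and the sheaf condition for
    the empty cover makes its ring of sections zero. As this ring is a localization at [f], [f] is
    nilpotent, hence zero in a domain. *)
Lemma generic_eval_eq0 (U : opens X) (h : oset U eta) (f : sec U) :
  affine U -> eval h f = 0 -> f = 0.
Proof.
move=> [phi [phi_inj phi_range phi_open phi_loc]] e.
have [p _ ep] : range phi eta by rewrite phi_range.
have h' : oset U (phi p) by rewrite ep.
have e' : eval h' f = 0 by move: h' => {}h'; move: h e; rewrite -ep => h e; rewrite (Prop_irrelevance h' h).
have pf := (affine_eval phi_inj phi_range phi_open phi_loc h' f).1 e'.
have [V [h1 eV eV']] := basic_opens phi_inj phi_range phi_open f.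
have V0 : V `<=` set0.
  move=> y Vy; have : oset V eta by apply: generic_mem; exists y.
  by rewrite eV' -ep => -[q fq /phi_inj qp]; apply: fq; rewrite qp.
have one0 : (1 : sec V) = 0.
  pose F (i : void) : opens X := match i with end.
  have hF i : F i `<=` V by case: i.
  have cov : V `<=` \bigcup_i F i by move=> y /V0.
  exact: (@sheaf_separated X V void F hF cov 1 0 (fun i => match i with end)).
have [_ _ loc0] := phi_loc f V h1 eV.
have [|n en] := loc0 1; first by rewrite rmorph1 one0.
have [_ dom] := X_int.2 U (ex_intro _ eta h).
have [one_neq0 _] := X_int.2 U (ex_intro _ eta h).
elim: n en => [|n IH]; first by rewrite expr0 mulr1 => /one_neq0.
by rewrite mulr1 exprS => /dom[//|e2]; apply: IH; rewrite mulr1.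
Qed.

Hypothesis X_flat : flat_over_Z X.

Lemma generic_char (n : nat) : (0 < n)%N -> n%:R != 0 :> kappa eta.
Proof.
move=> n0; have [U aU hU] := scheme_affine eta; apply/eqP => en.
have : eval hU n%:R = 0 by rewrite rmorph_nat.
move=> /(generic_eval_eq0 aU)/(congr1 (germ hU)); rewrite rmorph0 rmorph_nat => e.
have := flat_torsion_free (@X_flat eta) n0 e.
have := @stalk_nonzero X eta; move=> nz e1; apply: nz; exists 1; rewrite mulr1 -e1 //.
Qed.
End Generic.

Lemma affine_point (X : locallyRingedSpace) (U : opens X) (x : X) (hx : oset U x) :
  affine U -> exists p : spec (sec U), (forall f, eval hx f = 0 <-> prime_set p f) /\
    forall z : kappa x, exists u v : sec U, eval hx v != 0 /\ z = eval hx u / eval hx v.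
Proof.
move=> [phi [phi_inj phi_range phi_open phi_loc]].
have [p _ ep] : range phi x by rewrite phi_range.
subst x; exists p; split=> [f|z]; first exact: affine_eval.
exact: (affine_fraction phi_inj).
Qed.

Lemma affine_point_surj (X : locallyRingedSpace) (U : opens X) (p : spec (sec U)) :
  affine U -> exists (x : X) (hx : oset U x), forall f, eval hx f = 0 <-> prime_set p f.
Proof.
move=> [phi [phi_inj phi_range phi_open phi_loc]].
have hx : oset U (phi p) by rewrite -phi_range; exists p.
by exists (phi p), hx => f; apply: affine_eval.
Qed.

Lemma exists_prime (A : comPzRingType) (a : A) :
  ~ invertible a -> exists p : primeIdeal A, prime_set p a.
Proof.
move=> na.
pose ideal (I : set A) := [/\ I a, forall x y, I x -> I y -> I (x + y),
  forall x y, I y -> I (x * y) & ~ I 1].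
pose P I := I = set0 \/ ideal I.
have [C CP totC|I [PI maxI]] := @Zorn_bigcup _ P.
  have [[X CX X0]|noX] := pselect (exists2 X, C X & X !=set0); last first.
    left; apply/seteqP; split=> // u [X CX Xu]; apply: noX.
    by exists X => //; exists u.
  have idealX Y : C Y -> Y !=set0 -> ideal Y.
    by move=> CY [u Yu]; case: (CP _ CY) => // Y0; rewrite Y0 in Yu.
  right; split.
  - by exists X => //; have [Xa _ _ _] := idealX _ CX X0.
  - move=> u v [Y CY Yu] [Z CZ Zv].
    have [YZ|ZY] := totC _ _ CY CZ.
      exists Z => //; have [_ ZD _ _] := idealX _ CZ (ex_intro _ v Zv).
      by apply: ZD => //; apply: YZ.
    exists Y => //; have [_ YD _ _] := idealX _ CY (ex_intro _ u Yu).
    by apply: YD => //; apply: ZY.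
  - move=> u v [Y CY Yv]; exists Y => //.
    by have [_ _ YM _] := idealX _ CY (ex_intro _ v Yv); apply: YM.
  - by move=> [Y CY Y1]; have [_ _ _] := idealX _ CY (ex_intro _ 1 Y1).
pose aA : set A := [set x | exists y, x = a * y].
have idaA : ideal aA.
  split.
  - by exists 1; rewrite mulr1.
  - by move=> _ _ [x ->] [y ->]; exists (x + y); rewrite mulrDr.
  - by move=> x _ [y ->]; exists (x * y); rewrite mulrCA.
  - by move=> [y e]; apply: na; exists y.
have [Ia ID IM I1] : ideal I.
  case: PI => // I0; exfalso; apply: (maxI aA); last by right.
  rewrite I0; split; first by [].
  by move=> h; have [aa _ _ _] := idaA; have := h _ aa.
have I0 : I 0 by rewrite -(mul0r a); apply: IM.
have adj x : ~ I x -> exists i r, I i /\ 1 = i + r * x.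
  move=> nx; apply: contrapT => no; pose J : set A := [set y | exists i r, I i /\ y = i + r * x].
  apply: (maxI J).
    split; first by move=> y Iy; exists y, 0; rewrite mul0r addr0.
    by move=> h; apply/nx/h; exists 0, 1; rewrite mul1r add0r.
  right; split.
  - by exists a, 0; rewrite mul0r addr0.
  - move=> _ _ [i [r [Ii ->]]] [i' [r' [Ii' ->]]]; exists (i + i'), (r + r').
    by split; [apply: ID|rewrite mulrDl addrACA].
  - move=> y _ [i [r [Ii ->]]]; exists (y * i), (y * r).
    by split; [apply: IM|rewrite mulrDr mulrA].
  - by move=> [i [r [Ii e]]]; apply: no; exists i, r.
have IMM x y : I (x * y) -> I x \/ I y.
  move=> Ixy; apply: contrapT => /not_orP[nx ny].
  have [i [r [Ii e]]] := adj x nx; have [i' [r' [Ii' e']]] := adj y ny.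
  apply: I1; have -> : 1 = (i' + r' * y) * i + (r * x) * i' + (r * r') * (x * y).
    by transitivity ((i + r * x) * (i' + r' * y)); [rewrite -e -e' mulr1|ring].
  exact: (ID _ _ (ID _ _ (IM _ _ Ii) (IM _ _ Ii')) (IM _ _ Ixy)).
by exists (@PrimeIdeal A I I0 ID IM I1 IMM).
Qed.

Lemma countable_poly (L : fieldType) : countable [set: L] -> countable [set: {poly L}].
Proof.
move=> /countable_injP[f injf]; apply/countable_injP.
exists (fun p : {poly L} => pickle (map f p)) => p q _ _ /(pcan_inj pickleK) e.
by apply/poly_inj/(inj_map _ e) => x y; apply: injf; apply: mem_set.
Qed.

Lemma countable_algebraic (L K : fieldType) (iota : {rmorphism L -> K}) :
  countable [set: L] -> (forall z, algebraicOver iota z) -> countable [set: K].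
Proof.
move=> cL alg.
have sub : [set: K] `<=` \bigcup_(p in [set p : {poly L} | p != 0]) [set z | root (map_poly iota p) z].
  by move=> z _; have [p p0 pz] := alg z; exists p.
apply: (sub_countable (subset_card_le sub)); apply: bigcup_countable.
  apply: sub_countable (countable_poly cL); apply: subset_card_le; exact: subsetT.
move=> p p0; apply: finite_set_countable.
have q0 : map_poly iota p != 0 by rewrite map_poly_eq0.
apply: contrapT => /(infinite_set_fset (size (map_poly iota p)))[F Froot szF].
have allF : all (root (map_poly iota p)) (finmap.enum_fset F).
  by apply/allP => z zF; apply: Froot.
by have := max_poly_roots q0 allF (finmap.fset_uniq F); rewrite ltnNge szF.
Qed.

(** * The function field, residue characteristics and the normalization *)

Section Arithmetic.
Context (X0 : scheme) (X0_int : integral_scheme X0) (X0_flat : flat_over_Z X0)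
  (X0_ft : finite_type_over_Z X0) (eta0 : X0) (eta0_gen : generic_point eta0).

Lemma finite_type_cover : exists (U : opens X0) (h : oset U eta0)
    (B : countComNzRingType) (j : {rmorphism B -> kappa eta0}),
  [/\ affine U, almost_no_divisor j & forall a : sec U, range j (eval h a)].
Proof.
have [U [aU h [s gen_s]]] := X0_ft.2 eta0.
have [B [j [nodiv js]]] := finitely_generated_cover
  (generic_char X0_int eta0_gen X0_flat) [seq eval h a | a <- s].
exists U, h, B, j; split=> // a.
pose S : {pred sec U} := fun a => `[< range j (eval h a) >].
have : a \in S.
  apply: gen_s.
    split=> [|x y|x y]; rewrite /S /in_mem /=.
    - by apply/asboolP; exists 1 => //; rewrite !rmorph1.
    - move=> /asboolP[b _ eb] /asboolP[c _ ec]; apply/asboolP.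
      by exists (b - c) => //; rewrite !rmorphB /= eb ec.
    - move=> /asboolP[b _ eb] /asboolP[c _ ec]; apply/asboolP.
      by exists (b * c) => //; rewrite !rmorphM /= eb ec.
  by move=> x xs; apply/asboolP/js/map_f.
by move/asboolP.
Qed.

Lemma function_field_countable : countable [set: kappa eta0].
Proof.
have [U [h [B [j [aU _ cov]]]]] := finite_type_cover.
have [p [_ frac]] := affine_point h aU.
pose f (u : B * B) := j u.1 / j u.2.
apply: (@sub_countable _ _ _ [set f u | u in setT]).
  apply: subset_card_le => z _; have [u [v [_ ->]]] := frac z.
  by have [b _ <-] := cov u; have [c _ <-] := cov v; exists (b, c).
by apply: (sub_countable (card_image_le f setT)); apply: countableP.
Qed.

(** The bound is applied to [b = 1]: almost every prime l is a nonunit on an affine open set, so it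
    lies in a prime ideal, and the corresponding point has residue characteristic l. *)
Lemma residue_characteristics (P : nat_pred) :
  (forall x : X0, {subset [pchar kappa x] <= P}) ->
  exists c : nat, (0 < c)%N /\ forall l, prime l -> ~~ (l %| c)%N -> l \in P.
Proof.
move=> P_char; have [U [h [B [j [aU nodiv cov]]]]] := finite_type_cover.
have [|c [c0 H]] := nodiv 1; first by rewrite rmorph1 oner_neq0.
exists c; split=> // l pl lc.
have [|p pl0] := @exists_prime (sec U) l%:R.
  move=> [y e]; have [b _ eb] := cov y.
  apply: (H l pl lc 0%N b); rewrite expr0 eb.
  by have := congr1 (eval h) e; rewrite rmorphM rmorph1 rmorph_nat => /= ->.
have [x [hx ex]] := affine_point_surj p aU.
apply: (P_char x); apply/andP; split=> //; apply/eqP.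
by have /ex := pl0; rewrite rmorph_nat.
Qed.

Section Normalization.
Context (K : closedFieldType) (iota : {rmorphism kappa eta0 -> K})
  (K_alg : forall z : K, algebraicOver iota z) (X : normalization iota).

Lemma closure_countable : countable [set: K].
Proof. exact: countable_algebraic function_field_countable K_alg. Qed.

Lemma closure_char (n : nat) : (0 < n)%N -> n%:R != 0 :> K.
Proof.
move=> /(generic_char X0_int eta0_gen X0_flat) n0.
by rewrite -(rmorph_nat iota) fmorph_eq0.
Qed.

Lemma generic_affine (U : opens X0) : U !=set0 ->
  oset U eta0 /\ oset (mpreim (nz_proj X) U) (nz_eta X).
Proof.
by move=> /(generic_mem eta0_gen) h; split=> //; rewrite /= nz_proj_eta.
Qed.

Lemma common_denominator (U : opens X0) (h : oset U eta0) (zs : seq (kappa eta0)) :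
  affine U -> exists d : sec U, eval h d != 0 /\
    forall z, z \in zs -> exists a, eval h d * z = eval h a.
Proof.
move=> aU; have [p [_ frac]] := affine_point h aU.
elim: zs => [|z zs [d [d0 IH]]]; first by exists 1; rewrite rmorph1 oner_neq0.
have [u [v [v0 ez]]] := frac z; exists (d * v); rewrite rmorphM mulf_neq0 //; split=> //.
move=> w; rewrite inE => /orP[/eqP ->|/IH[a ea]].
  by exists (d * u); rewrite ez rmorphM -mulrA [eval h v * _]mulrC divfK.
by exists (a * v); rewrite rmorphM /= -ea mulrAC.
Qed.

(** An element of [K] becomes integral over the functions on [U] once multiplied by a common
    denominator of the coefficients of a monic equation for it. *)
Lemma nz_emb_bij : bijective (nz_emb X).
Proof.
have surj z : exists a, nz_emb X a = z.
  have [U aU hU0] := scheme_affine eta0.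
  have [h0 h] := generic_affine (ex_intro _ eta0 hU0).
  have [p' p'0 p'z] := K_alg z.
  pose p := (lead_coef p')^-1 *: p'.
  have lp' : lead_coef p' != 0 by rewrite lead_coef_eq0.
  have pz : root (map_poly iota p) z.
    by rewrite map_polyZ rootZ ?fmorph_eq0 ?invr_eq0.
  have p_monic : p \is monic by rewrite monicE lead_coefZ mulVf.
  have [d [d0 hd]] := common_denominator h0 p aU.
  pose n := (size p).-1.
  have szp : size p = n.+1 by rewrite prednK // size_poly_gt0 monic_neq0.
  pose D := iota (eval h0 d).
  have D0 : D != 0 by rewrite fmorph_eq0.
  (* This is [D ^+ n] times [p] evaluated at X / D: monic, with root [D * z] and coefficients
     without denominators. *)
  pose q := \poly_(i < n.+1) (iota p`_i * D ^+ (n - i)).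
  have qn : iota p`_n * D ^+ (n - n) = 1.
    have -> : p`_n = 1 by have := monicP p_monic; rewrite lead_coefE.
    by rewrite subnn expr0 rmorph1 mulr1.
  have : integral_over_image (iota \o eval h0) (D * z).
    exists q; split.
    - by rewrite monicE lead_coef_poly ?qn ?oner_neq0.
    - move=> i; rewrite coef_poly; case: ltnP => [|_]; last by exists 0 => //=; rewrite !rmorph0.
      rewrite ltnS leq_eqVlt => /orP[/eqP ->|lt_in].
        by exists 1 => //; rewrite qn /= !rmorph1.
      have [|a ea] := hd p`_i; first by rewrite mem_nth // szp ltnW.
      exists (a * d ^+ (n - i).-1) => //=.
      rewrite !rmorphM /= -ea !rmorphXn /= -[in RHS](@prednK (n - i)) ?subn_gt0 //.
      by rewrite exprS rmorphM mulrA [iota _ * D]mulrC.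
    - rewrite /root horner_poly.
      have -> : \sum_(i < n.+1) iota p`_i * D ^+ (n - i) * (D * z) ^+ i =
          D ^+ n * (map_poly iota p).[z].
        rewrite (@horner_coef_wide _ n.+1) ?size_map_poly ?szp // mulr_sumr.
        apply: eq_bigr => i _; rewrite coef_map /= exprMn.
        have -> : D ^+ n = D ^+ (n - i) * D ^+ i by rewrite -exprD subnK // leq_ord.
        by rewrite [iota _ * _]mulrC mulrACA.
      by move: pz => /eqP ->; rewrite mulr0.
  rewrite -(nz_range h0 h aU) => -[r _ /= er].
  exists (eval h r / eval h (mor_sec (nz_proj X) d)).
  by rewrite fmorph_div er (nz_embE h0 h) mulrC mulKf.
exists (fun z => projT1 (cid (surj z))) => a; last by case: cid.
by case: cid => b /= /fmorph_inj.
Qed.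

Lemma torsion_integral (U : opens X0) (h : oset (mpreim (nz_proj X) U) (nz_eta X)) (z : K) :
  affine U -> tors z -> exists r, nz_emb X (eval h r) = z.
Proof.
move=> aU [n [n0 zn]].
have h0 : oset U eta0 by move: (h); rewrite /= nz_proj_eta.
have : integral_over_image (iota \o eval h0) z.
  exists ('X^n - 1); split.
  - exact: monicXnsubC.
  - move=> i; rewrite coefB coefXn coef1.
    exists ((i == n)%:R - (i == 0%N)%:R) => //=.
    by rewrite !rmorphB !rmorph_nat.
  - by rewrite rootE !hornerE zn subrr.
by rewrite -(nz_range h0 h aU) => -[r _ /= er]; exists r.
Qed.

Lemma kappa_eta_closed : GRing.closed_field_axiom (kappa (nz_eta X)).
Proof.
have [g gK Kg] := nz_emb_bij.
move=> n c n0; have [y ey] := @solve_monicpoly K n (nz_emb X \o c) n0.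
exists (g y); apply: (can_inj gK); rewrite rmorphXn Kg ey rmorph_sum.
by apply: eq_bigr => i _; rewrite rmorphM rmorphXn /= Kg.
Qed.
End Normalization.
End Arithmetic.

(** * Topology of the character spaces *)

Section LocallyConstant.
Context (R : realType).

Definition locally_constant (T : topologicalType) (h : T -> R) : Prop :=
  forall x, exists2 V, nbhs x V & forall y, V y -> h y = h x.

(** This replaces being joined by a path: it is transitive without any gluing of paths. *)
Definition linked (T : topologicalType) (x y : T) : Prop :=
  forall h : T -> R, locally_constant h -> h x = h y.

Lemma locally_constant_line (g : R -> R) (a b : R) : locally_constant g -> g a = g b.
Proof.
move=> lg; apply: is_derive_0_is_cst => x.
have [V nV gV] := lg x.
apply: (@near_eq_is_derive R R R (cst (g x)) g x 1 0).
by apply: filterS nV => y /gV ->.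
Qed.

Lemma path_linked (T : topologicalType) (p : R -> T) (a b : R) :
  (forall s V, nbhs (p s) V -> nbhs s (p @^-1` V)) -> linked (p a) (p b).
Proof.
move=> cp h lh; apply: (@locally_constant_line (h \o p)) => s.
have [V nV hV] := lh (p s); exists (p @^-1` V); first exact: cp.
by move=> s' /hV.
Qed.

Lemma linked_trans (T : topologicalType) (x y z : T) : linked x y -> linked y z -> linked x z.
Proof. by move=> xy yz h lh; rewrite (xy h lh); apply: yz. Qed.

Lemma subtype_nbhs (T : topologicalType) (A : set T) (x : A) (V : set A) :
  nbhs x V -> exists2 O, nbhs (\val x) O & forall y : A, O (\val y) -> V y.
Proof.
rewrite nbhsE => -[B [[C oC eC] Bx] BV]; exists C.
  have Cx : C (\val x) by rewrite -eC in Bx.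
  by exists C.
by move=> y Cy; apply: BV; rewrite -eC.
Qed.

Local Notation C := (Cplx R).

Lemma nbhs_absC (z : C) (A : set C) : nbhs z A ->
  exists2 e : R, 0 < e & forall w, absC (w - z) < e -> A w.
Proof.
move=> /nbhs_ballP[e /= e0 he].
have [Re0 Ie0] : 0 < complex.Re e /\ complex.Im e = 0.
  by move: e0; rewrite ltcE /= => /andP[/eqP -> ].
exists (complex.Re e) => // w hw; apply: he; rewrite /ball /= distrC absCE ltcE /=.
by rewrite Ie0 eqxx.
Qed.

Lemma ptws_nbhs (I : eqType) (f : {ptws I -> C}) (W : set {ptws I -> C}) : nbhs f W ->
  exists (rs : seq I) (e : R), 0 < e /\
    forall g : {ptws I -> C}, (forall r, r \in rs -> absC (g r - f r) < e) -> W g.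
Proof.
pose D := [set u : seq I * R | 0 < u.2].
pose B (u : seq I * R) := [set g : {ptws I -> C} | forall r, r \in u.1 -> absC (g r - f r) < u.2].
have FF : Filter (filter_from D B).
  apply: filter_from_filter; first by exists ([::], 1) => /=; rewrite /D /= ltr01.
  move=> [rs e] [ss d] /= e0 d0; exists (rs ++ ss, Num.min e d).
    by rewrite /D /= lt_min; apply/andP.
  move=> g /= h; split=> r rin; have := h r; rewrite mem_cat rin ?orbT lt_min => /(_ isT) /andP[] //.
suff : filter_from D B --> f.
  move=> cv nW; have [[rs e] /= e0 h] : filter_from D B W := cv W nW.
  by exists rs, e.
apply/cvg_sup => i A; rewrite nbhsE => -[Q [[S oS eS] Qf] QA].
have : nbhs (f i) S by apply: open_nbhs_nbhs; split=> //; rewrite -eS in Qf.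
move=> /nbhs_absC[e e0 he]; exists ([:: i], e) => // g /= hg.
by apply: QA; rewrite -eS; apply: he; apply: hg; rewrite inE.
Qed.
End LocallyConstant.

Section CheckNeighborhoods.
Context (R : realType) (X0 : scheme) (eta0 : X0) (K : fieldType)
  (iota : {rmorphism kappa eta0 -> K}) (X : normalization iota) (P : nat_pred).
Local Notation C := (Cplx R).

Lemma dot_nbhs (O : set (dotX R X)) (y : dotX R X) (U : opens X0)
    (hy : oset (mpreim (nz_proj X) U) (dot_pt y)) :
  open O -> O y -> affine U ->
  exists (rs : seq (sec (mpreim (nz_proj X) U))) (e : R), 0 < e /\
    forall (y' : dotX R X) (hy' : oset (mpreim (nz_proj X) U) (dot_pt y')),
      (forall r, r \in rs -> absC (dot_char y' (eval hy' r) - dot_char y (eval hy r)) < e) ->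
      O y'.
Proof.
move=> oO Oy aU; have [W oW eW] := oO U aU.
pose yU : dot_over U := exist _ y (mem_set hy).
have nW : nbhs (dot_eval yU) W.
  apply: open_nbhs_nbhs; split=> //.
  by have : (@dot_eval R X0 eta0 K iota X U @^-1` W) yU by rewrite eW.
have [rs [e [e0 he]]] := ptws_nbhs nW; exists rs, e; split=> // y' hy' close.
pose yU' : dot_over U := exist _ y' (mem_set hy').
suff : (@dot_eval R X0 eta0 K iota X U @^-1` W) yU' by rewrite eW.
apply: he => r rin.
have -> : dot_eval yU' r = dot_char y' (eval hy' r).
  by rewrite /dot_eval (Prop_irrelevance (set_mem (valP yU')) hy').
have -> : dot_eval yU r = dot_char y (eval hy r).
  by rewrite /dot_eval (Prop_irrelevance (set_mem (valP yU)) hy).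
exact: close.
Qed.

Definition eta_char (f : K -> C) (hf : multhom f) : character R (kappa (nz_eta X)) :=
  @Character R (kappa (nz_eta X)) (f \o nz_emb X)
    (let: And3 f0 _ _ := hf in etrans (congr1 f (rmorph0 _)) f0)
    (let: And3 _ f1 _ := hf in etrans (congr1 f (rmorph1 _)) f1)
    (fun x y => let: And3 _ _ fM := hf in etrans (congr1 f (rmorphM _ x y)) (fM _ _)).

Definition eta_dot (f : K -> C) (hf : multhom f) : dotX R X := DotX (eta_char hf).

Context (E : admissibleClass R P).

(** Open sets of the colimit are tested index by index, so points with the same index [n] as the
    given representative suffice. *)
Lemma checkE_nbhs (n : N0 P) (y : dotX R X) (z : checkE X E) (O : set (checkE X E)) :
  \val z = check_mk n y -> nbhs z O ->
  exists (U : opens X0) (hy : oset (mpreim (nz_proj X) U) (dot_pt y))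
    (rs : seq (sec (mpreim (nz_proj X) U))) (e : R),
  [/\ affine U, 0 < e &
    forall (y' : dotX R X) (hy' : oset (mpreim (nz_proj X) U) (dot_pt y')) (w : checkE X E),
      (forall r, r \in rs -> absC (dot_char y' (eval hy' r) - dot_char y (eval hy r)) < e) ->
      \val w = check_mk n y' -> O w].
Proof.
move=> ez /subtype_nbhs[Q]; rewrite nbhsE => -[B [oB Bz] BQ] QO.
have [U aU hy] := scheme_affine (nz_proj X (dot_pt y)).
have oBn : open [set y : dotX R X | B (check_mk n y)] := oB n.
have By : [set y : dotX R X | B (check_mk n y)] y by rewrite /= -ez.
have [rs [e [e0 he]]] := @dot_nbhs _ y U hy oBn By aU.
exists U, hy, rs, e; split=> // y' hy' w close ew.
by apply/QO/BQ; rewrite ew; apply: he close.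
Qed.
End CheckNeighborhoods.

(** * The limit argument *)

Section LimitArgument.
Context (R : realType) (P : nat_pred) (M0 M : Q0space P) (m1 : M0) (phi : M0 -> M).
Hypotheses (phi_cont : continuous phi)
  (phi_act : forall q, Q0 P q -> forall m, phi (q0_act q m) = q0_act q (phi m)).

(** The bounded gaps [N] between the admissible [b] are essential: consecutive quotients [b / n]
    have ratio tending to 1. *)
Definition approached : Prop := forall (m : M) (O : set M), nbhs m O ->
  exists (n : N0 P) (a N : nat), (0 < N)%N /\ forall k : nat, exists b : N0 P,
    val b = (a + k * N)%N /\ exists w : M0,
      linked R (q0_act ((val b)%:R / (val n)%:R) m1) w /\ O (phi w).

Hypothesis acc : approached.

Section Section0.
Context (f : XM R M -> R) (f_leaf : leaf_sheaf_XM setT f).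

Let F (m : M) (u : {posnum R}) : R := f (pr_XM ((m, u) : Xtilde R M)).

Let F_act (m : M) (q : rat) (u v : {posnum R}) : Q0 P q -> v%:num = ratr q * u%:num ->
  F (q0_act q m) u = F m v.
Proof.
move=> hq e; rewrite /F; congr f; apply/esym/pr_XMP; exists q => //; split=> //=.
by rewrite e mulrA -rmorphM mulVf ?rmorph1 ?mul1r // (Q0_neq0 hq).
Qed.

Let F_lc (u : {posnum R}) : locally_constant (fun w : M0 => F (phi w) u).
Proof.
move=> w; have [V [nV _ hV]] := f_leaf.2 (phi w) u I.
exists (phi @^-1` V); first exact: phi_cont.
by move=> w' /hV.
Qed.

Let F_near (m : M) (u : {posnum R}) (e : R) : 0 < e ->
  exists2 O, nbhs m O & exists2 d : R, 0 < d & forall m' (u' : {posnum R}), O m' ->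
    `|u'%:num - u%:num| < d -> `|F m' u' - F m u| < e.
Proof.
move=> e0; have /cvgrPdist_lt/(_ e e0) := f_leaf.1 (m, u) I.
move=> [[N W] /= [nO nW] OW]; exists N => //.
move: nW; rewrite nbhsE => -[Q [[S oS eS] Qu] QW].
have : nbhs u%:num S by apply: open_nbhs_nbhs; split=> //; rewrite -eS in Qu.
move=> /nbhs_ballP[d /= d0 hd]; exists d => // m' u' Om' close.
rewrite distrC; apply: (OW (m', u')); split=> //=; apply: QW; rewrite -eS.
by apply: hd; rewrite /ball /= distrC.
Qed.

Let F_limit (m : M) (u : {posnum R}) (e : R) : 0 < e ->
  exists T : R, forall w : {posnum R}, T < w%:num -> `|F (phi m1) w - F m u| < e.
Proof.
move=> e_gt0; have [V nO [d d_gt0 hOd]] := F_near m u e_gt0.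
have [n [a [N [N0 hN]]]] := acc nO.
have n0 : 0 < (val n)%:R :> R by rewrite ltr0n N0_gt0.
have N0' : 0 < N%:R :> R by rewrite ltr0n.
have a0 : 0 <= a%:R :> R by rewrite ler0n.
(* With [t = w n / u], let [b] be the largest term of the progression not exceeding [t]. Then
   [v = w n / b] differs from [u] by [(t - b) u / b], at most [N u / b], which is below [d] once [b]
   exceeds [u N / d]; the bound [T] guarantees this. *)
pose T := u%:num / (val n)%:R * (a%:R + N%:R + u%:num * N%:R / d).
exists T => w Tw.
pose t := w%:num * (val n)%:R / u%:num.
have tT : a%:R + N%:R + u%:num * N%:R / d < t.
  rewrite /t ltr_pdivlMr // -ltr_pdivrMr //; apply: le_lt_trans Tw.
  by rewrite /T [X in _ <= X]mulrC mulrA lexx.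
have uNd : 0 <= u%:num * N%:R / d by rewrite divr_ge0 ?mulr_ge0 // ?ltW.
pose k := Num.truncn ((t - a%:R) / N%:R).
have /andP[k1 k2] : k%:R <= (t - a%:R) / N%:R < k.+1%:R.
  by apply: truncn_itv; rewrite divr_ge0 ?subr_ge0 //; lra.
move: k1 k2; rewrite ler_pdivlMr // ltr_pdivrMr // => k1 k2.
have [b [eb [z [lz Vz]]]] := hN k.
have eb' : (val b)%:R = a%:R + k%:R * N%:R :> R by rewrite eb natrD natrM.
have b_le : (val b)%:R <= t by rewrite eb'; lra.
have b_gt : u%:num * N%:R / d < (val b)%:R.
  by rewrite eb'; move: k2; rewrite -natr1 mulrDl mul1r; lra.
have b0 : 0 < (val b)%:R :> R by apply: le_lt_trans b_gt.
have v0 : 0 < w%:num * (val n)%:R / (val b)%:R by rewrite divr_gt0 // mulr_gt0.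
pose v := PosNum v0.
have close : `|v%:num - u%:num| < d.
  have wt : w%:num * (val n)%:R = t * u%:num by rewrite /t divfK ?gt_eqF.
  have -> : v%:num - u%:num = (t - (val b)%:R) * u%:num / (val b)%:R.
    rewrite /v /= wt mulrBl [X in _ = X]mulrBl; congr (_ - _).
    by rewrite mulrAC divff ?mul1r // gt_eqF.
  rewrite ger0_norm; last first.
    apply: divr_ge0; last exact: ltW.
    by apply: mulr_ge0 => //; rewrite subr_ge0.
  rewrite ltr_pdivrMr //; apply: le_lt_trans (_ : N%:R * u%:num < _); last first.
    by move: b_gt; rewrite ltr_pdivrMr // mulrC [d * _]mulrC.
  rewrite ler_pM2r // eb'; move: k2; rewrite -natr1 mulrDl mul1r; lra.
have hq : Q0 P ((val b)%:R / (val n)%:R) by exists b, n.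
have := hOd _ _ Vz close.
have -> : F (phi z) v = F (phi m1) w; last by [].
rewrite -(lz _ (@F_lc v)) (phi_act hq); apply: (F_act _ hq).
rewrite /v /= fmorph_div !rmorph_nat.
have b1 : (val b)%:R != 0 :> R by rewrite gt_eqF.
have n1 : (val n)%:R != 0 :> R by rewrite gt_eqF.
by field; rewrite b1 n1.
Qed.

Lemma leaf_constant : exists c : R, forall z, f z = c.
Proof.
have cst m u m' u' : F m u = F m' u'.
  apply/eqP; rewrite -subr_eq0 -normr_le0; apply/ler_addgt0Pr => e e0; rewrite add0r.
  have e2 : 0 < e / 2 by rewrite divr_gt0.
  have [T hT] := F_limit m u e2; have [T' hT'] := F_limit m' u' e2.
  have w0 : 0 < `|T| + `|T'| + 1 by rewrite ltr_wpDl // addr_ge0.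
  have h1 : T < `|T| + `|T'| + 1.
    by have := ler_norm T; have := normr_ge0 T'; lra.
  have h2 : T' < `|T| + `|T'| + 1.
    by have := ler_norm T'; have := normr_ge0 T; lra.
  have := hT (PosNum w0) h1; have := hT' (PosNum w0) h2.
  set x := F (phi m1) _ => A B.
  rewrite -(subrKA x) (le_trans (ler_normD _ _)) // [e]splitr lerD // ltW //.
  by rewrite distrC.
exists (F (phi m1) (PosNum ltr01)) => z; rewrite -[z]lift_XMK.
by case: (lift_XM z) => m u; apply: cst.
Qed.
End Section0.

Lemma approached_constants : H0_constants_only R M /\ H0_canonically_R R M.
Proof.
have const : H0_constants_only R M.
  by case=> f hf; apply: leaf_constant; apply/asboolP.
split=> //.
have cstP (c : R) : (fun _ : XM R M => c) \in @H0_pred R P M.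
  apply/asboolP; split=> [z _|m u _]; first exact: cst_continuous.
  by exists setT; split=> //; apply: filterT.
pose cst_H0 (c : R^o) : leaf_H0 R M := LeafH0 (cstP c).
have cst_lin : linear cst_H0.
  by move=> a c d; apply: val_inj; apply/funext => z.
pose phi0 : {linear R^o -> leaf_H0 R M} :=
  HB.pack cst_H0 (GRing.isLinear.Build R R^o (leaf_H0 R M) _ cst_H0 cst_lin).
exists phi0; split=> //.
pose z0 : XM R M := pr_XM ((phi m1, PosNum ltr01) : Xtilde R M).
exists (fun f : leaf_H0 R M => f z0) => // f.
by apply: val_inj; apply/funext => z /=; have [c fc] := const f; rewrite !fc.
Qed.
End LimitArgument.

Lemma constants_trivial_action (R : realType) (P : nat_pred) (M : Q0space P)
    (T : Type) (a : T -> XM R M -> XM R M) :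
  H0_constants_only R M -> H0_trivial_action a.
Proof. by move=> const t f z; have [c fc] := const f; rewrite !fc. Qed.

(** * Paths in the generic fibre *)

(** Multiplication by [w] permutes [T], so the product of all elements of [T] is unchanged by the
    factor [w ^+ n]. *)
Lemma finite_mulgrp_exp (k : fieldType) (T : set k) (n : nat) (w : k) :
  (T #= `I_n)%card -> ~ T 0 -> (forall x, T x -> T (w * x)) -> w != 0 -> w ^+ n = 1.
Proof.
move=> Tn T0 Tw w0; have fT : finite_set T by exists n.
pose s := finmap.enum_fset (fset_set T).
have sE x : x \in s <-> T x.
  have e : (x \in s) = (x \in T) := in_fset_set fT x.
  by rewrite e; split=> [/set_mem|/mem_set].
have su : uniq s by apply: finmap.fset_uniq.
have sz : size s = n by apply: card_fset_set.
have injw : injective ( *%R w) by apply: mulfI.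
have sub : {subset map ( *%R w) s <= s} by move=> _ /mapP[x /sE Tx ->]; apply/sE/Tw.
have mu : uniq (map ( *%R w) s) by rewrite map_inj_uniq.
have le_sz : (size s <= size (map ( *%R w) s))%N by rewrite size_map.
have perm : perm_eq (map ( *%R w) s) s.
  by apply: uniq_perm => // x; have [_ ->] := uniq_min_size mu sub le_sz.
have prod0 : \prod_(x <- s) x != 0.
  rewrite prodf_seq_neq0; apply/allP => x /sE Tx /=.
  by apply/eqP => x0; apply: T0; rewrite -x0.
apply: (mulIf prod0); rewrite mul1r -[RHS](perm_big _ perm) /= big_map big_split /=.
by rewrite big_const_seq count_predT sz iter_mulr_1.
Qed.

Lemma near_all (R : realType) (T : eqType) (rs : seq T) (Q : T -> R -> Prop) (s : R) :
  (forall r, r \in rs -> nbhs s (Q r)) -> nbhs s [set s' | forall r, r \in rs -> Q r s'].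
Proof.
elim: rs => [_|r rs IH h]; first by apply: filterS filterT.
have h1 : nbhs s (Q r) by apply: h; rewrite inE eqxx.
have h2 := IH (fun x xr => h x (@mem_behead _ (r :: rs) x xr)).
apply: filterS (filterI h1 h2) => s' [q1 q2] x.
by rewrite inE => /orP[/eqP ->|/q2].
Qed.

Section ComplexContinuity.
Context (R : realType).
Local Notation C := (Cplx R).

Definition absC_continuous (F : R -> C) : Prop :=
  forall s e, 0 < e -> nbhs s [set s' | absC (F s' - F s) < e].

Lemma absC_ge0 (z : C) : 0 <= absC z.
Proof. by rewrite /absC normc_def /= sqrtr_ge0. Qed.

Lemma absC_le (z : C) : absC z <= `|complex.Re z| + `|complex.Im z|.
Proof.
rewrite /absC normc_def /= -[leRHS]ger0_norm ?addr_ge0 // -sqrtr_sqr ler_wsqrtr //.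
by rewrite sqrrD !real_normK ?num_real // lerD2r lerDl mulrn_wge0 // mulr_ge0.
Qed.

Lemma absC_continuousMl (c : C) (F : R -> C) :
  absC_continuous F -> absC_continuous (fun s => c * F s).
Proof.
move=> cF s e e0; have c0 : 0 < absC c + 1 by rewrite ltr_wpDl ?absC_ge0.
apply: filterS (cF s (e / (absC c + 1)) _); last by rewrite divr_gt0.
move=> s' /=; rewrite ltr_pdivlMr // -mulrBr absCM; apply: le_lt_trans.
by rewrite mulrC ler_wpM2l ?absC_ge0 // lerDl.
Qed.

Lemma absC_continuous_cofR (f : R -> R) : continuous f -> absC_continuous (fun s => cofR (f s)).
Proof.
move=> cf s e e0; have := cf s => /cvgrPdist_lt/(_ e e0); apply: filterS => s' /=.
by rewrite -[cofR _ - cofR _]rmorphB /= -/(cofR _) /absC norm_cofR /= distrC.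
Qed.

Lemma absC_continuous_expi (b : R) : absC_continuous (fun s => expi (s * b)).
Proof.
move=> s e e0; have e2 : 0 < e / 2 by rewrite divr_gt0.
have cm : (fun s => s * b) @ s --> s * b by apply: cvgM; [exact: cvg_id|exact: cvg_cst].
have h1 : cos (t * b) @[t --> s] --> cos (s * b) by apply: continuous_cvg cm; exact: continuous_cos.
have h2 : sin (t * b) @[t --> s] --> sin (s * b) by apply: continuous_cvg cm; exact: continuous_sin.
move: h1 => /cvgrPdist_lt/(_ _ e2) h1; move: h2 => /cvgrPdist_lt/(_ _ e2) h2.
apply: filterS (filterI h1 h2) => s' [/= c1 c2].
apply: (le_lt_trans (absC_le _)); rewrite /= [e]splitr distrC.
by apply: ltrD => //; rewrite distrC.
Qed.
End ComplexContinuity.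

Section Main.
Context (R : realType)
    (X0 : scheme)
    (X0_integral : integral_scheme X0)
    (X0_flat : flat_over_Z X0)
    (X0_finite_type : finite_type_over_Z X0)
    (eta0 : X0) (eta0_generic : generic_point eta0)
    (K : closedFieldType) (iota : {rmorphism kappa eta0 -> K})
    (K_algebraic : forall z : K, algebraicOver iota z)
    (X : normalization iota) (P : nat_pred)
    (P_char : forall x : X0, {subset [pchar kappa x] <= P})
    (E : admissibleClass R P)
    (E_Ef : forall k : fieldType, class_Ef (R := R) P (k := k) `<=` E k).
Local Notation C := (Cplx R).

Let emb_bij : bijective (nz_emb X).
Proof. exact: (nz_emb_bij eta0_generic K_algebraic). Qed.
Let K_char (n : nat) : (0 < n)%N -> n%:R != 0 :> K.
Proof. exact: (closure_char X0_integral X0_flat eta0_generic iota). Qed.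
Let K_countable : countable [set: K].
Proof. exact: (closure_countable X0_integral X0_flat X0_finite_type eta0_generic K_algebraic). Qed.

(** In characteristic zero the kernel consists of exactly [val a] roots of unity, so the character
    is in the class [class_Ef]. *)
Lemma eta_char_Ef (f : K -> C) (hf : multhom f) (a : N0 P) :
  (forall x, f x = 1 <-> x ^+ val a = 1) -> E _ (eta_char X hf).
Proof.
move=> hker; apply: E_Ef; split; first exact: (kappa_eta_closed eta0_generic K_algebraic).
exists a; have [z prim_z] := closed_prim_root (K_char (N0_gt0 a)).
have [g gK Kg] := emb_bij.
have -> : char_ker (eta_char X hf) = [set g (z ^+ i) | i in `I_(val a)].
  apply/seteqP; split=> [x /hker xa|_ [i _ <-]].
    have [[i ia] /= ei] := prim_rootP prim_z xa.
    by exists i => //; rewrite -ei gK.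
  by apply/hker; rewrite Kg -exprM mulnC exprM (prim_expr_order prim_z) expr1n.
apply: inj_card_eq => i j /set_mem /= ia /set_mem /= ja /(can_inj Kg)/eqP.
by rewrite (eq_prim_root_expr prim_z) !modn_small // => /eqP.
Qed.

Definition checkE_pt (n : N0 P) (y : dotX R X) (Ey : E _ (dot_char y)) : checkE X E :=
  exist _ (check_mk n y) (mem_set (ex_intro _ n (ex_intro _ y (conj Ey erefl)))).

Definition eta_pt (n : N0 P) (f : K -> C) (hf : multhom f) (Ef : E _ (eta_char X hf)) : check_eta X E :=
  exist _ (@checkE_pt n (eta_dot X hf) Ef) (mem_set (check_prE n (eta_dot X hf))).

(** A neighbourhood is controlled by finitely many functions, so pointwise continuity in [s] makes
    the path continuous. *)
Lemma path_eta_pt (n : N0 P) (F : R -> K -> C) (hF : forall s, multhom (F s))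
    (EF : forall s, E _ (eta_char X (hF s))) (a b : R) :
  (forall x, absC_continuous (fun s => F s x)) ->
  linked R (eta_pt n (EF a)) (eta_pt n (EF b)).
Proof.
move=> cF; apply: (@path_linked R _ (fun s => eta_pt n (EF s))) => s V /subtype_nbhs[W nW WV].
have [U [hy [rs [e [aU e0 he]]]]] :=
  @checkE_nbhs _ _ _ _ _ _ _ E n (eta_dot X (hF s)) (@checkE_pt n (eta_dot X (hF s)) (EF s)) W erefl nW.
have near_s : nbhs s [set s' | forall r, r \in rs ->
    absC (F s' (nz_emb X (eval hy r)) - F s (nz_emb X (eval hy r))) < e].
  by apply: near_all => r _; apply: cF.
apply: filterS near_s => s' close; apply: WV.
exact: (he (eta_dot X (hF s')) hy).
Qed.

Section Approximation.
Context (th : K -> C) (L : K -> R) (th_hom : multhom th)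
  (th_abs : forall x, x != 0 -> absC (th x) = 1) (th_inj : forall x, th x = 1 -> x = 1)
  (L_hom : addhom L) (L_tors : forall x, x != 0 -> L x = 0 -> tors x).

Lemma mkchar_hom (a : nat) (rho beta : K -> R) :
  addhom rho -> addhom beta -> multhom (mkchar th a rho beta).
Proof.
have [th0 th1 thM] := th_hom.
move=> hr hb; split; rewrite /mkchar ?eqxx //.
  by rewrite oner_eq0 (addhom1 hr) (addhom1 hb) expR0 expi0 th1 expr1n /cofR rmorph1 !mulr1.
move=> x y; rewrite mulf_eq0; have [_|x0] := eqVneq x 0; first by rewrite mul0r.
have [_|y0] := eqVneq y 0; first by rewrite mulr0.
by rewrite /= hr // hb // expRD cofRM expiD thM exprMn; ring.
Qed.

(** The absolute value forces [rho x = 0]. Then [beta x = 0], either by assumption or because [x] is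
    torsion, and injectivity of [th] concludes. The two alternatives serve the two legs of the
    path. *)
Lemma mkchar_ker (a : N0 P) (rho beta : K -> R) (x : K) : addhom rho -> addhom beta ->
  (forall y, beta y = 0) \/ (forall y, y != 0 -> rho y = 0 -> tors y) ->
  mkchar th (val a) rho beta x = 1 <-> x ^+ val a = 1.
Proof.
have [th0 th1 thM] := th_hom; have a0 := N0_gt0 a.
have thX y n : th (y ^+ n) = th y ^+ n by have := multhomXz y n th_hom.
move=> hr hb h; rewrite /mkchar; have [->|x0] := eqVneq x 0.
  by rewrite expr0n gtn_eqF //; split=> /eqP; rewrite eq_sym oner_eq0.
split=> [e|xa]; last first.
  by rewrite (addhom_torsion hr a0 xa) (addhom_torsion hb a0 xa) expR0 expi0 -thX xa th1
    /cofR rmorph1 !mulr1.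
have rho0 : rho x = 0.
  have := congr1 (@absC R) e; rewrite absC1 !absCM absC_expi absCX th_abs // expr1n !mulr1.
  rewrite absC_cofR ?expR_ge0 // => /(congr1 (@ln R)).
  by rewrite expRK ln1.
have beta0 : beta x = 0.
  by case: h => [//|/(_ x x0 rho0)[n [n0 xn]]]; apply: (addhom_torsion hb n0 xn).
move: e; rewrite rho0 beta0 expR0 expi0 /cofR rmorph1 mul1r mulr1 -thX; exact: th_inj.
Qed.

Let zero : K -> R := fun=> 0.
Let zero_hom : addhom zero := @addhom0 R K.

Let mk_E (a : N0 P) (rho beta : K -> R) (hr : addhom rho) (hb : addhom beta) :
  (forall y, beta y = 0) \/ (forall y, y != 0 -> rho y = 0 -> tors y) ->
  E _ (eta_char X (mkchar_hom (val a) hr hb)).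
Proof. by move=> h; apply: (@eta_char_Ef _ _ a) => x; apply: mkchar_ker. Qed.

Let one := N0_one P.

Let base_E : E _ (eta_char X (mkchar_hom (val one) zero_hom zero_hom)).
Proof. by apply: mk_E; left. Qed.

Definition base_pt : check_eta X E := eta_pt one base_E.

Lemma base_pt_act (b n : N0 P) (Eb : E _ (eta_char X (mkchar_hom (val b) zero_hom zero_hom))) :
  q0_act ((val b)%:R / (val n)%:R) base_pt = eta_pt n Eb.
Proof.
have hq : Q0 P ((val b)%:R / (val n)%:R) by exists b, n.
apply: val_inj; rewrite val_sub_act //; apply: val_inj; rewrite val_sub_act //.
rewrite -[LHS]/(check_F _ (check_mk one _)) check_FE N0_mulC N0_mul1.
congr (check_mk n _); apply: dotX_eq => // U hy hz s /=.
rewrite (Prop_irrelevance hz hy) /= rmorphXn /mkchar expf_eq0 (N0_gt0 b) /=.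
case: eqP => // _; rewrite expr1.
by have := multhomXz (nz_emb X (eval hy s)) (val b) th_hom => ->.
Qed.

(* First the absolute value is moved, with the injective argument [th ^+ b] kept
   fixed, and then the argument, with an absolute value of torsion kernel. *)
Lemma base_pt_linked (b n : N0 P) (rho beta : K -> R) (hr : addhom rho) (hb : addhom beta)
    (rho_tors : forall x, x != 0 -> rho x = 0 -> tors x) :
  linked R (q0_act ((val b)%:R / (val n)%:R) base_pt)
    (eta_pt n (mk_E b hr hb (or_intror rho_tors))).
Proof.
pose hr' s := addhomZ s hr; pose hb' s := addhomZ s hb.
have E1 s : E _ (eta_char X (mkchar_hom (val b) (hr' s) zero_hom)) by apply: mk_E; left.
have E2 s : E _ (eta_char X (mkchar_hom (val b) hr (hb' s))) by apply: mk_E; right.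
have pt_eq (f g : K -> C) (hf : multhom f) (hg : multhom g) (Ef : E _ (eta_char X hf))
    (Eg : E _ (eta_char X hg)) : f =1 g -> eta_pt n Ef = eta_pt n Eg.
  move=> /funext fg; subst g; rewrite (Prop_irrelevance hg hf) in Eg *.
  by rewrite (Prop_irrelevance Eg Ef).
have c1 x : absC_continuous (fun s => mkchar th (val b) (fun y => s * rho y) zero x).
  rewrite /mkchar; case: eqVneq => [_|x0].
    by move=> s e e0; apply: filterS filterT => s' _ /=; rewrite subrr /absC normr0.
  under eq_fun do rewrite -mulrA mulrC.
  apply: absC_continuousMl; apply: absC_continuous_cofR => s.
  apply: continuous_cvg; first exact: continuous_expR.
  by apply: cvgM; [exact: cvg_id|exact: cvg_cst].
have c2 x : absC_continuous (fun s => mkchar th (val b) rho (fun y => s * beta y) x).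
  rewrite /mkchar; case: eqVneq => [_|x0].
    by move=> s e e0; apply: filterS filterT => s' _ /=; rewrite subrr /absC normr0.
  by apply: absC_continuousMl; apply: absC_continuous_expi.
rewrite (base_pt_act n (mk_E b zero_hom zero_hom (or_introl (fun=> erefl)))).
have := path_eta_pt n E1 0 1 c1; have := path_eta_pt n E2 0 1 c2 => l2 l1.
apply: linked_trans (linked_trans l1 _); first last.
  have -> : eta_pt n (E1 1) = eta_pt n (E2 0).
    by apply: pt_eq => x; rewrite /mkchar mul1r mul0r.
  suff <- : eta_pt n (E2 1) = eta_pt n (mk_E b hr hb (or_intror rho_tors)) by [].
  by apply: pt_eq => x; rewrite /mkchar mul1r.
suff -> : eta_pt n (mk_E b zero_hom zero_hom (or_introl (fun=> erefl))) = eta_pt n (E1 0) by [].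
by apply: pt_eq => x; rewrite /mkchar mul0r.
Qed.

Lemma residue_char_mem (l : nat) (x : X) : prime l -> l%:R = 0 :> kappa x -> l \in P.
Proof.
move=> pl lx; apply: (@P_char (nz_proj X x) l); apply/andP; split=> //; apply/eqP.
by apply: (fmorph_inj (kappa_map (nz_proj X) x)); rewrite rmorph_nat rmorph0.
Qed.

Lemma base_pt_approaches (z : checkE X E) (O : set (checkE X E)) : nbhs z O ->
  exists (n : N0 P) (a N : nat), (0 < N)%N /\ forall k : nat, exists b : N0 P,
    val b = (a + k * N)%N /\ exists w : check_eta X E,
      linked R (q0_act ((val b)%:R / (val n)%:R) base_pt) w /\ O (\val w).
Proof.
move=> nO; have [n [y [Ey ez]]] := set_mem (valP z).
have [U [hy [rs [e [aU e0 he]]]]] := checkE_nbhs ez nO.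
have U0 : (U : set X0) !=set0 by exists (nz_proj X (dot_pt y)).
have [h0 h] := generic_affine eta0_generic X U0.
pose em r := nz_emb X (eval h r).
have em_inj : injective em by apply: nz_inj aU.
have [emB emM em1] : [/\ {morph em : r s / r - s}, {morph em : r s / r * s} & em 1 = 1].
  by split=> [r s|r s|]; rewrite /em ?rmorphB ?rmorphM ?rmorph1.
have em0 : em 0 = 0 by rewrite /em !rmorph0.
pose chi := dot_char y.
(* [em] identifies the functions over [U] with a subring of [K], along which [chi] is transported;
   outside this subring the default of [xget] makes [t] zero. *)
pose t (x : K) : C := chi (eval hy (xget 0 [set r | em r = x])).
have tE r : t (em r) = chi (eval hy r).
  rewrite /t; case: xgetP => [r' _ /em_inj -> //|/(_ r)]; by case.
have [chi0 chi1 chiM] : [/\ chi 0 = 0, chi 1 = 1 & {morph chi : a b / a * b}].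
  by split; [exact: char0|exact: char1|exact: charM].
have [c [c0 Pc]] := residue_characteristics X0_integral X0_flat X0_finite_type eta0_generic P_char.
have tP l x : prime l -> l.-primitive_root x -> t x = 1 -> l \in P.
  move=> pl prim_x; have l0 := prime_gt0 pl.
  have tx : tors x by exists l; rewrite (prim_expr_order prim_x).
  have [r er] := torsion_integral h aU tx.
  move: prim_x; rewrite -er -/(em r) tE => prim_x chir.
  have rl : r ^+ l = 1.
    by apply: em_inj; rewrite em1 /em !rmorphXn (prim_expr_order prim_x).
  pose w := eval hy r.
  have wl : w ^+ l = 1 by rewrite -rmorphXn rl rmorph1.
  (* If the root of unity [r] reduces to 1, the vanishing sum of its powers [r ^+ i], [i < l],
     reduces to [l = 0]. Otherwise [w] has order [l] and acts by multiplication on the finite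
     torsion part of the kernel of [chi], so [l] divides its order. *)
  have [w1|w1] := eqVneq w 1.
    apply: (@residue_char_mem l (dot_pt y) pl).
    have sum0 : \sum_(i < l) r ^+ i = 0.
      apply: em_inj; rewrite em0.
      have x1 : em r != 1.
        apply/eqP => x1; have := eq_prim_root_expr prim_x 1 0; rewrite x1 !expr1n eqxx => /esym.
        by rewrite (modn_small (prime_gt1 pl)) mod0n.
      have := subrX1 (em r) l; rewrite (prim_expr_order prim_x) subrr => /esym/eqP.
      rewrite mulf_eq0 subr_eq0 (negbTE x1) /= => /eqP <-.
      by rewrite /em !rmorph_sum; apply: eq_bigr => i _; rewrite !rmorphXn.
    have := congr1 (eval hy) sum0; rewrite rmorph_sum rmorph0 => <-.
    rewrite (eq_bigr (fun=> 1)) ?sumr_const ?card_ord // => i _.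
    by transitivity (w ^+ i); [exact: rmorphXn|rewrite w1 expr1n].
  have [m Tm] := adm_tors Ey.
  have w0 : w != 0 by apply: contra_eq_neq wl => ->; rewrite expr0n gtn_eqF // eq_sym oner_neq0.
  have wm : w ^+ val m = 1.
    apply: (finite_mulgrp_exp Tm) => //.
      by move=> [_ [k [k0 /eqP]]]; rewrite expr0n gtn_eqF // eq_sym oner_eq0.
    move=> u [cu [k [k0 uk]]]; split.
      by rewrite /char_ker /= charM cu mulr1.
    exists (l * k)%N; rewrite muln_gt0 l0 k0; split=> //.
    by rewrite exprMn exprM wl expr1n mulnC exprM uk expr1n mul1r.
  have prim_w := prime_primitive_root pl wl w1.
  have : (l %| val m)%N by rewrite (prim_order_dvd prim_w) wm.
  by have /pnatP := valP m; move=> /(_ (N0_gt0 m)); apply.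
pose S : set K := range em.
have S1 : S 1 by exists 1.
have SM u v : S u -> S v -> S (u * v).
  by move=> [r _ <-] [s _ <-]; exists (r * s).
have St : @tors K `<=` S.
  by move=> u tu; have [r er] := torsion_integral h aU tu; exists r.
have t0 : t 0 = 0 by rewrite -em0 tE rmorph0.
have t1 : t 1 = 1 by rewrite -em1 tE rmorph1.
have tM u v : S u -> S v -> t (u * v) = t u * t v.
  by move=> [r _ <-] [s _ <-]; rewrite -emM !tE rmorphM chiM.
have rsS u : u \in [seq em r | r <- rs] -> S u by move=> /mapP[r _ ->]; exists r.
have [a [N [N_gt0 hN]]] := approximate_character th_hom th_abs th_inj L_hom L_tors
  K_countable K_char c0 Pc S1 SM St t0 t1 tM tP rsS e0.
exists n, a, N; split=> // k; have [Pk [rho [beta [hr hb rho_tors close]]]] := hN k.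
pose b : N0 P := exist _ (a + k * N)%N Pk.
exists b; split=> //; exists (eta_pt n (mk_E b hr hb (or_intror rho_tors))); split.
  exact: base_pt_linked.
apply: (he (eta_dot X (mkchar_hom (val b) hr hb)) h) => [r rr|]; last by [].
by rewrite -[dot_char y _]tE; apply: close; apply: map_f.
Qed.
End Approximation.

Lemma exists_base_pt : exists m1 : check_eta X E,
  forall (z : checkE X E) (O : set (checkE X E)), nbhs z O ->
  exists (n : N0 P) (a N : nat), (0 < N)%N /\ forall k : nat, exists b : N0 P,
    val b = (a + k * N)%N /\ exists w : check_eta X E,
      linked R (q0_act ((val b)%:R / (val n)%:R) m1) w /\ O (\val w).
Proof.
have [th [L [th_hom th_abs th_inj L_hom L_tors]]] := unitary_injective_character R K_countable.
exists (base_pt th_hom th_abs th_inj); exact: base_pt_approaches L_hom L_tors.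
Qed.
End Main.

(** * Passage to the four spaces *)

Lemma subtype_val_continuous (T : topologicalType) (A : set T) : continuous (fun x : A => \val x).
Proof. exact: initial_continuous. Qed.

Theorem theorem10p2 (R : realType)
    (X0 : scheme)
    (X0_integral : integral_scheme X0)
    (X0_normal : normal_scheme X0)
    (X0_flat : flat_over_Z X0)
    (X0_finite_type : finite_type_over_Z X0)
    (eta0 : X0) (eta0_generic : generic_point eta0)
    (K : closedFieldType) (iota : {rmorphism kappa eta0 -> K})
    (K_algebraic : forall z : K, algebraicOver iota z)
    (X : normalization iota) (A : galoisAction X)
    (P : nat_pred) (P_prime : {subset P <= prime})
    (P_char : forall x : X0, {subset [pchar kappa x] <= P})
    (E : admissibleClass R P)
    (E_Ef : forall k : fieldType, class_Ef (R := R) P (k := k) `<=` E k) :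
  [/\ [/\ H0_constants_only R (check_eta X E),
          H0_canonically_R R (check_eta X E) &
          H0_trivial_action (fun (g : galois iota * {posnum R}) (z : XM R (check_eta X E)) =>
            flow g.2 (XM_map (check_eta_act A g.1) z))],
      [/\ H0_constants_only R (checkE X E),
          H0_canonically_R R (checkE X E) &
          H0_trivial_action (fun (g : galois iota * {posnum R}) (z : XM R (checkE X E)) =>
            flow g.2 (XM_map (checkE_act A g.1) z))],
      [/\ H0_constants_only R (check0_eta E A),
          H0_canonically_R R (check0_eta E A) &
          H0_trivial_action (@flow R P (check0_eta E A))] &
      [/\ H0_constants_only R (check0 E A),
          H0_canonically_R R (check0 E A) &
          H0_trivial_action (@flow R P (check0 E A))]].
Proof.
have [m1 acc] := exists_base_pt X0_integral X0_flat X0_finite_type eta0_generic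
  K_algebraic X P_char E_Ef.
(* The last premise pulls a neighbourhood in [M] back to one in [checkE X E], the only space in
   which the approximation was carried out. *)
have finish (M : Q0space P) (phi : check_eta X E -> M) (T : Type) (a : T -> XM R M -> XM R M) :
    continuous phi ->
    (forall q, Q0 P q -> forall m, phi (q0_act q m) = q0_act q (phi m)) ->
    (forall (m : M) (O : set M), nbhs m O -> exists z : checkE X E, exists2 W : set (checkE X E), nbhs z W &
       forall w : check_eta X E, W (\val w) -> O (phi w)) ->
    [/\ H0_constants_only R M, H0_canonically_R R M & H0_trivial_action a].
  move=> phi_cont phi_act dense.
  have [|const can] := @approached_constants R P _ M m1 phi phi_cont phi_act; last first.
    by split=> //; apply: constants_trivial_action.
  move=> m V nV; have [z [W nW WV]] := dense m V nV; have [n [b [N [N0 h]]]] := acc z W nW.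
  exists n, b, N; split=> // k; have [c [ec [w [lw Ww]]]] := h k.
  by exists c; split=> //; exists w; split=> //; apply: WV.
pose Q := quotient_topology {eq_quot (galois_equiv E A)}%qT.
pose phi0 (w : check_eta X E) : check0 E A := (\pi_Q (\val w))%qT.
have phi0_cont : continuous phi0.
  move=> w; apply: continuous_comp; first exact: subtype_val_continuous.
  exact: pi_continuous.
have equiv_act q : Q0 P q -> forall z w : checkE X E,
    galois_equiv E A z w -> galois_equiv E A (q0_act q z) (q0_act q w).
  by move=> hq z w /asboolP[s <-]; apply/asboolP; exists s; apply: checkE_act_F.
have phi0_act q : Q0 P q -> forall m, phi0 (q0_act q m) = q0_act q (phi0 m).
  move=> hq m; apply: etrans (esym (quo_actE equiv_act (\val m) hq)).
  by apply: (congr1 \pi_Q%qT); apply: val_sub_act.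
have phi0_pr w : check0_pr (phi0 w) = eta0.
  by rewrite [LHS]check0_prE (set_mem (valP w)) nz_proj_eta.
pose phi1 w : check0_eta E A := exist _ (phi0 w) (mem_set (phi0_pr w)).
have dense0 (c : check0 E A) (V : set (check0 E A)) : nbhs c V ->
    exists z : checkE X E, exists2 W : set (checkE X E), nbhs z W &
      forall w : check_eta X E, W (\val w) -> V (phi0 w).
  move=> nV; exists (repr (c : Q)), ((fun z : checkE X E => (\pi_Q z)%qT) @^-1` V); last by [].
  by apply: (@pi_continuous _ {eq_quot (galois_equiv E A)}%qT); rewrite reprK.
pose phi2 (w : check_eta X E) : checkE X E := \val w.
split.
- apply: (finish (check_eta X E) id) => [w|//|w V /subtype_nbhs[W nW WV]]; first exact: cvg_id.
  by exists (\val w); exists W.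
- apply: (finish (checkE X E) phi2) => [|q hq m|m V nV].
  + exact: (@subtype_val_continuous (checkE X E)).
  + exact: val_sub_act.
  + by exists m; exists V.
- apply: (finish (check0_eta E A) phi1) => [w V|q hq m|m V].
  + move=> /subtype_nbhs[W nW WV]; have h : nbhs w (phi0 @^-1` W) := phi0_cont w _ nW.
    suff : nbhs w (phi1 @^-1` V) by [].
    by apply: filterS h => w' Ww'; apply: WV.
  + by apply: val_inj; rewrite [RHS]val_sub_act //; apply: phi0_act.
  + move=> /subtype_nbhs[W nW WV]; have [z [W' nW' hW']] := dense0 _ _ nW.
    by exists z; exists W' => // w Ww; apply: WV; apply: hW'.
- exact: (finish (check0 E A) phi0).
Qed.
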